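(* Let $H$ be an infinite dimensional separable complex Hilbert space and let $V=B(H)_{sa}$ as a JB-algebra. Then: 1. $g\in G(\Omega)$ if and only if there exists a bounded invertible linear or antilinear map $f:H\to H$ such that $g(A)=fAf^\dagger$ for all $A\in V$, where $\dagger$ denotes the usual adjoint (resp. the conjugate adjoint). 2. If $g(A)=fAf^\dagger$ is as in item 1, then $g^*(A)=f^\dagger Af$. 3. Assume $g(A)=fAf^\dagger=hAh^\dagger$ for all $A\in V$, with each of $f,h$ bounded invertible and linear or antilinear. Then either both $f,h$ are linear or both are antilinear, and there exists $\lambda\in S^1$ such that $f=\lambda h$. 4. The decomposition $g=U_xk$ with $x\in\Omega$, $k\in\mathrm{Aut}(V)$ of $g=f\cdot f^\dagger\in G(\Omega)$ is given by $x=|f^\dagger|$ and $k(A)=WAW^\dagger$ for some unitary or antiunitary operator $W$ of $H$; i.e. if $f=|f^\dagger|W$ is the polar decomposition of $f$, then $g(A)=|f^\dagger|WAW^\dagger|f^\dagger|$. 5. $g=f\cdot f^\dagger\in\mathrm{Aut}(V)$ if and only if $f$ is unitary or antiunitary. 6. The set of linear maps $f$ and the set of antilinear maps $f$ induce the two connected components of $G(\Omega)$ (i.e. $\{f\cdot f^\dagger: f\text{ linear}\}$ and $\{f\cdot f^\dagger:f\text{ antilinear}\}$ are the two components), and the set of unitary maps and the set of antiunitary maps induce the two connected components of $\mathrm{Aut}(V)$.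
   Context: $V=B(H)_{sa}$ is the real Banach space of bounded self-adjoint operators on $H$ with the operator norm and Jordan product $A\circ B=\frac12(AB+BA)$. $\Omega\subset V$ is the set of positive invertible operators. $GL(V)$ is the group of bounded invertible real-linear operators on $V$ with the norm topology. $U_X(A)=XAX$. $G(\Omega)=\{g\in GL(V):g(\Omega)=\Omega\}$; $\mathrm{Aut}(V)$ is the group of $k\in GL(V)$ with $k(A\circ B)=k(A)\circ k(B)$. For $g\in G(\Omega)$ (which lies in the structure group of $V$), $g^*\in GL(V)$ is the operator with $U_{g(X)}=gU_Xg^*$ for all $X\in V$; equivalently $g^*=g^{-1}U_{g(1)}$. A map $f:H\to H$ is antilinear if it is additive and $f(\lambda x)=\overline\lambda f(x)$; for bounded antilinear $f$ the conjugate adjoint $f^\dagger$ is the unique antilinear operator with $\langle fx,y\rangle=\overline{\langle x,f^\dagger y\rangle}$ for all $x,y$. For linear $f$, $f^\dagger$ is the usual adjoint. $|f^\dagger|=\sqrt{ff^\dagger}$. An antiunitary operator is a (surjective) antilinear $W$ with $\langle Wx,Wy\rangle=\overline{\langle x,y\rangle}$, equivalently $W^{-1}=W^\dagger$. Every bounded invertible linear (antilinear) $f$ has a polar decomposition $f=|f^\dagger|W$ with $W$ unitary (antiunitary). $f\cdot f^\dagger$ denotes the map $A\mapsto fAf^\dagger$. *)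

(* Defs.v *)
From HB Require Import structures.
From mathcomp Require Import all_boot all_order all_algebra.
From mathcomp Require Import all_classical all_reals all_analysis.
From mathcomp Require Import complex.

Set Implicit Arguments.
Unset Strict Implicit.
Unset Printing Implicit Defensive.

Import Order.TTheory GRing.Theory Num.Theory.
Import numFieldNormedType.Exports.

Local Open Scope classical_set_scope.
Local Open Scope ring_scope.

Local Notation "x %:C" := (real_complex _ x) : ring_scope.

(* The conjugation [z^*] below is [Num.conj] on the field R[i]; the order on
   R[i] is the partial one, so that [0 <= z] means that z is real and
   nonnegative. *)

HB.mixin Record CompleteNormedModule_isHilbert (R : realType) (H : Type)
    & CompleteNormedModule R[i] H := {
  inner : H -> H -> R[i];
  inner_linearl : forall (a : R[i]) (x y z : H),
    inner (a *: x + y) z = a * inner x z + inner y z;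
  inner_conj : forall x y : H, inner y x = (inner x y)^*;
  inner_norm : forall x : H, inner x x = `|x| ^+ 2
}.

#[short(type="hilbertType")]
HB.structure Definition Hilbert (R : realType) :=
  { H of CompleteNormedModule R[i] H & CompleteNormedModule_isHilbert R H }.

Definition separable (T : topologicalType) : Prop :=
  exists S : set T, countable S /\ dense S.

Definition infinite_dimensional (K : fieldType) (E : lmodType K) : Prop :=
  forall (n : nat) (e : 'I_n -> E),
    exists x : E, forall c : 'I_n -> K, x <> \sum_(i < n) c i *: e i.

Definition bounded_map (K : numFieldType) (E F : normedModType K)
    (f : E -> F) : Prop :=
  exists M : K, forall x, `|f x| <= M * `|x|.

Definition bounded_invertible (K : numFieldType) (E F : normedModType K)
    (f : E -> F) : Prop :=
  bounded_map f /\
  exists h : F -> E, [/\ bounded_map h, cancel f h & cancel h f].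

Lemma bounded_map_ge0 (K : numFieldType) (E F : normedModType K) (f : E -> F) :
  bounded_map f -> exists2 M : K, 0 <= M & forall x, `|f x| <= M * `|x|.
Proof.
move=> [M fM]; exists `|M| => // x.
by rewrite -[`|x|]normr_id -normrM ger0_norm// (le_trans _ (fM x)).
Qed.

Lemma bounded_map_comp (K : numFieldType) (E F G : normedModType K)
    (f : E -> F) (h : F -> G) :
  bounded_map f -> bounded_map h -> bounded_map (h \o f).
Proof.
move=> [M fM] /bounded_map_ge0[N N0 hN]; exists (N * M) => x.
by rewrite (le_trans (hN _))// -mulrA ler_wpM2l.
Qed.

Section BoundedOperators.
Variables (R : realType) (E F : normedModType R).

Definition blin_pred : {pred E -> F} :=
  [pred f : E -> F | `[< linear f /\ bounded_map f >]].

Lemma blin_pred_submod : submod_closed blin_pred.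
Proof.
split.
  apply/asboolP; split; first by move=> a x y; rewrite /= scaler0 addr0.
  by exists 0 => x; rewrite mul0r normr0.
move=> a f g /asboolP[fl [M fM]] /asboolP[gl [N gN]].
apply/asboolP; split.
  move=> b x y; rewrite !fctE fl gl !scalerDr !scalerA addrACA.
  by rewrite [a * b]mulrC.
exists (`|a| * M + N) => x; rewrite !fctE (le_trans (ler_normD _ _))// mulrDl.
by rewrite lerD// normrZ -mulrA ler_wpM2l.
Qed.

HB.instance Definition _ :=
  GRing.isSubmodClosed.Build R (E -> F) blin_pred blin_pred_submod.

(* Bounded R-linear maps E -> F with the operator norm *)
Record BL := MkBL { BL_val :> E -> F; _ : BL_val \in blin_pred }.

HB.instance Definition _ := [isSub for BL_val].
HB.instance Definition _ := [Choice of BL by <:].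
HB.instance Definition _ := [SubChoice_isSubLmodule of BL by <:].

Definition BL_opnorm (f : BL) : R :=
  sup [set `|f x| | x in [set x : E | `|x| <= 1]].

Lemma BL_linear (f : BL) : linear f.
Proof. by have /asboolP[] := valP f. Qed.

Lemma BL_bounded (f : BL) : bounded_map f.
Proof. by have /asboolP[] := valP f. Qed.

Lemma BL_has_sup (f : BL) :
  has_sup [set `|f x| | x in [set x : E | `|x| <= 1]].
Proof.
split; first by exists `|f 0|, 0 => //=; rewrite normr0.
have [M fM] := BL_bounded f; exists `|M| => _ [x /= x1 <-].
apply: le_trans (fM x) _; apply: le_trans (ler_norm _) _.
by rewrite normrM normr_id ler_piMr.
Qed.

Lemma BL_opnorm_ub (f : BL) (x : E) : `|x| <= 1 -> `|f x| <= BL_opnorm f.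
Proof. by move=> x1; apply: ub_le_sup; [case: (BL_has_sup f)|exists x]. Qed.

Lemma BL_opnorm_le (f : BL) (M : R) :
  (forall x, `|x| <= 1 -> `|f x| <= M) -> BL_opnorm f <= M.
Proof.
by move=> fM; apply: ge_sup; [case: (BL_has_sup f)|move=> _ [x /= /fM ? <-]].
Qed.

Lemma BL_opnormD (f g : BL) : BL_opnorm (f + g) <= BL_opnorm f + BL_opnorm g.
Proof.
apply: BL_opnorm_le => x x1; apply: le_trans (ler_normD _ _) _.
by rewrite lerD// BL_opnorm_ub.
Qed.

Lemma BL_opnormZ_le (a : R) (f : BL) : BL_opnorm (a *: f) <= `|a| * BL_opnorm f.
Proof.
by apply: BL_opnorm_le => x x1; rewrite normrZ ler_wpM2l// BL_opnorm_ub.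
Qed.

Lemma BL_opnorm_ge0 (f : BL) : 0 <= BL_opnorm f.
Proof. by apply: le_trans (BL_opnorm_ub f (x := 0) _); rewrite ?normr0. Qed.

Lemma BL_opnormZ (a : R) (f : BL) : BL_opnorm (a *: f) = `|a| * BL_opnorm f.
Proof.
apply/le_anti; rewrite BL_opnormZ_le/=; have [->|a0] := eqVneq a 0.
  by rewrite normr0 mul0r BL_opnorm_ge0.
rewrite mulrC -ler_pdivlMr ?normr_gt0// mulrC -normfV.
by apply: le_trans (BL_opnormZ_le _ _); rewrite scalerA mulVf// scale1r.
Qed.

Lemma BL_opnorm_eq0 (f : BL) : BL_opnorm f = 0 -> f = 0.
Proof.
move=> f0; apply/val_inj/funext => x /=; apply/eqP; rewrite -normr_le0.
have lin0 : f 0 = 0.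
  by have := BL_linear f (-1) 0 0; rewrite scaler0 addr0 scaleN1r addNr.
have [->|x0] := eqVneq x 0; first by rewrite lin0 normr0.
have : `|f (`|x|^-1 *: x)| <= BL_opnorm f.
  apply: BL_opnorm_ub.
  by rewrite normrZ normfV normr_id mulVf// normr_eq0.
have := BL_linear f `|x|^-1 x 0; rewrite !addr0 lin0 addr0 => ->.
rewrite f0 normrZ normfV normr_id pmulr_rle0// invr_gt0 normr_gt0//.
Qed.

HB.instance Definition _ :=
  Lmodule_isNormed.Build R BL BL_opnormD BL_opnormZ BL_opnorm_eq0.

End BoundedOperators.

Section SelfAdjointOperators.
Variables (R : realType) (H : hilbertType R).

Definition sa_pred : {pred H -> H} :=
  [pred A : H -> H | `[< [/\ linear A, bounded_map A &
                          forall x y, inner (A x) y = inner x (A y)] >]].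

Lemma innerDl (x y z : H) : inner (x + y) z = inner x z + inner y z.
Proof. by have := inner_linearl 1 x y z; rewrite scale1r mul1r. Qed.

Lemma inner0l (z : H) : inner 0 z = 0.
Proof. by have := inner_linearl (-1) 0 0 z; rewrite scaler0 addr0 mulN1r addNr. Qed.

Lemma innerZl (a : R[i]) (x z : H) : inner (a *: x) z = a * inner x z.
Proof. by have := inner_linearl a x 0 z; rewrite addr0 inner0l addr0. Qed.

Lemma innerDr (x y z : H) : inner x (y + z) = inner x y + inner x z.
Proof. by rewrite inner_conj innerDl rmorphD /= -!inner_conj. Qed.

Lemma innerZr (a : R[i]) (x z : H) : inner x (a *: z) = a^* * inner x z.
Proof. by rewrite inner_conj innerZl rmorphM /= -!inner_conj. Qed.

Lemma inner0r (x : H) : inner x 0 = 0.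
Proof. by rewrite inner_conj inner0l rmorph0. Qed.

Lemma conjC_real (r : R) : (r%:C)^* = r%:C :> R[i].
Proof. by apply/CrealP; rewrite complex_real. Qed.

Lemma sa_predZD (r : R) (A B : H -> H) :
  A \in sa_pred -> B \in sa_pred -> r%:C *: A + B \in sa_pred.
Proof.
move=> /asboolP[Al [M AM] As] /asboolP[Bl [N BN] Bs]; apply/asboolP; split.
- move=> b x y; rewrite !fctE Al Bl !scalerDr !scalerA addrACA.
  by rewrite [_ * b]mulrC.
- exists (`|r%:C| * M + N) => x; rewrite !fctE (le_trans (ler_normD _ _))//.
  by rewrite mulrDl lerD// normrZ -mulrA ler_wpM2l.
- move=> x y; rewrite !fctE innerDl innerDr innerZl innerZr As Bs.
  by rewrite conjC_real.
Qed.

Lemma sa_pred0 : 0 \in sa_pred.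
Proof.
apply/asboolP; split.
- by move=> b x y; rewrite /= scaler0 addr0.
- by exists 0 => x; rewrite mul0r normr0.
- by move=> x y; rewrite /= inner0l inner0r.
Qed.

Lemma sa_pred_zmod : zmod_closed sa_pred.
Proof.
split; first exact: sa_pred0.
move=> A B As Bs; rewrite addrC.
by have := sa_predZD (-1) Bs As; rewrite rmorphN1 scaleN1r.
Qed.

HB.instance Definition _ :=
  GRing.isZmodClosed.Build (H -> H) sa_pred sa_pred_zmod.

(* The real Banach space V = B(H)_sa *)
Record Bsa := MkBsa { Bsa_val :> H -> H; _ : Bsa_val \in sa_pred }.

HB.instance Definition _ := [isSub for Bsa_val].
HB.instance Definition _ := [Choice of Bsa by <:].
HB.instance Definition _ := [SubChoice_isSubZmodule of Bsa by <:].

Lemma Bsa_linear (A : Bsa) : linear A.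
Proof. by have /asboolP[] := valP A. Qed.

Lemma Bsa_bounded (A : Bsa) : bounded_map A.
Proof. by have /asboolP[] := valP A. Qed.

Lemma Bsa_sym (A : Bsa) (x y : H) : inner (A x) y = inner x (A y).
Proof. by have /asboolP[] := valP A. Qed.

Lemma Bsa_scale_subproof (r : R) (A : Bsa) : r%:C *: (A : H -> H) \in sa_pred.
Proof. by have := sa_predZD r (valP A) sa_pred0; rewrite addr0. Qed.

Definition Bsa_scale (r : R) (A : Bsa) : Bsa := MkBsa (Bsa_scale_subproof r A).

Lemma Bsa_scaleA (a b : R) (A : Bsa) :
  Bsa_scale a (Bsa_scale b A) = Bsa_scale (a * b) A.
Proof. by apply: val_inj; rewrite /= scalerA rmorphM. Qed.

Lemma Bsa_scale1 : left_id 1 Bsa_scale.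
Proof. by move=> A; apply: val_inj; rewrite /= rmorph1 scale1r. Qed.

Lemma Bsa_scaleDr : right_distributive Bsa_scale +%R.
Proof. by move=> a A B; apply: val_inj; rewrite /= scalerDr. Qed.

Lemma Bsa_scaleDl (A : Bsa) : {morph Bsa_scale^~ A : a b / a + b}.
Proof. by move=> a b; apply: val_inj; rewrite /= rmorphD scalerDl. Qed.

HB.instance Definition _ := GRing.Zmodule_isLmodule.Build R Bsa
  Bsa_scaleA Bsa_scale1 Bsa_scaleDr Bsa_scaleDl.

(* The norm of H takes its values in R[i], whence the real part. *)
Definition Bsa_opnorm (A : Bsa) : R :=
  sup [set complex.Re `|A x| | x in [set x : H | `|x| <= 1]].

Lemma Re_normK (x : H) : (complex.Re `|x|)%:C = `|x|.
Proof. by apply: RRe_real; rewrite normr_real. Qed.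

Lemma Re_norm_le (x : H) (r : R) : (complex.Re `|x| <= r) = (`|x| <= r%:C).
Proof. by rewrite -lecR Re_normK. Qed.

Lemma Bsa_has_sup (A : Bsa) :
  has_sup [set complex.Re `|A x| | x in [set x : H | `|x| <= 1]].
Proof.
split; first by exists (complex.Re `|A 0|), 0 => //=; rewrite normr0.
have [M M0 AM] := bounded_map_ge0 (Bsa_bounded A); exists (complex.Re M) => _ [x /= x1 <-].
rewrite Re_norm_le (RRe_real (ger0_real M0)).
by rewrite (le_trans (AM x))// ler_piMr.
Qed.

Lemma Bsa_opnorm_ub (A : Bsa) (x : H) :
  `|x| <= 1 -> `|A x| <= (Bsa_opnorm A)%:C.
Proof.
move=> x1; rewrite -Re_norm_le.
by apply: ub_le_sup; [case: (Bsa_has_sup A)|exists x].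
Qed.

Lemma Bsa_opnorm_le (A : Bsa) (M : R) :
  (forall x, `|x| <= 1 -> `|A x| <= M%:C) -> Bsa_opnorm A <= M.
Proof.
move=> AM; apply: ge_sup; first by case: (Bsa_has_sup A).
by move=> _ [x /= /AM ? <-]; rewrite Re_norm_le.
Qed.

Lemma Bsa_opnormD (A B : Bsa) :
  Bsa_opnorm (A + B) <= Bsa_opnorm A + Bsa_opnorm B.
Proof.
apply: Bsa_opnorm_le => x x1; apply: le_trans (ler_normD _ _) _.
by rewrite rmorphD lerD// Bsa_opnorm_ub.
Qed.

Lemma normr_RC (a : R) : `|a%:C| = `|a|%:C :> R[i].
Proof. by rewrite normc_def /= expr0n /= addr0 sqrtr_sqr. Qed.

Lemma Bsa_opnormZ_le (a : R) (A : Bsa) :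
  Bsa_opnorm (a *: A) <= `|a| * Bsa_opnorm A.
Proof.
apply: Bsa_opnorm_le => x x1; rewrite /= normrZ rmorphM normr_RC.
by rewrite ler_wpM2l ?Bsa_opnorm_ub// -normr_RC.
Qed.

Lemma Bsa_opnorm_ge0 (A : Bsa) : 0 <= Bsa_opnorm A.
Proof.
rewrite -ler0c; apply: le_trans (Bsa_opnorm_ub A (x := 0) _) => //.
by rewrite normr0.
Qed.

Lemma Bsa_opnormZ (a : R) (A : Bsa) : Bsa_opnorm (a *: A) = `|a| * Bsa_opnorm A.
Proof.
apply/le_anti; rewrite Bsa_opnormZ_le/=; have [->|a0] := eqVneq a 0.
  by rewrite normr0 mul0r Bsa_opnorm_ge0.
rewrite mulrC -ler_pdivlMr ?normr_gt0// mulrC -normfV.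
by apply: le_trans (Bsa_opnormZ_le _ _); rewrite scalerA mulVf// scale1r.
Qed.

Lemma Bsa_opnorm_eq0 (A : Bsa) : Bsa_opnorm A = 0 -> A = 0.
Proof.
move=> A0; apply/val_inj/funext => x /=; apply/eqP; rewrite -normr_le0.
have lin0 : A 0 = 0.
  by have := Bsa_linear A (-1) 0 0; rewrite scaler0 addr0 scaleN1r addNr.
have [->|x0] := eqVneq x 0; first by rewrite lin0 normr0.
have : `|A (`|x|^-1 *: x)| <= (Bsa_opnorm A)%:C.
  apply: Bsa_opnorm_ub.
  by rewrite normrZ normfV normr_id mulVf// normr_eq0.
have := Bsa_linear A `|x|^-1 x 0; rewrite !addr0 lin0 addr0 => ->.
by rewrite A0 rmorph0 normrZ normfV normr_id pmulr_rle0// invr_gt0 normr_gt0.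
Qed.

HB.instance Definition _ :=
  Lmodule_isNormed.Build R Bsa Bsa_opnormD Bsa_opnormZ Bsa_opnorm_eq0.

Lemma sa_pred1 : idfun \in sa_pred.
Proof.
by apply/asboolP; split=> //; exists 1 => x; rewrite mul1r.
Qed.

Definition Bsa1 : Bsa := MkBsa sa_pred1.

Lemma Bsa_jordan_subproof (A B : Bsa) :
  (2^-1 : R[i]) *: ((A \o B) + (B \o A)) \in sa_pred.
Proof.
have bnd (X Y : Bsa) : bounded_map (X \o Y).
  by apply: bounded_map_comp; exact: Bsa_bounded.
have half : (2^-1 : R[i]) = (2^-1 : R)%:C by rewrite fmorphV rmorph_nat.
apply/asboolP; split.
- move=> a x y; rewrite !fctE !Bsa_linear.
  by rewrite addrACA -(scalerDr a) (scalerDr 2^-1) !scalerA mulrC.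
- have [M AM] := bnd A B; have [N BN] := bnd B A.
  exists (`|2^-1| * (M + N)) => x; rewrite !fctE normrZ -mulrA ler_wpM2l//.
  by rewrite (le_trans (ler_normD _ _))// mulrDl lerD// ?AM ?BN.
- move=> x y; rewrite !fctE innerZl innerZr innerDl innerDr !Bsa_sym addrC.
  by rewrite half conjC_real.
Qed.

Definition Bsa_jordan (A B : Bsa) : Bsa := MkBsa (Bsa_jordan_subproof A B).

Lemma Bsa_U_subproof (X A : Bsa) : X \o A \o X \in sa_pred.
Proof.
apply/asboolP; split.
- by move=> a x y; rewrite /= !Bsa_linear.
- by do 2![apply: bounded_map_comp; first exact: Bsa_bounded];
    exact: Bsa_bounded.
- by move=> x y; rewrite /= !Bsa_sym.
Qed.

Definition Bsa_U (X A : Bsa) : Bsa := MkBsa (Bsa_U_subproof X A).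

Definition positive_op (A : Bsa) : Prop := forall x : H, 0 <= inner (A x) x.

Definition Omega : set Bsa := [set A | positive_op A /\ bounded_invertible A].

Definition GL_V : set (Bsa -> Bsa) := [set g | linear g /\ bounded_invertible g].

Definition G_Omega : set (Bsa -> Bsa) := [set g | GL_V g /\ g @` Omega = Omega].

Definition Aut_V : set (Bsa -> Bsa) :=
  [set k | GL_V k /\
     forall A B, k (Bsa_jordan A B) = Bsa_jordan (k A) (k B)].

(* [gs] satisfies the defining property of g^* *)
Definition is_star (g gs : Bsa -> Bsa) : Prop :=
  GL_V gs /\ forall X, Bsa_U (g X) = g \o Bsa_U X \o gs.

Definition antilinear (f : H -> H) : Prop :=
  (forall x y, f (x + y) = f x + f y) /\
  (forall (l : R[i]) x, f (l *: x) = l^* *: f x).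

Definition is_dagger (f fd : H -> H) : Prop :=
  (linear f /\ linear fd /\ forall x y, inner (f x) y = inner x (fd y)) \/
  (antilinear f /\ antilinear fd /\
     forall x y, inner (f x) y = (inner x (fd y))^*).

(* The usual adjoint of a bounded linear f, the conjugate adjoint of a bounded
   antilinear f (both exist and are unique); 0 if there is no such operator. *)
Definition dagger (f : H -> H) : H -> H := xget 0 [set fd | is_dagger f fd].

Definition unitary (W : H -> H) : Prop :=
  [/\ linear W, (forall y, exists x, W x = y) &
      forall x y, inner (W x) (W y) = inner x y].

Definition antiunitary (W : H -> H) : Prop :=
  [/\ antilinear W, (forall y, exists x, W x = y) &
      forall x y, inner (W x) (W y) = (inner x y)^*].

Definition semilin_inv (f : H -> H) : Prop :=
  bounded_invertible f /\ (linear f \/ antilinear f).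

(* g = f . f^dagger *)
Definition induces (f : H -> H) (g : Bsa -> Bsa) : Prop :=
  forall A : Bsa, g A = f \o A \o dagger f :> (H -> H).

(* The positive square root of B, where B is a positive bounded operator *)
Definition opsqrt (B : H -> H) : Bsa :=
  xget 0 [set X : Bsa | positive_op X /\ X \o X = B :> (H -> H)].

(* |f^dagger| *)
Definition abs_dagger (f : H -> H) : Bsa := opsqrt (f \o dagger f).

Definition is_polar (f W : H -> H) : Prop :=
  f = abs_dagger f \o W /\
  ((linear f /\ unitary W) \/ (antilinear f /\ antiunitary W)).

End SelfAdjointOperators.

Definition components (T : topologicalType) (A : set T) : set (set T) :=
  [set connected_component A x | x in A].

(* Main.v *)
Require Import Defs.
From mathcomp Require Import all_boot all_order all_algebra.
From mathcomp Require Import all_classical all_reals all_analysis.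
From mathcomp Require Import complex.
From mathcomp Require Import ring lra.

Set Implicit Arguments.
Unset Strict Implicit.
Unset Printing Implicit Defensive.

Import Order.TTheory GRing.Theory Num.Theory.
Import numFieldNormedType.Exports.

Local Open Scope classical_set_scope.
Local Open Scope ring_scope.

(* Linear and antilinear maps are treated together: [slin s f] means that f is
   linear (s = false) or antilinear (s = true), and [cj s] is the identity or the
   conjugation of scalars.

   Item 1: g in G(Omega) is an order automorphism, so it permutes the extreme
   rays of the positive cone, which are the rays of rank one operators |x><x|
   (by Cauchy-Schwarz, A >= |Aw><Aw| / <Aw,w> for positive A).  Fix x and u with
   g(|x><x|) = |u><u|.  A linear, resp. antilinear, f with g = f . f^dagger and
   f x = u can be read off from g on |x><y| + |y><x| and i|y><x| - i|x><y|; for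
   each y one of the two candidates satisfies g(|y><y|) = |f y><f y|.  This
   condition is quadratic along real lines y + t z, so the same candidate works
   for all y.  Order automorphisms that agree on the rank one operators agree.

   Item 6: the positive factor of the polar decomposition is deformed to 1 along
   a segment, and a unitary is a product of two Cayley transforms
   (1 + iK)(1 - iK)^-1 with K self-adjoint, which are deformed to 1 through
   tK.  The second factor takes the values i and -i on the projection onto
   ker(|S| - S), S = Im W, and its complement; dividing by it turns the upper and
   the lower half of the spectrum of W into the right half circle, where the Cayley
   transform can be inverted.  The linear and the antilinear
   parts are separated by an identity on rank one operators that is stable under
   norm limits.  An antiunitary exists by Zorn's lemma. *)

(** No spectral calculus is used. Projections come from nearest points, inverses from coercivity,
    and square roots from an iteration whose limit inherits every commutation relation of its
    argument; this last property gives uniqueness of roots and makes |S| commute with W in the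
    Cayley argument. Taking the real part of the inner product turns H into a real Hilbert space in
    which the adjoint of a linear map and the conjugate adjoint of an antilinear map obey the same
    identity, so that most estimates are proved once for both. The obstacle in item 1 is that
    g(|y><y|) determines f y only up to a phase that depends on y. Hence the candidates for f are
    read off relative to one fixed vector: they are semilinear by construction, and only the
    identity on rank one operators remains to be checked. In item 6 both parts are first enclosed in
    closed sets. These may meet elsewhere (both contain 0), but neither meets the opposite part,
    which is all that connectedness needs. *)

Local Notation "x %:C" := (real_complex _ x) : ring_scope.
Local Notation Re := complex.Re.
Local Notation Im := complex.Im.

(** * Scalars and vectors *)

Section Scalars.
Variable R : realType.
Local Notation C := R[i].
Implicit Types (a b : C) (r : R) (s : bool).

Definition iC : C := Complex 0 1.

Definition cj s a : C := if s then a^* else a.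

Lemma conj_conjc a : a^* = conjc a. Proof. by []. Qed.

Lemma cjD s a b : cj s (a + b) = cj s a + cj s b.
Proof. by case: s; rewrite /= ?rmorphD. Qed.

Lemma cjM s a b : cj s (a * b) = cj s a * cj s b.
Proof. by case: s; rewrite /= ?rmorphM. Qed.

Lemma cjN s a : cj s (- a) = - cj s a.
Proof. by case: s; rewrite /= ?rmorphN. Qed.

Lemma cjV s a : cj s a^-1 = (cj s a)^-1.
Proof. by case: s; rewrite /= ?fmorphV. Qed.

Lemma cjK s : involutive (cj s).
Proof. by case: s => a //=; rewrite conjCK. Qed.

Lemma cj_add s t a : cj s (cj t a) = cj (s (+) t) a.
Proof. by case: s t => [] [] //=; rewrite conjCK. Qed.

Lemma cj_conj s a : cj s a^* = (cj s a)^*.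
Proof. by case: s. Qed.

Lemma cj_real s r : cj s r%:C = r%:C.
Proof. by case: s => //=; rewrite conj_conjc conjc_real. Qed.

Lemma cj0 s : cj s 0 = 0. Proof. by have := cj_real s 0; rewrite rmorph0. Qed.

Lemma cj1 s : cj s 1 = 1. Proof. by have := cj_real s 1; rewrite rmorph1. Qed.

Lemma Re_cj s a : Re (cj s a) = Re a.
Proof. by case: s; case: a. Qed.

Lemma ReD a b : Re (a + b) = Re a + Re b. Proof. by case: a; case: b. Qed.
Lemma ImD a b : Im (a + b) = Im a + Im b. Proof. by case: a; case: b. Qed.
Lemma ReN a : Re (- a) = - Re a. Proof. by case: a. Qed.
Lemma ImN a : Im (- a) = - Im a. Proof. by case: a. Qed.
Lemma ReJ a : Re a^* = Re a. Proof. by case: a. Qed.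
Lemma ImJ a : Im a^* = - Im a. Proof. by case: a. Qed.
Lemma ReM a b : Re (a * b) = Re a * Re b - Im a * Im b.
Proof. by case: a; case: b. Qed.
Lemma ImM a b : Im (a * b) = Re a * Im b + Im a * Re b.
Proof. by case: a => p q; case: b => u v /=; ring. Qed.

Lemma Re_scale r a : Re (r%:C * a) = r * Re a.
Proof. by rewrite ReM /=; ring. Qed.

Lemma Im_scale r a : Im (r%:C * a) = r * Im a.
Proof. by rewrite ImM /=; ring. Qed.

Lemma complex_ext a b : Re a = Re b -> Im a = Im b -> a = b.
Proof. by case: a b => [p q] [u v] /= -> ->. Qed.

Lemma iC_conj : iC^* = - iC.
Proof. by apply: complex_ext; rewrite ?ReJ ?ImJ ?ReN ?ImN //= oppr0. Qed.

Lemma iC_sqr : iC * iC = -1.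
Proof. by apply: complex_ext; rewrite ?ReM ?ImM ?ReN ?ImN /=; ring. Qed.

(** The squared modulus is taken in [R], where the order is total and [lra] and [nra] apply; [|a|]
    itself lives in [R[i]]. *)
Definition sqm a : R := Re a ^+ 2 + Im a ^+ 2.

Lemma sqmE a : (sqm a)%:C = a * a^*.
Proof.
by apply: complex_ext; rewrite ?ReM ?ImM ?ReJ ?ImJ /= /sqm; ring.
Qed.

Lemma sqm_norm a : (sqm a)%:C = `|a| ^+ 2.
Proof. by rewrite /sqm add_Re2_Im2. Qed.

Lemma sqm_ge0 a : 0 <= sqm a. Proof. by rewrite addr_ge0 ?sqr_ge0. Qed.

Lemma sqm_eq0 a : sqm a = 0 -> a = 0.
Proof.
rewrite /sqm => /eqP; rewrite paddr_eq0 ?sqr_ge0// !sqrf_eq0.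
by case/andP => /eqP ? /eqP ?; apply: complex_ext.
Qed.

Lemma sqm_gt0 a : a != 0 -> 0 < sqm a.
Proof.
by move=> a0; rewrite lt_def sqm_ge0 andbT; apply: contraNneq a0 => /sqm_eq0 ->.
Qed.

Lemma sqmM a b : sqm (a * b) = sqm a * sqm b.
Proof. by rewrite /sqm ReM ImM; ring. Qed.

Lemma sqm_real r : sqm r%:C = r ^+ 2.
Proof. by rewrite /sqm /=; ring. Qed.

Lemma sqmJ a : sqm a^* = sqm a.
Proof. by rewrite /sqm ReJ ImJ sqrrN. Qed.

Lemma sqm1_norm a : sqm a = 1 -> `|a| = 1.
Proof.
move=> a1; have := sqm_norm a; rewrite a1 => /esym /eqP.
by rewrite sqrp_eq1 ?normr_ge0// => /eqP.
Qed.

Lemma ge0_complex a : 0 <= a -> a = (Re a)%:C.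
Proof. by move=> /ger0_real /RRe_real. Qed.

(** This is the source of the Cauchy-Schwarz inequalities below and of the orthogonality of nearest
    points. The sign of [c] is left open, so the degenerate cases are settled by explicit values of
    [t]. *)
Lemma discr_le (a b c : R) :
  (forall t, 0 <= a + 2 * t * b + t ^+ 2 * c) -> b ^+ 2 <= a * c.
Proof.
move=> h; have a0 : 0 <= a by have := h 0; rewrite mulr0 mul0r expr0n /= mul0r !addr0.
have [c0|c0] := ltP 0 c.
  have := h (- b / c); have -> : a + 2 * (- b / c) * b + (- b / c) ^+ 2 * c
    = (a * c - b ^+ 2) / c by field; rewrite gt_eqF.
  by rewrite pmulr_lge0 ?invr_gt0// subr_ge0.
have [b0|b0] := eqVneq b 0; last first.
  (* This [t] makes [a + 2 * t * b] equal to -2 - a + a + 1 = -1, while the quadratic term is at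
     most 0. *)
  have := h (- (a + 1) / (2 * b)).
  have -> : a + 2 * (- (a + 1) / (2 * b)) * b + (- (a + 1) / (2 * b)) ^+ 2 * c
    = -1 + (- (a + 1) / (2 * b)) ^+ 2 * c by field; rewrite b0.
  have := mulr_ge0_le0 (sqr_ge0 (- (a + 1) / (2 * b))) c0; lra.
rewrite b0 expr0n /=; have [cn|cn] := ltP c 0; last by rewrite mulr_ge0.
have := h (1 + a / (- c)); rewrite b0 mulr0 addr0.
have -> : a + (1 + a / (- c)) ^+ 2 * c = - a + c + a ^+ 2 / c
  by field; rewrite lt_eqF.
have := mulr_ge0_le0 (sqr_ge0 a) (ltW (_ : c^-1 < 0)); rewrite invr_lt0 => /(_ cn); nra.
Qed.

End Scalars.

Section Vectors.
Variables (R : realType) (H : hilbertType R).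
Implicit Types (x y z : H) (a : R[i]) (r : R).

Definition rnorm x : R := Re `|x|.
(** This is the inner product of the underlying real Hilbert space. Moving a linear or an antilinear
    map to the other side reads the same for it ([dagger_ip]). *)
Definition ip x y : R := Re (inner x y).

Lemma rnormE x : (rnorm x)%:C = `|x|. Proof. exact: Re_normK. Qed.

Lemma rnorm_ge0 x : 0 <= rnorm x.
Proof. by rewrite -ler0c rnormE. Qed.

Lemma rnormD x y : rnorm (x + y) <= rnorm x + rnorm y.
Proof. by rewrite -lecR rmorphD /= !rnormE ler_normD. Qed.

Lemma rnormN x : rnorm (- x) = rnorm x.
Proof. by rewrite /rnorm normrN. Qed.

Lemma rnormB x y : rnorm (x - y) <= rnorm x + rnorm y.
Proof. by rewrite -(rnormN y) rnormD. Qed.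

Lemma rnorm_distC x y : rnorm (x - y) = rnorm (y - x).
Proof. by rewrite -rnormN opprB. Qed.

Lemma rnormZ a x : rnorm (a *: x) = Re `|a| * rnorm x.
Proof.
by apply: complexI; rewrite rmorphM /= !rnormE normrZ; congr (_ * _).
Qed.

Lemma rnormZr r x : rnorm (r%:C *: x) = `|r| * rnorm x.
Proof. by rewrite rnormZ normr_RC. Qed.

Lemma rnorm0 : rnorm 0 = 0. Proof. by rewrite /rnorm normr0. Qed.

Lemma rnorm_eq0 x : rnorm x = 0 -> x = 0.
Proof. by move=> x0; apply/normr0_eq0; rewrite -rnormE x0. Qed.

Lemma rnorm_gt0 x : x != 0 -> 0 < rnorm x.
Proof.
by move=> x0; rewrite lt_def rnorm_ge0 andbT; apply: contraNneq x0 => /rnorm_eq0 ->.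
Qed.

Lemma rnorm_lt0 x : (forall e, 0 < e -> rnorm x <= e) -> x = 0.
Proof.
move=> h; apply: rnorm_eq0; apply/le_anti; rewrite rnorm_ge0 andbT.
by apply/ler_addgt0Pl => e e0; rewrite addr0 h.
Qed.

Lemma innerxx x : inner x x = (rnorm x ^+ 2)%:C.
Proof. by rewrite rmorphXn /= rnormE inner_norm. Qed.

Lemma innerNl x y : inner (- x) y = - inner x y.
Proof. by rewrite -scaleN1r innerZl mulN1r. Qed.

Lemma innerNr x y : inner x (- y) = - inner x y.
Proof. by rewrite -scaleN1r innerZr rmorphN rmorph1 mulN1r. Qed.

Lemma innerBl x y z : inner (x - y) z = inner x z - inner y z.
Proof. by rewrite innerDl innerNl. Qed.

Lemma innerBr x y z : inner z (x - y) = inner z x - inner z y.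
Proof. by rewrite innerDr innerNr. Qed.

Definition innerE := (innerDl, innerDr, innerBl, innerBr, innerNl, innerNr,
  innerZl, innerZr, @inner0l R H, @inner0r R H).

Lemma ipC x y : ip x y = ip y x.
Proof. by rewrite /ip inner_conj ReJ. Qed.

Lemma ipDl x y z : ip (x + y) z = ip x z + ip y z.
Proof. by rewrite /ip innerDl ReD. Qed.
Lemma ipDr x y z : ip z (x + y) = ip z x + ip z y.
Proof. by rewrite /ip innerDr ReD. Qed.
Lemma ipNl x y : ip (- x) y = - ip x y.
Proof. by rewrite /ip innerNl ReN. Qed.
Lemma ipNr x y : ip x (- y) = - ip x y.
Proof. by rewrite /ip innerNr ReN. Qed.
Lemma ipZl r x y : ip (r%:C *: x) y = r * ip x y.
Proof. by rewrite /ip innerZl Re_scale. Qed.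
Lemma ipZr r x y : ip x (r%:C *: y) = r * ip x y.
Proof. by rewrite ipC ipZl ipC. Qed.
Lemma ip0l x : ip 0 x = 0. Proof. by rewrite /ip inner0l. Qed.
Lemma ip0r x : ip x 0 = 0. Proof. by rewrite /ip inner0r. Qed.

Definition ipE := (ipDl, ipDr, ipNl, ipNr, ipZl, ipZr, ip0l, ip0r).

Lemma ipxx x : ip x x = rnorm x ^+ 2.
Proof. by rewrite /ip innerxx. Qed.

(** The imaginary part is a real part after a multiplication by i. Through this formula, identities
    proved for [ip] lift to [inner]. *)
Lemma inner_ip x y : inner x y = Complex (ip x y) (ip x (iC R *: y)).
Proof.
rewrite /ip innerZr iC_conj; apply: complex_ext => //=.
by rewrite ReM ReN ImN /=; ring.
Qed.

Lemma inner_eq0 x : inner x x = 0 -> x = 0.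
Proof.
rewrite innerxx => /(congr1 (@complex.Re R)) /= /eqP; rewrite sqrf_eq0 => /eqP.
exact: rnorm_eq0.
Qed.

Lemma inner_ext x y : (forall z, inner x z = inner y z) -> x = y.
Proof.
move=> h; apply/eqP; rewrite -subr_eq0; apply/eqP; apply: inner_eq0.
by rewrite innerBl h subrr.
Qed.

Lemma inner_extr x y : (forall z, inner z x = inner z y) -> x = y.
Proof. by move=> h; apply: inner_ext => z; rewrite inner_conj h -inner_conj. Qed.

Lemma parallelogram x y :
  rnorm (x + y) ^+ 2 + rnorm (x - y) ^+ 2 = 2 * rnorm x ^+ 2 + 2 * rnorm y ^+ 2.
Proof. by rewrite -!ipxx !ipE (ipC y x); ring. Qed.

Lemma sqm_rnorm a x : rnorm (a *: x) ^+ 2 = sqm a * rnorm x ^+ 2.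
Proof.
apply: complexI; rewrite -innerxx innerZl innerZr innerxx mulrA -sqmE.
by rewrite -rmorphM.
Qed.

Lemma CS_ip x y : ip x y ^+ 2 <= rnorm x ^+ 2 * rnorm y ^+ 2.
Proof.
apply: discr_le => t.
have -> : rnorm x ^+ 2 + 2 * t * ip x y + t ^+ 2 * rnorm y ^+ 2
   = rnorm (x + t%:C *: y) ^+ 2.
  by rewrite -!ipxx !ipE (ipC y x); ring.
exact: sqr_ge0.
Qed.

Lemma ip_le x y : `|ip x y| <= rnorm x * rnorm y.
Proof.
rewrite -(@ler_sqr _ `|_|) ?nnegrE ?mulr_ge0 ?rnorm_ge0//.
by rewrite real_normK ?num_real// exprMn CS_ip.
Qed.

Lemma CS_inner x y : sqm (inner x y) <= rnorm x ^+ 2 * rnorm y ^+ 2.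
Proof.
have [->|c0] := eqVneq (inner x y) 0.
  by rewrite /sqm /= expr0n addr0 mulr_ge0 ?sqr_ge0.
(* Scaling y by <x,y> rotates the product onto the real axis: its real part becomes |<x,y>|^2, and
   one such factor cancels. *)
have := CS_ip x (inner x y *: y).
rewrite /ip innerZr mulrC -sqmE /= sqm_rnorm mulrCA expr2.
by rewrite ler_pM2l// sqm_gt0.
Qed.

End Vectors.

(** * Projections, adjoints, and the Lax-Milgram lemma *)

Section Operators.
Variables (R : realType) (H : hilbertType R).
Implicit Types (x y z : H) (a : R[i]) (f g h : H -> H).

Lemma inv_nat_small (e : R) : 0 < e -> exists n : nat, n.+1%:R^-1 < e.
Proof.
move=> e0; exists (Num.truncn e^-1).
rewrite -[ltRHS]invrK ltf_pV2 ?posrE ?invr_gt0 ?ltr0n//.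
by rewrite truncnS_gt.
Qed.

(** Completeness with an explicit rate: the bound [r] on the tails passes to the limit, so later
    limit arguments are plain estimates without filters. *)
Lemma cauchy_limit (u : nat -> H) (r : nat -> R) :
  (forall e, 0 < e -> exists n, r n < e) ->
  (forall n m, (n <= m)%N -> rnorm (u m - u n) <= r n) ->
  exists l, forall n, rnorm (l - u n) <= r n.
Proof.
move=> r0 ur.
have cu : cvg (u @ \oo).
  apply/cauchy_cvgP/cauchy_exP => e e0.
  have [eE eR] : e = (Re e)%:C /\ 0 < Re e.
    by split; [exact: ge0_complex (ltW e0)|move: e0; rewrite ltcE => /andP[]].
  have [n rn] := r0 _ eR; exists (u n); exists n => // m /= nm.
  rewrite -ball_normE /= eE -rnormE ltcR rnorm_distC.
  by apply: le_lt_trans rn; exact: ur.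
exists (lim (u @ \oo)) => n; apply/ler_addgt0Pr => e e0.
have [m [nm um]] : exists m, (n <= m)%N /\ `|lim (u @ \oo) - u m| < e%:C.
  have /cvgrPdist_lt /(_ e%:C) : u @ \oo --> lim (u @ \oo) by exact: cu.
  rewrite ltcR => /(_ e0) [N _ hN]; exists (maxn n N); split; first exact: leq_maxl.
  by apply: hN; exact: leq_maxr.
move: um; rewrite -rnormE ltcR => um.
rewrite -(subrKA (u m)) (le_trans (rnormD _ _))// addrC lerD ?ur//.
exact: ltW.
Qed.

(** A closed real subspace, closedness being the last clause. Scalars are real because kernels of
    real functionals and the set K in [antiunitary_ex] are not complex subspaces. *)
Definition rsubspace (K : set H) :=
  [/\ K 0, forall x y, K x -> K y -> K (x + y),
      forall (r : R) x, K x -> K (r%:C *: x) &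
      forall x, (forall e, 0 < e -> exists2 k, K k & rnorm (x - k) <= e) -> K x].

Lemma nearest_point (K : set H) (h : H) : rsubspace K ->
  exists2 a, K a & forall k, K k -> ip (h - a) k = 0.
Proof.
move=> [K0 KD KZ Kcl].
pose D := [set rnorm (h - k) | k in K]; pose d := inf D.
have Dinf : has_inf D.
  split; first by exists (rnorm (h - 0)), 0.
  by exists 0 => _ [k _ <-]; exact: rnorm_ge0.
have d0 : 0 <= d.
  by apply: lb_le_inf; [case: Dinf|move=> _ [k _ <-]; exact: rnorm_ge0].
have dle k : K k -> d <= rnorm (h - k).
  by move=> Kk; apply: ge_inf; [case: Dinf|exists k].
pose e n : R := n.+1%:R^-1.
have e0 n : 0 < e n by rewrite invr_gt0 ltr0n.
(* The error is a square so that the parallelogram law, applied to a midpoint at distance at least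
   d, gives |u m - u n| <= 2 * e n. *)
have /choice[u uP] n : exists k, K k /\ rnorm (h - k) ^+ 2 <= d ^+ 2 + e n ^+ 2.
  have : d < Num.sqrt (d ^+ 2 + e n ^+ 2).
    rewrite -[ltLHS](ger0_norm d0) -sqrtr_sqr ltr_sqrt.
      by rewrite ltrDl exprn_gt0.
    by rewrite ltr_wpDl ?sqr_ge0// exprn_gt0.
  move=> /(inf_lt Dinf.1)[_ [k Kk <-] hk]; exists k; split=> //.
  rewrite -[leRHS]sqr_sqrtr ?addr_ge0 ?sqr_ge0//.
  by rewrite ler_sqr ?nnegrE ?rnorm_ge0 ?sqrtr_ge0// ltW.
have em n m : (n <= m)%N -> e m <= e n.
  by move=> nm; rewrite lef_pV2 ?posrE ?ltr0n// ler_nat.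
have [l lP] : exists l, forall n, rnorm (l - u n) <= 2 * e n.
  apply: cauchy_limit.
    move=> t t0; have [n nt] := @inv_nat_small (t / 2) (divr_gt0 t0 (ltr0Sn _ _)).
    by exists n; rewrite mulrC -ltr_pdivlMr.
  move=> n m nm; have [Kn un] := uP n; have [Km um] := uP m.
  have Kmid : K ((2^-1)%:C *: (u n + u m)) by apply: KZ; exact: KD.
  have := parallelogram (h - u n) (h - u m).
  have -> : h - u n - (h - u m) = u m - u n by rewrite opprB addrC subrKA.
  have -> : h - u n + (h - u m) = 2%:C *: (h - (2^-1)%:C *: (u n + u m)).
    rewrite scalerBr scalerA -rmorphM /= divff ?pnatr_eq0// rmorph1 scale1r.
    by rewrite rmorph_nat scaler_nat mulr2n addrACA opprD.
  rewrite rnormZr normr_nat exprMn => pl.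
  have := dle _ Kmid; have := em _ _ nm; have := e0 m; have := e0 n; move: d0 un um pl.
  move: (rnorm (h - _ *: _)) (rnorm_ge0 (h - (2^-1)%:C *: (u n + u m))) => w w0.
  move=> d0 un um pl en0 em0 emn dw.
  rewrite -ler_sqr ?nnegrE ?rnorm_ge0 ?mulr_ge0 ?(ltW (e0 _))//.
  have dw2 : d ^+ 2 <= w ^+ 2 by rewrite ler_sqr.
  have e2 : e m ^+ 2 <= e n ^+ 2 by rewrite ler_sqr ?nnegrE ?(ltW (e0 _)).
  by rewrite exprMn; lra.
have Kl : K l.
  apply: Kcl => t t0; have [n nt] := @inv_nat_small (t / 2) (divr_gt0 t0 (ltr0Sn _ _)).
  exists (u n); first by case: (uP n).
  by rewrite (le_trans (lP n))// mulrC -ler_pdivlMr// ltW.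
have hl : rnorm (h - l) <= d.
  apply/ler_addgt0Pr => t t0.
  have [n nt] := @inv_nat_small (t / 3) (divr_gt0 t0 (ltr0Sn _ _)).
  have [_ un] := uP n; have ln := lP n.
  have hn : rnorm (h - u n) <= d + e n.
    rewrite -ler_sqr ?nnegrE ?rnorm_ge0 ?addr_ge0 ?(ltW (e0 n))//.
    by rewrite (le_trans un)// sqrrD lerD2r lerDl mulrn_wge0// mulr_ge0// ltW.
  rewrite -(subrKA (u n)) (le_trans (rnormD _ _))//.
  by rewrite (rnorm_distC (u n)); move: nt; rewrite -/(e n) ltr_pdivlMr//; lra.
exists l => // k Kk.
(* By minimality of [l] the increment of the squared distance along [k] is a nonnegative quadratic
   polynomial without constant term, so its linear coefficient vanishes. *)
have : ip (h - l) k ^+ 2 <= 0 * rnorm k ^+ 2.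
  apply: discr_le => t; rewrite add0r.
  have : d <= rnorm (h - (l + (-t)%:C *: k)) by apply/dle/KD => //; exact: KZ.
  rewrite opprD addrA -scaleNr -rmorphN opprK => hd.
  have : rnorm (h - l) ^+ 2 <= rnorm (h - l + t%:C *: k) ^+ 2.
    by rewrite ler_sqr ?nnegrE ?rnorm_ge0// (le_trans hl).
  have -> : rnorm (h - l + t%:C *: k) ^+ 2 =
     rnorm (h - l) ^+ 2 + (2 * t * ip (h - l) k + t ^+ 2 * rnorm k ^+ 2).
    by rewrite -!ipxx !(ipDl (h - l)) !(ipDr (h - l)) !ipZl !ipZr (ipC k); ring.
  by rewrite lerDl.
by rewrite mul0r => h0; apply/eqP; rewrite -sqrf_eq0 eq_le h0 sqr_ge0.
Qed.

Definition slin s f :=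
  (forall x y, f (x + y) = f x + f y) /\ (forall a x, f (a *: x) = cj s a *: f x).

Lemma linear_slin f : linear f <-> slin false f.
Proof.
split=> [lf|[fD fZ] a x y]; last by rewrite fD fZ.
have f0 : f 0 = 0 by have := lf (-1) 0 0; rewrite scaler0 addr0 scaleN1r addNr.
split=> [x y|a x]; first by have := lf 1 x y; rewrite !scale1r.
by have := lf a x 0; rewrite !addr0 f0 addr0.
Qed.

Section Slin.
Variables (s : bool) (f : H -> H).
Hypothesis fs : slin s f.

Lemma slinD x y : f (x + y) = f x + f y. Proof. by case: fs. Qed.
Lemma slinZ a x : f (a *: x) = cj s a *: f x. Proof. by case: fs. Qed.
Lemma slinZr (r : R) x : f (r%:C *: x) = r%:C *: f x.
Proof. by rewrite slinZ cj_real. Qed.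
Lemma slin0 : f 0 = 0. Proof. by rewrite -(scale0r (0 : H)) slinZ cj0 !scale0r. Qed.
Lemma slinN x : f (- x) = - f x.
Proof. by rewrite -scaleN1r slinZ cjN cj1 scaleN1r. Qed.
Lemma slinB x y : f (x - y) = f x - f y.
Proof. by rewrite slinD slinN. Qed.
End Slin.

Lemma slin_comp s t f g : slin s f -> slin t g -> slin (s (+) t) (f \o g).
Proof.
move=> fs gt; split=> [x y|a x] /=; first by rewrite (slinD gt) (slinD fs).
by rewrite (slinZ gt) (slinZ fs) cj_add.
Qed.

Lemma slin_inv s f g : slin s f -> cancel f g -> cancel g f -> slin s g.
Proof.
move=> fs fK gK; split=> [x y|a x]; apply: (can_inj fK).
  by rewrite (slinD fs) !gK.
by rewrite (slinZ fs) cjK !gK.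
Qed.

Lemma slin_id : slin false (@id H).
Proof. by split. Qed.

(** The two rules give f(ix) = i f(x) = - i f(x). It serves to discard the wrong alternative in
    [is_dagger]. *)
Lemma slin_bothP s f : slin s f -> slin (~~ s) f -> forall x, f x = 0.
Proof.
move=> fs fs' x; have := slinZ fs (iC R) x; rewrite (slinZ fs').
have iC0 : iC R != 0 by rewrite -sqrf_eq0 expr2 iC_sqr oppr_eq0 oner_eq0.
have E (v : H) : iC R *: v = - (iC R *: v) -> v = 0.
  move/eqP; rewrite -subr_eq0 opprK -scalerDl scaler_eq0 -mulr2n mulrn_eq0 /=.
  by rewrite (negbTE iC0) /= => /eqP.
by case: s fs fs' => fs fs'; rewrite /= iC_conj scaleNr => h; apply: E; rewrite {1}h ?opprK.
Qed.

Definition bnd f (M : R) := 0 <= M /\ forall x, rnorm (f x) <= M * rnorm x.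

Lemma bounded_mapP f : bounded_map f <-> exists M, bnd f M.
Proof.
split=> [/bounded_map_ge0[M M0 fM]|[M [M0 fM]]].
  exists (Re M); split; first by move: M0; rewrite lecE => /andP[].
  by move=> x; rewrite -lecR rmorphM /= !rnormE -(ge0_complex M0).
by exists M%:C => x; rewrite -!rnormE -rmorphM lecR.
Qed.

Lemma bnd_small f M x e : bnd f M -> 0 < e ->
  exists2 d : R, 0 < d & forall y, rnorm (x - y) <= d -> rnorm (f (x - y)) <= e.
Proof.
move=> [M0 fM] e0; exists (e / (M + 1)).
  by rewrite divr_gt0// ltr_wpDl.
move=> y xy; rewrite (le_trans (fM _))//.
move: xy; rewrite ler_pdivlMr ?ltr_wpDl// => xy.
by have := rnorm_ge0 (x - y); nra.
Qed.

(** The functionals are only real-linear, since x |-> [ip (f x) y] must be covered for antilinear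
    [f] too. The representing vector is a multiple of the component of [e] orthogonal to the
    kernel. *)
Lemma riesz (phi : H -> R) (M : R) :
  (forall x y, phi (x + y) = phi x + phi y) ->
  (forall r x, phi (r%:C *: x) = r * phi x) ->
  (forall x, `|phi x| <= M * rnorm x) -> exists z, forall x, phi x = ip x z.
Proof.
move=> pD pZ pM.
have [[e /eqP e0]|p0] := pselect (exists e, phi e <> 0); last first.
  by exists 0 => x; rewrite ip0r; apply: contrapT => px; apply: p0; exists x.
have p0 : phi 0 = 0 by rewrite -(scale0r 0) -[0 in LHS](rmorph0 (real_complex R)) pZ mul0r.
have pN x : phi (- x) = - phi x.
  by rewrite -scaleN1r -(rmorphN1 (real_complex R)) pZ mulN1r.
have M0 : 0 <= M.
  have := le_trans (normr_ge0 _) (pM e).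
  have : 0 < rnorm e by apply: rnorm_gt0; apply: contraNneq e0 => ->; rewrite p0.
  by move=> h; rewrite pmulr_lge0.
have sK : rsubspace [set x | phi x = 0].
  split=> //=.
  - by move=> x y px py; rewrite pD px py addr0.
  - by move=> r x px; rewrite pZ px mulr0.
  - move=> x hx; apply/normr0_eq0/le_anti; rewrite normr_ge0 andbT.
    apply/ler_addgt0Pr => t t0; rewrite add0r.
    have [k pk xk] := hx (t / (M + 1)) (divr_gt0 t0 (ltr_wpDl M0 ltr01)).
    have -> : phi x = phi (x - k) by rewrite pD pN pk subr0.
    rewrite (le_trans (pM _))//; move: xk; rewrite ler_pdivlMr ?ltr_wpDl// => xk.
    by have := rnorm_ge0 (x - k); nra.
have [a /= pa ea] := nearest_point e sK.
set w := e - a in ea.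
have pw : phi w = phi e by rewrite pD pN pa subr0.
have w0 : rnorm w != 0.
  by apply: contraNneq e0 => /rnorm_eq0 w0; rewrite -pw w0 p0.
exists ((phi w / rnorm w ^+ 2)%:C *: w) => x.
have : phi (x - (phi x / phi w)%:C *: w) = 0.
  by rewrite pD pN pZ divfK ?subrr// pw.
move/ea; rewrite ipDr ipNr ipZr ipxx => /eqP; rewrite subr_eq0 => /eqP xw.
by rewrite ipZr ipC xw; field; rewrite w0 pw e0.
Qed.

Lemma dagger_ex s f : slin s f -> bounded_map f -> exists fd,
  slin s fd /\ forall x y, inner (f x) y = cj s (inner x (fd y)).
Proof.
move=> fs /bounded_mapP[M [M0 fM]].
have /choice[fd fdP] y : exists z, forall x, ip (f x) y = ip x z.
  apply: (@riesz _ (M * rnorm y)).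
  - by move=> u v; rewrite (slinD fs) ipDl.
  - by move=> r u; rewrite (slinZr fs) ipZl.
  - move=> u; rewrite (le_trans (ip_le _ _))// mulrAC ler_wpM2r ?rnorm_ge0//.
have E x y : inner (f x) y = cj s (inner x (fd y)).
  (* Real parts agree by the choice of [fd]. The imaginary parts are real parts with an extra i,
     which moves inside [f] with its sign changed exactly when [f] is antilinear. *)
  rewrite [LHS]inner_ip [in RHS]inner_ip.
  have -> : ip (f x) (iC R *: y) = ip (- (iC R *: f x)) y.
    by rewrite /ip -scaleNr innerZr innerZl iC_conj.
  have -> : - (iC R *: f x) = f ((if s then iC R else - iC R) *: x).
    by rewrite (slinZ fs); case: (s); rewrite /= ?iC_conj scaleNr.
  have -> : ip x (iC R *: fd y) = ip (- iC R *: x) (fd y).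
    by rewrite /ip innerZr innerZl iC_conj.
  rewrite !fdP; case: (s) => //.
  by rewrite scaleNr ipNl; apply: complex_ext; rewrite /= ?ReJ ?ImJ //= opprK.
exists fd; split=> //; split.
  move=> x y; apply: inner_extr => z; apply: (can_inj (@cjK R s)).
  by rewrite -E !innerDr cjD -!E.
move=> a x; apply: inner_extr => z; apply: (can_inj (@cjK R s)).
by rewrite -E !innerZr cjM -!E -cj_conj cjK.
Qed.

(** [dagger] selects some map that satisfies a disjunction, possibly the alternative of the other
    type. In that event [f] vanishes, and so does the selected map, which then fits both
    alternatives. *)
Lemma dagger_spec s f : slin s f -> bounded_map f ->
  slin s (dagger f) /\ forall x y, inner (f x) y = cj s (inner x (dagger f y)).
Proof.
move=> fs fb; have [fd [fds fdE]] := dagger_ex fs fb.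
have : is_dagger f (dagger f).
  apply: (xgetPex 0); exists fd; rewrite /= /is_dagger.
  case: (s) fs fds fdE => fs fds fdE; [by right|left].
  by rewrite !linear_slin.
rewrite /is_dagger !linear_slin; move: (dagger f) => gd [[f1 [g1 g2]]|[f1 [g1 g2]]].
  case: s fs fds fdE => fs fds fdE; last by split.
  have f0 := slin_bothP fs f1.
  suff -> : gd = fun=> 0.
    split; first by split=> [x y|a x]; rewrite ?addr0 ?scaler0.
    by move=> x y; rewrite f0 inner0l inner0r cj0.
  apply/funext => y; apply: inner_extr => x.
  by rewrite -g2 f0 inner0l inner0r.
case: s fs fds fdE => fs fds fdE; first by split.
have f0 := slin_bothP fs f1.
suff -> : gd = fun=> 0.
  split; first by split=> [x y|a x]; rewrite ?addr0 ?scaler0.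
  by move=> x y; rewrite f0 inner0l inner0r cj0.
apply/funext => y; apply: inner_extr => x.
by apply: (can_inj (@cjK R true)); rewrite /= -g2 f0 inner0l inner0r conjC0.
Qed.

Lemma dagger_slin s f : slin s f -> bounded_map f -> slin s (dagger f).
Proof. by move=> fs fb; case: (dagger_spec fs fb). Qed.

Lemma daggerP s f : slin s f -> bounded_map f ->
  forall x y, inner (f x) y = cj s (inner x (dagger f y)).
Proof. by move=> fs fb; case: (dagger_spec fs fb). Qed.

Lemma daggerPr s f : slin s f -> bounded_map f ->
  forall x y, inner x (f y) = cj s (inner (dagger f x) y).
Proof.
move=> fs fb x y; rewrite inner_conj (daggerP fs fb) -cj_conj; congr cj.
by rewrite -inner_conj.
Qed.

Lemma dagger_ip s f : slin s f -> bounded_map f ->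
  forall x y, ip (f x) y = ip x (dagger f y).
Proof. by move=> fs fb x y; rewrite /ip (daggerP fs fb) Re_cj. Qed.

Lemma dagger_eq s f g : slin s f -> bounded_map f ->
  (forall x y, inner (f x) y = cj s (inner x (g y))) -> dagger f = g.
Proof.
move=> fs fb fg; apply/funext => y; apply: inner_extr => x.
by apply: (can_inj (@cjK R s)); rewrite -fg (daggerP fs fb).
Qed.

Lemma dagger_bnd s f M : slin s f -> bnd f M -> bnd (dagger f) M.
Proof.
move=> fs [M0 fM]; have fb : bounded_map f by apply/bounded_mapP; exists M.
split=> // y; have [->|/rnorm_gt0 d0] := eqVneq (dagger f y) 0.
  by rewrite rnorm0 mulr_ge0 ?rnorm_ge0.
rewrite -(ler_pM2l d0) -expr2 -ipxx -(dagger_ip fs fb).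
rewrite (le_trans (ler_norm _))// (le_trans (ip_le _ _))//.
by rewrite mulrA (mulrC _ M) ler_wpM2r ?rnorm_ge0.
Qed.

Lemma dagger_bounded s f : slin s f -> bounded_map f -> bounded_map (dagger f).
Proof.
by move=> fs /bounded_mapP[M fM]; apply/bounded_mapP; exists M; exact: dagger_bnd fs fM.
Qed.

Lemma daggerK s f : slin s f -> bounded_map f -> dagger (dagger f) = f.
Proof.
move=> fs fb; apply: (dagger_eq (s := s)).
- exact: dagger_slin.
- exact: dagger_bounded fs fb.
- by move=> x y; rewrite (daggerPr fs fb) cjK.
Qed.

Lemma dagger_comp s t f g : slin s f -> bounded_map f -> slin t g ->
  bounded_map g -> dagger (f \o g) = dagger g \o dagger f.
Proof.
move=> fs fb gt gb; apply: (dagger_eq (s := s (+) t)).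
- exact: slin_comp.
- exact: bounded_map_comp gb fb.
- by move=> x y /=; rewrite (daggerP fs fb) (daggerP gt gb) cj_add.
Qed.

Lemma bounded_id : bounded_map (@id H).
Proof. by exists 1 => x; rewrite mul1r. Qed.

Lemma dagger_id : dagger (@id H) = id.
Proof. by apply: (dagger_eq slin_id bounded_id). Qed.

Lemma dagger_inv s f g : slin s f -> bounded_map f -> bounded_map g ->
  cancel f g -> cancel g f ->
  cancel (dagger f) (dagger g) /\ cancel (dagger g) (dagger f).
Proof.
move=> fs fb gb fK gK; have gs := slin_inv fs fK gK; split=> x.
  rewrite -[LHS]/((dagger g \o dagger f) x) -(dagger_comp fs fb gs gb).
  by rewrite (_ : f \o g = id) ?dagger_id//; apply/funext.
rewrite -[LHS]/((dagger f \o dagger g) x) -(dagger_comp gs gb fs fb).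
by rewrite (_ : g \o f = id) ?dagger_id//; apply/funext.
Qed.

(** Coercivity bounds T from below, so T is injective with closed range; a vector w orthogonal to
    the range satisfies c |w|^2 <= [ip (T w) w] = 0. The lemma provides the inverses of coercive
    self-adjoint operators, of 1 - iK and of 1 + W. *)
Lemma lax_milgram (T : H -> H) (c : R) : linear T -> bounded_map T -> 0 < c ->
  (forall x, c * rnorm x ^+ 2 <= ip (T x) x) ->
  exists h, [/\ linear h, forall x, c * rnorm (h x) <= rnorm x,
                cancel T h & cancel h T].
Proof.
move=> /linear_slin Ts /bounded_mapP[M TM] c0 Tc.
have Tb x : c * rnorm x <= rnorm (T x).
  have [->|/rnorm_gt0 x0] := eqVneq x 0; first by rewrite (slin0 Ts) rnorm0 mulr0.
  rewrite -(ler_pM2r x0) -mulrA -expr2 (le_trans (Tc x))//.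
  exact: le_trans (ler_norm _) (ip_le _ _).
have sK : rsubspace (range T).
  split=> /=.
  - by exists 0 => //; rewrite (slin0 Ts).
  - by move=> _ _ [x _ <-] [y _ <-]; exists (x + y) => //; rewrite (slinD Ts).
  - by move=> r _ [x _ <-]; exists (r%:C *: x) => //; rewrite (slinZr Ts).
  - move=> y hy; pose e n : R := n.+1%:R^-1.
    have e0 n : 0 < e n by rewrite invr_gt0 ltr0n.
    have em n m : (n <= m)%N -> e m <= e n.
      by move=> nm; rewrite lef_pV2 ?posrE ?ltr0n// ler_nat.
    have /choice[u uP] n : exists x, rnorm (y - T x) <= e n.
      by have [_ [x _ <-] ?] := hy (e n) (e0 n); exists x.
    have [|n m nm|l lP] := @cauchy_limit u (fun n => 2 * e n / c).
    + move=> t t0; have [n nt] := @inv_nat_small (t * c / 2)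
        (divr_gt0 (mulr_gt0 t0 c0) (ltr0Sn _ _)).
      by exists n; rewrite ltr_pdivrMr// mulrC -ltr_pdivlMr.
    + rewrite ler_pdivlMr// mulrC (le_trans (Tb _))// (slinB Ts).
      rewrite -(subrKA y) (le_trans (rnormD _ _))// (rnorm_distC (T _)).
      by have := uP n; have := uP m; have := em _ _ nm; lra.
    exists l => //; apply/eqP; rewrite eq_sym -subr_eq0; apply/eqP.
    apply: rnorm_lt0 => t t0.
    have [M0 TMx] := TM.
    have M1 : 0 < 1 + M * 2 / c by rewrite ltr_pwDl// divr_ge0 ?mulr_ge0// ltW.
    (* The factor comes from |y - T l| <= |y - T (u n)| + M |u n - l| <= e n + M * (2 * e n / c). *)
    have [n nt] := @inv_nat_small (t / (1 + M * 2 / c)) (divr_gt0 t0 M1).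
    rewrite -(subrKA (T (u n))) (le_trans (rnormD _ _))// -(slinB Ts).
    have := le_trans (TMx (u n - l)) (ler_wpM2l M0 _); rewrite rnorm_distC => /(_ _ (lP n)) h1.
    rewrite (le_trans (lerD (uP n) h1))//; move: nt; rewrite ltr_pdivlMr// -/(e n) => nt.
    by apply: ltW; apply: le_lt_trans nt; rewrite le_eqVlt; apply/orP; left; apply/eqP; field; rewrite gt_eqF.
have /choice[h hP] y : exists x, T x = y.
  have [_ [x _ <-] xo] := nearest_point y sK; exists x.
  apply/eqP; rewrite eq_sym -subr_eq0; apply/eqP; set w := y - T x in xo *.
  have := Tc w; rewrite ipC xo; last by exists w.
  by rewrite pmulr_rle0// => w0; apply: rnorm_eq0; apply/eqP; rewrite -sqrf_eq0 eq_le w0 sqr_ge0.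
have Tinj x y : T x = T y -> x = y.
  move=> Txy; apply/eqP; rewrite -subr_eq0; apply/eqP; apply: rnorm_eq0.
  apply/le_anti; rewrite rnorm_ge0 andbT -(pmulr_rle0 _ c0).
  by rewrite (le_trans (Tb _))// (slinB Ts) Txy subrr rnorm0.
have hT : cancel T h by move=> x; apply: Tinj; rewrite hP.
exists h; split=> //; first by apply/linear_slin; exact: slin_inv Ts hT hP.
by move=> x; rewrite (le_trans (Tb _))// hP.
Qed.

End Operators.

(** * Positive operators and square roots *)

Section SelfAdjoint.
Variables (R : realType) (H : hilbertType R).
Implicit Types (x y z : H) (a : R[i]) (A B X Y : Bsa H).

Lemma Bsa_ext A B : (forall x, A x = B x) -> A = B.
Proof. by move=> AB; apply/val_inj/funext. Qed.

Lemma BsaD A B x : (A + B) x = A x + B x. Proof. by []. Qed.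
Lemma BsaN A x : (- A) x = - A x. Proof. by []. Qed.
Lemma BsaB A B x : (A - B) x = A x - B x. Proof. by []. Qed.
Lemma BsaZ (r : R) A x : (r *: A) x = r%:C *: A x. Proof. by []. Qed.
Lemma Bsa0E x : (0 : Bsa H) x = 0. Proof. by []. Qed.
Lemma Bsa1E x : Bsa1 H x = x. Proof. by []. Qed.

Definition BsaE := (BsaD, BsaB, BsaN, BsaZ, Bsa0E, Bsa1E).

Lemma Bsa_slin A : slin false A.
Proof. by apply/linear_slin; exact: Bsa_linear. Qed.

Lemma Bsa_ip A x y : ip (A x) y = ip x (A y).
Proof. by rewrite /ip Bsa_sym. Qed.

Lemma Bsa_norm_le A x : rnorm (A x) <= `|A| * rnorm x.
Proof.
have [->|x0] := eqVneq x 0; first by rewrite (slin0 (Bsa_slin A)) rnorm0 mulr0.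
have := Bsa_opnorm_ub A (x := (rnorm x)^-1%:C *: x).
rewrite (slinZr (Bsa_slin A)) -!rnormE lecR !rnormZr normfV.
rewrite (ger0_norm (rnorm_ge0 x)) mulVf ?gt_eqF ?rnorm_gt0// => /(_ (lexx _)).
by rewrite lecR ler_pdivrMl ?rnorm_gt0// mulrC.
Qed.

Lemma Bsa_bnd A : bnd A `|A|.
Proof. by split; [exact: normr_ge0|exact: Bsa_norm_le]. Qed.

Lemma Bsa_normP A (M : R) : 0 <= M -> (forall x, rnorm (A x) <= M * rnorm x) ->
  `|A| <= M.
Proof.
move=> M0 AM; apply: Bsa_opnorm_le => x x1; rewrite -rnormE lecR.
rewrite (le_trans (AM x))// ler_piMr// -lecR rnormE.
by rewrite rmorph1.
Qed.

Lemma Bsa_real A x : inner (A x) x = (ip (A x) x)%:C.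
Proof.
rewrite inner_ip; apply: complex_ext => //=.
rewrite /ip innerZr iC_conj ReM ReN ImN /=.
by have := inner_conj x (A x); rewrite -Bsa_sym => /(congr1 (@complex.Im R)); rewrite ImJ; lra.
Qed.

Lemma sa_predP (f : H -> H) : slin false f -> bounded_map f ->
  (forall x y, ip (f x) y = ip x (f y)) -> f \in @sa_pred R H.
Proof.
move=> fs fb fi; apply/asboolP; split=> //; first by apply/linear_slin.
move=> x y; rewrite [LHS]inner_ip [RHS]inner_ip fi; congr Complex.
by rewrite fi (slinZ fs).
Qed.

Lemma Bsa_quad_ext A B : (forall x, ip (A x) x = ip (B x) x) -> A = B.
Proof.
move=> AB; apply: Bsa_ext => x; apply/eqP; rewrite -subr_eq0; apply/eqP.
have h y : ip ((A - B) y) y = 0 by rewrite BsaB ipDl ipNl AB subrr.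
rewrite -BsaB; move: (A - B) h => D h.
(* Since D is symmetric, the form of D at x + D x contains the cross term 2 |D x|^2, and its
   diagonal terms vanish. *)
have := h (x + D x); rewrite (slinD (Bsa_slin D)) !ipE !h !addr0 !add0r.
rewrite (Bsa_ip _ (D x)) ipxx => h2; apply: rnorm_eq0; apply/eqP.
by rewrite -sqrf_eq0; apply/eqP; lra.
Qed.

Definition psd A := forall x, 0 <= ip (A x) x.

Lemma psdP A : positive_op A <-> psd A.
Proof. by split=> h x; have := h x; rewrite Bsa_real ler0c. Qed.

Lemma CS_psd A x y : psd A -> ip (A x) y ^+ 2 <= ip (A x) x * ip (A y) y.
Proof.
move=> A0; apply: discr_le => t.
have := A0 (x + t%:C *: y).
rewrite (slinD (Bsa_slin A)) (slinZr (Bsa_slin A)) !ipE (ipC (A y)) -(Bsa_ip A x y).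
by congr (_ <= _); ring.
Qed.

Lemma CS_psd_inner A x y : psd A ->
  sqm (inner (A x) y) <= ip (A x) x * ip (A y) y.
Proof.
move=> A0; have [->|c0] := eqVneq (inner (A x) y) 0.
  by rewrite /sqm /= expr0n addr0 mulr_ge0.
have := CS_psd x (inner (A x) y *: y) A0.
rewrite {1}/ip innerZr mulrC -sqmE /= (slinZ (Bsa_slin A)) /= /ip innerZl innerZr.
rewrite mulrA -sqmE Re_scale mulrCA expr2.
by rewrite ler_pM2l// sqm_gt0.
Qed.

(** This is A^2 <= M A, obtained from Cauchy-Schwarz for the form of A at x and A x. It converts
    bounds on forms into bounds on norms. *)
Lemma psd_norm A (M : R) : psd A -> (forall x, ip (A x) x <= M * rnorm x ^+ 2) ->
  forall x, rnorm (A x) ^+ 2 <= M * ip (A x) x.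
Proof.
move=> A0 AM x; have [->|/rnorm_gt0 Ax] := eqVneq (A x) 0.
  by rewrite rnorm0 ip0l expr0n mulr0.
have := CS_psd x (A x) A0; rewrite ipxx => h.
have := le_trans h (ler_wpM2l (A0 x) (AM (A x))).
move: (_ ^+ 2) (exprn_gt0 2 Ax) => a a0.
by rewrite mulrCA mulrA expr2 ler_pM2r.
Qed.

Lemma psd_upper A x : ip (A x) x <= `|A| * rnorm x ^+ 2.
Proof.
rewrite (le_trans (ler_norm _))// (le_trans (ip_le _ _))//.
by rewrite expr2 mulrA ler_wpM2r ?rnorm_ge0// Bsa_norm_le.
Qed.

Lemma psd_eq0 A x : psd A -> ip (A x) x = 0 -> A x = 0.
Proof.
move=> A0 Ax; apply: rnorm_eq0; apply/eqP; rewrite -sqrf_eq0 eq_le sqr_ge0 andbT.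
by have := psd_norm A0 (psd_upper A) x; rewrite Ax mulr0.
Qed.

Definition Bsa_sq A := Bsa_U A (Bsa1 H).

Lemma Bsa_sqE A x : Bsa_sq A x = A (A x). Proof. by []. Qed.

Lemma psd_sq A : psd (Bsa_sq A).
Proof. by move=> x; rewrite Bsa_sqE Bsa_ip ipxx sqr_ge0. Qed.

(** * Square roots by iteration *)

Section SquareRoot.
Variable T : Bsa H.
Hypothesis T1 : forall x, rnorm (T x) <= rnorm x.

(** A fixed point Z satisfies 2 Z = T + Z^2, that is, (1 - Z)^2 = 1 - T. So the sequence
    approximates 1 - sqrt(1 - T), and it consists of polynomials in T. *)
Fixpoint sqrt_seq n : Bsa H :=
  if n is m.+1 then 2^-1 *: (T + Bsa_sq (sqrt_seq m)) else 0.

(* The scalar recursion that dominates [sqrt_seq] in norm. *)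
Fixpoint sqrt_maj n : R := if n is m.+1 then 2^-1 * (1 + sqrt_maj m ^+ 2) else 0.

Local Notation Y := sqrt_seq.
Local Notation y_ := sqrt_maj.

Lemma sqrt_maj_bound n : 0 <= y_ n <= 1.
Proof.
elim: n => [|n /andP[h0 h1]] /=; first by rewrite lexx ler01.
have : 0 <= y_ n ^+ 2 <= 1 by rewrite sqr_ge0 expr_le1.
by move=> /andP[? ?]; apply/andP; split; lra.
Qed.

Lemma sqrt_seqS n x : Y n.+1 x = (2^-1)%:C *: (T x + Y n (Y n x)).
Proof. by []. Qed.

Lemma sqrt_seq_comm (S : H -> H) : slin false S ->
  (forall x, S (T x) = T (S x)) -> forall n x, S (Y n x) = Y n (S x).
Proof.
move=> Ss ST; elim=> [|n IH] x; first exact: (slin0 Ss).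
by rewrite !sqrt_seqS (slinZr Ss) (slinD Ss) ST !IH.
Qed.

(** Consecutive terms commute, hence Y(n+2) - Y(n+1) is half the product of the sum and the
    difference of Y(n+1) and Y(n). The scalar sequence factors in the same way, and the two bounds
    propagate together. *)
Lemma sqrt_seq_step n x : rnorm (Y n x) <= y_ n * rnorm x /\
  rnorm (Y n.+1 x - Y n x) <= (y_ n.+1 - y_ n) * rnorm x.
Proof.
elim: n x => [|n IH] x.
  rewrite Bsa0E rnorm0 mul0r lexx; split=> //.
  rewrite subr0 sqrt_seqS !Bsa0E addr0 rnormZr ger0_norm ?invr_ge0//.
  by rewrite /= expr0n addr0 subr0 mulr1 ler_wpM2l// invr_ge0.
have IH1 z := (IH z).1; have IH2 z := (IH z).2.
have bY z : rnorm (Y n.+1 z) <= y_ n.+1 * rnorm z.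
  rewrite -(subrK (Y n z) (Y n.+1 z)) (le_trans (rnormD _ _))//.
  by have := IH1 z; have := IH2 z; lra.
split=> //.
have comm u : Y n (Y n.+1 u) = Y n.+1 (Y n u).
  apply: sqrt_seq_comm; first exact: Bsa_slin.
  by move=> z; rewrite -(@sqrt_seq_comm T) //; exact: Bsa_slin.
have -> : Y n.+2 x - Y n.+1 x
  = (2^-1)%:C *: (Y n.+1 (Y n.+1 x - Y n x) + Y n (Y n.+1 x - Y n x)).
  rewrite (slinB (Bsa_slin (Y n.+1))) (slinB (Bsa_slin (Y n))) comm subrKA.
  rewrite [in LHS]sqrt_seqS [in X in _ - X]sqrt_seqS -scalerBr; congr (_ *: _).
  by rewrite opprD addrACA subrr add0r.
rewrite rnormZr ger0_norm ?invr_ge0// -ler_pdivlMl ?invr_gt0// invrK.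
rewrite (le_trans (rnormD _ _))//.
have := bY (Y n.+1 x - Y n x); have := IH1 (Y n.+1 x - Y n x); have := IH2 x.
have /andP[p0 _] := sqrt_maj_bound n; have /andP[q0 _] := sqrt_maj_bound n.+1.
have -> : y_ n.+2 - y_ n.+1 = 2^-1 * ((y_ n.+1 + y_ n) * (y_ n.+1 - y_ n)).
  have e m : 2 * y_ m.+1 = 1 + y_ m ^+ 2 by rewrite /= mulrA divff// mul1r.
  by have := e n; have := e n.+1; move: (y_ n.+2) (y_ n.+1) (y_ n) => a b c; lra.
move=> i2 i1 b; apply: le_trans (lerD b i1) _.
rewrite -mulrDl (le_trans (ler_wpM2l (addr_ge0 q0 p0) i2))//.
by rewrite !mulrA divff// mul1r.
Qed.

Lemma sqrt_seq_dist n m x : (n <= m)%N ->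
  rnorm (Y m x - Y n x) <= (y_ m - y_ n) * rnorm x.
Proof.
elim: m => [|m IH]; first by rewrite leqn0 => /eqP ->; rewrite !subrr rnorm0 mul0r.
rewrite leq_eqVlt => /orP[/eqP ->|nm]; first by rewrite !subrr rnorm0 mul0r.
rewrite -(subrKA (Y m x)) (le_trans (rnormD _ _))//.
by have := (sqrt_seq_step m x).2; have := IH nm; lra.
Qed.

Lemma sqrt_lim_ex : exists Z : Bsa H,
  [/\ forall x, rnorm (Z x) <= rnorm x,
      forall x, 2%:C *: Z x = T x + Z (Z x) &
      forall S : H -> H, slin false S -> bounded_map S ->
        (forall x, S (T x) = T (S x)) -> forall x, S (Z x) = Z (S x)].
Proof.
pose D := range y_; pose L := sup D.
have Ds : has_sup D.
  split; first by exists (y_ 0), 0.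
  by exists 1 => _ [n _ <-]; case/andP: (sqrt_maj_bound n).
have yL n : y_ n <= L by apply: ub_le_sup; [case: Ds|exists n].
have L1 : L <= 1.
  by apply: ge_sup; [case: Ds|move=> _ [n _ <-]; case/andP: (sqrt_maj_bound n)].
have Lsmall e : 0 < e -> exists n, L - y_ n < e.
  move=> e0; have [_ [n _ <-] hn] := sup_adherent e0 Ds.
  by exists n; move: hn; rewrite -/L; lra.
(* Every identity for the limit Z is proved by bounding its defect by a constant times L - y_n. *)
have zero (v : H) (c : R) : 0 <= c -> (forall n, rnorm v <= (L - y_ n) * c) -> v = 0.
  move=> c0 hv; apply: rnorm_lt0 => e e0.
  have c1 : 0 < c + 1 by rewrite ltr_wpDl.
  have [n] := Lsmall _ (divr_gt0 e0 c1); rewrite ltr_pdivlMr// => hn.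
  by apply: le_trans (hv n) _; have := yL n; nra.
have /choice[Z ZP] x : exists l, forall n, rnorm (l - Y n x) <= (L - y_ n) * rnorm x.
  apply: cauchy_limit => [e e0|n m nm].
    have [->|/rnorm_gt0 x0] := eqVneq x 0; first by exists 0%N; rewrite rnorm0 mulr0.
    have [n] := Lsmall _ (divr_gt0 e0 x0); rewrite ltr_pdivlMr// => hn.
    by exists n.
  rewrite (le_trans (sqrt_seq_dist _ nm))// ler_wpM2r ?rnorm_ge0//.
  by rewrite lerD2r.
have Zb x : rnorm (Z x) <= rnorm x.
  rewrite -(subrK (Y 0 x) (Z x)) (le_trans (rnormD _ _))//.
  by have := ZP x 0%N; rewrite /= rnorm0; have := rnorm_ge0 x; nra.
have Zs : slin false Z.
  split=> [x y|a x].
    apply/eqP; rewrite -subr_eq0; apply/eqP.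
    apply: (zero _ (rnorm (x + y) + (rnorm x + rnorm y))) => [|n].
      by rewrite !addr_ge0 ?rnorm_ge0.
    have -> : Z (x + y) - (Z x + Z y) =
      (Z (x + y) - Y n (x + y)) - ((Z x - Y n x) + (Z y - Y n y)).
      by rewrite (slinD (Bsa_slin (Y n))) addrACA -opprD opprB addrA subrK.
    rewrite (le_trans (rnormB _ _))// [leRHS]mulrDr lerD ?ZP//.
    by rewrite (le_trans (rnormD _ _))// mulrDr lerD ?ZP.
  apply/eqP; rewrite -subr_eq0; apply/eqP.
  apply: (zero _ (rnorm (a *: x) + Re `|a| * rnorm x)) => [|n].
    by rewrite -rnormZ addr_ge0 ?rnorm_ge0.
  have -> : Z (a *: x) - a *: Z x = (Z (a *: x) - Y n (a *: x)) - a *: (Z x - Y n x).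
    by rewrite (slinZ (Bsa_slin (Y n))) scalerBr opprB addrA subrK.
  rewrite (le_trans (rnormB _ _))// mulrDr lerD ?ZP// rnormZ mulrCA ler_wpM2l ?ZP//.
  by rewrite -ler0c -ge0_complex.
have Zbnd : bounded_map Z.
  by apply/bounded_mapP; exists 1; split=> // x; rewrite mul1r.
have Zsa : Z \in @sa_pred R H.
  apply: sa_predP => // x y; apply/eqP; rewrite -subr_eq0; apply/eqP.
  apply/normr0_eq0/le_anti; rewrite normr_ge0 andbT; apply/ler_addgt0Pr => e e0.
  rewrite add0r; have c1 : 0 < 2 * (rnorm x * rnorm y) + 1.
    by rewrite ltr_wpDl// !mulr_ge0 ?rnorm_ge0.
  have [n] := Lsmall _ (divr_gt0 e0 c1); rewrite ltr_pdivlMr// => hn.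
  have -> : ip (Z x) y - ip x (Z y) = ip (Z x - Y n x) y - ip x (Z y - Y n y).
    by rewrite !ipE (Bsa_ip (Y n)); ring.
  have h1 := ip_le (Z x - Y n x) y; have h2 := ip_le x (Z y - Y n y).
  have h3 := ZP x n; have h4 := ZP y n; have := yL n.
  have := ler_normB (ip (Z x - Y n x) y) (ip x (Z y - Y n y)).
  have x0 := rnorm_ge0 x; have y0 := rnorm_ge0 y.
  have := ler_wpM2r y0 h3; have := ler_wpM2l x0 h4.
  by move=> *; nra.
exists (MkBsa Zsa); split=> //= [x|S Ss Sb ST x].
  apply/eqP; rewrite -subr_eq0; apply/eqP.
  apply: (zero _ (2 * rnorm x + 2 * rnorm x)) => [|n].
    by rewrite !addr_ge0 ?mulr_ge0 ?rnorm_ge0.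
  have -> : 2%:C *: Z x - (T x + Z (Z x)) = 2%:C *: (Z x - Y n.+1 x)
     - ((Z (Z x) - Y n (Z x)) + Y n (Z x - Y n x)).
    rewrite scalerBr sqrt_seqS scalerA -rmorphM divff// rmorph1 scale1r.
    rewrite (slinB (Bsa_slin (Y n))) subrKA.
    by apply: inner_ext => w; rewrite !innerE; ring.
  rewrite (le_trans (rnormB _ _))// mulrDr lerD//.
    rewrite rnormZr normr_nat mulrCA ler_wpM2l// (le_trans (ZP _ _))//.
    rewrite ler_wpM2r ?rnorm_ge0// lerD2l lerN2.
    have := sqrt_maj_bound n => /andP[p0 p1].
    (* Half of this square is y_(n+1) - y_n, so the majorant increases. *)
    have : 0 <= (1 - y_ n) ^+ 2 by rewrite sqr_ge0.
    by rewrite /=; lra.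
  rewrite (le_trans (rnormD _ _))// [2 * _]mulr_natl mulr2n mulrDr lerD//.
    by rewrite (le_trans (ZP _ _))// ler_wpM2l ?subr_ge0.
  rewrite (le_trans (sqrt_seq_step n _).1)//.
  have /andP[p0 p1] := sqrt_maj_bound n.
  rewrite (le_trans (ler_wpM2l p0 (ZP x n)))//.
  by rewrite ler_piMl// mulr_ge0 ?rnorm_ge0 ?subr_ge0.
have [M [M0 SM]] := (bounded_mapP S).1 Sb.
apply/eqP; rewrite -subr_eq0; apply/eqP.
apply: (zero _ (M * rnorm x + rnorm (S x))) => [|n].
  by rewrite addr_ge0 ?mulr_ge0 ?rnorm_ge0.
have -> : S (Z x) - Z (S x) = S (Z x - Y n x) - (Z (S x) - Y n (S x)).
  by rewrite (slinB Ss) sqrt_seq_comm// opprB addrA subrK.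
rewrite (le_trans (rnormB _ _))// mulrDr lerD ?ZP//.
by rewrite (le_trans (SM _))// mulrCA ler_wpM2l.
Qed.

End SquareRoot.

(** With T = 1 - B / M one has 0 <= T <= 1, so T is a contraction and X = sqrt(M) (1 - Z) satisfies
    X^2 = M (1 - T) = B. The summand 1 in M keeps it positive when B = 0. The commutation clause is
    what replaces functional calculus later on. *)
Lemma sqrt_ex B : psd B -> exists X,
  [/\ psd X, forall x, X (X x) = B x &
      forall S : H -> H, slin false S -> bounded_map S ->
        (forall x, S (B x) = B (S x)) -> forall x, S (X x) = X (S x)].
Proof.
move=> B0; pose M := `|B| + 1; have M0 : 0 < M by rewrite ltr_wpDl.
pose T := Bsa1 H - M^-1 *: B.
have Tq x : ip (T x) x = rnorm x ^+ 2 - M^-1 * ip (B x) x.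
  by rewrite !BsaE !ipE ipxx.
have BM x : M^-1 * ip (B x) x <= rnorm x ^+ 2.
  rewrite ler_pdivrMl// (le_trans (psd_upper B x))// ler_wpM2r ?sqr_ge0//.
  by rewrite lerDl.
have T0 : psd T by move=> x; rewrite Tq subr_ge0.
have Tle x : ip (T x) x <= 1 * rnorm x ^+ 2.
  by rewrite Tq mul1r gerBl mulr_ge0// invr_ge0 ltW.
have T1 x : rnorm (T x) <= rnorm x.
  rewrite -ler_sqr ?nnegrE ?rnorm_ge0// (le_trans (psd_norm T0 Tle x))//.
  by rewrite mul1r (le_trans (Tle x))// mul1r.
have [Z [Z1 Z2 Zc]] := sqrt_lim_ex T1.
exists (Num.sqrt M *: (Bsa1 H - Z)); split.
- move=> x; rewrite !BsaE ipZl mulr_ge0 ?sqrtr_ge0//.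
  rewrite ipDl ipNl ipxx subr_ge0 (le_trans (ler_norm _))//.
  by rewrite (le_trans (ip_le _ _))// expr2 ler_wpM2r ?rnorm_ge0.
- move=> x; rewrite !BsaZ (slinZr (Bsa_slin _)) scalerA -rmorphM /= -expr2.
  rewrite sqr_sqrtr ?(ltW M0)// -[(_ - _) _]/(x - Z x - Z (x - Z x)) (slinB (Bsa_slin Z)).
  have -> : x - Z x - (Z x - Z (Z x)) = x - (2%:C *: Z x - Z (Z x)).
    by apply: inner_ext => w; rewrite !innerE rmorph_nat; ring.
  rewrite Z2 addrK !BsaE opprB addrC subrK scalerA -rmorphM.
  by rewrite divff ?gt_eqF// rmorph1 scale1r.
- move=> S Ss Sb SB x; rewrite !BsaE (slinZr Ss) (slinB Ss) Zc// => z.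
  by rewrite !BsaE (slinB Ss) (slinZr Ss) SB.
Qed.

(** For commuting roots with difference D, the sum of the roots kills the range of D; both forms are
    nonnegative there, so each root kills it, D^2 = 0 and D = 0. Arbitrary roots X and Y are
    compared with the root from [sqrt_ex], which commutes with both because each commutes with X^2 =
    Y^2. *)
Lemma sqrt_unique X Y : psd X -> psd Y -> (forall x, X (X x) = Y (Y x)) -> X = Y.
Proof.
have key X0 S : psd X0 -> psd S -> (forall x, X0 (X0 x) = S (S x)) ->
    (forall x, X0 (S x) = S (X0 x)) -> X0 = S.
  move=> p1 p2 sq cm; apply: Bsa_ext => v.
  apply/eqP; rewrite -subr_eq0 -BsaB; apply/eqP; set D := X0 - S.
  have sum0 w : X0 (D w) + S (D w) = 0.
    rewrite /D BsaB (slinB (Bsa_slin X0)) (slinB (Bsa_slin S)) cm sq.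
    by rewrite addrA subrK subrr.
  have h w : ip (X0 (D w)) (D w) = 0 /\ ip (S (D w)) (D w) = 0.
    have := congr1 (fun u => ip u (D w)) (sum0 w); rewrite /= ipDl ip0l => e.
    by have := p1 (D w); have := p2 (D w); split; lra.
  have DD : D (D v) = 0.
    by rewrite {1}/D BsaB (psd_eq0 p1 (h v).1) (psd_eq0 p2 (h v).2) subrr.
  apply: rnorm_eq0; apply/eqP; rewrite -sqrf_eq0 -ipxx -Bsa_ip DD ip0l.
  exact: eqxx.
move=> pX pY XY; have [S [pS SS Sc]] := sqrt_ex (psd_sq X).
have c1 x : X (S x) = S (X x).
  by apply: Sc => //; [exact: Bsa_slin|exact: Bsa_bounded].
have c2 x : Y (S x) = S (Y x).
  apply: Sc => [||z]; [exact: Bsa_slin|exact: Bsa_bounded|].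
  by rewrite !Bsa_sqE !XY.
rewrite (key _ _ pX pS _ c1) => [|x]; last by rewrite SS.
by rewrite (key _ _ pY pS _ c2) // => x; rewrite SS Bsa_sqE XY.
Qed.

Lemma opsqrt_eq (F : H -> H) X : psd X -> (forall x, X (X x) = F x) -> opsqrt F = X.
Proof.
move=> pX XF.
have [/psdP p1 h] :
    [set S : Bsa H | positive_op S /\ S \o S = F :> (H -> H)] (opsqrt F).
  by apply: xgetPex; exists X; split; [apply/psdP|apply/funext].
by apply: sqrt_unique => // x; rewrite XF -[RHS](congr1 (fun u => u x) h).
Qed.

Lemma coercive_inv A (c : R) : 0 < c -> (forall x, c * rnorm x ^+ 2 <= ip (A x) x) ->
  exists B, [/\ cancel A B & cancel B A].
Proof.
move=> c0 Ac; have [h [hl hb Ah hA]] := lax_milgram (@Bsa_linear _ _ A) (Bsa_bounded A) c0 Ac.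
have hs : h \in @sa_pred R H.
  apply: sa_predP; first by apply/linear_slin.
    apply/bounded_mapP; exists c^-1; split; first by rewrite invr_ge0 ltW.
    by move=> x; rewrite ler_pdivlMl.
  by move=> x y; rewrite -{2}(hA x) Bsa_ip hA.
by exists (MkBsa hs).
Qed.

(** The quantitative form of membership in the cone. Forwards, |x| is bounded by a multiple of |A
    x|, and |A x|^2 by a multiple of the form through [psd_norm]; backwards, Lax-Milgram supplies
    the inverse. *)
Lemma OmegaP A : Omega A <-> exists2 c : R, 0 < c &
  forall x, c * rnorm x ^+ 2 <= ip (A x) x.
Proof.
split=> [[/psdP A0 [Ab [h [hb Ah hA]]]]|[c c0 Ac]].
  have [M [M0 hM]] := (bounded_mapP _).1 hb.
  pose N := `|A| + 1; have N0 : 0 < N by rewrite ltr_wpDl.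
  pose M' := (M + 1) ^+ 2; have M1 : 0 < M' by rewrite exprn_gt0// ltr_wpDl.
  have NM0 := mulr_gt0 N0 M1.
  exists (N * M')^-1; first by rewrite invr_gt0.
  move=> x; rewrite ler_pdivrMl//.
  have Aup z : ip (A z) z <= N * rnorm z ^+ 2.
    by rewrite (le_trans (psd_upper A z))// ler_wpM2r ?sqr_ge0// lerDl.
  have := psd_norm A0 Aup x => h1; rewrite (mulrC N) -mulrA.
  apply: le_trans (ler_wpM2l (ltW M1) h1).
  have := hM (A x); rewrite Ah => h2.
  have M11 : 0 <= M + 1 by rewrite addr_ge0.
  have : rnorm x <= (M + 1) * rnorm (A x) by rewrite (le_trans h2)// ler_wpM2r ?rnorm_ge0// lerDl.
  by rewrite /M' -exprMn => h3; rewrite ler_sqr ?nnegrE ?mulr_ge0 ?rnorm_ge0.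
split; first by apply/psdP => x; apply: le_trans (Ac x); rewrite mulr_ge0 ?sqr_ge0// ltW.
split; first exact: Bsa_bounded.
have [B [AB BA]] := coercive_inv c0 Ac.
by exists B; split=> //; exact: Bsa_bounded.
Qed.

Lemma Omega_psd A : Omega A -> psd A. Proof. by case=> /psdP. Qed.

Lemma psd_eps A (e : R) : psd A -> 0 < e -> Omega (A + e *: Bsa1 H).
Proof.
move=> A0 e0; apply/OmegaP; exists e => // x.
by rewrite !BsaE ipDl ipZl ipxx lerDr.
Qed.

Lemma Omega1 : Omega (Bsa1 H).
Proof. by apply/OmegaP; exists 1 => // x; rewrite Bsa1E ipxx mul1r. Qed.

(** The direction B is arbitrary because it will be the image of the identity under a map that is
    only known to preserve [Omega]. *)
Lemma psd_lim A B : (forall e, 0 < e -> psd (A + e *: B)) -> psd A.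
Proof.
move=> h x; apply/ler_addgt0Pr => e e0.
pose c := `|ip (B x) x| + 1; have c0 : 0 < c by rewrite ltr_wpDl.
have := h (e / c) (divr_gt0 e0 c0) x.
rewrite !BsaE ipDl ipZl => /le_trans; apply; rewrite lerD2l mulrAC ler_pdivrMr//.
by rewrite ler_pM2l// (le_trans (ler_norm _))// lerDl.
Qed.

Lemma Omega_diff A : exists B (e : R), Omega B /\ A = B - e *: Bsa1 H.
Proof.
exists (A + (`|A| + 1) *: Bsa1 H), (`|A| + 1); split; last by rewrite addrK.
apply/OmegaP; exists 1 => // x; rewrite !BsaE ipDl ipZl ipxx mul1r.
have : - (`|A| * rnorm x ^+ 2) <= ip (A x) x.
  have := psd_upper (- A) x; rewrite normrN BsaN ipNl; lra.
by lra.
Qed.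

End SelfAdjoint.

(** * Conjugation by semilinear maps *)

Section Conjugation.
Variables (R : realType) (H : hilbertType R).
Implicit Types (x y z : H) (a : R[i]) (A B X Y : Bsa H) (f h W : H -> H).

Definition sinv s f := slin s f /\ bounded_invertible f.

Definition suni s W := [/\ slin s W, (forall y, exists x, W x = y) &
  forall x y, inner (W x) (W y) = cj s (inner x y)].

Lemma semilin_invP f : semilin_inv f <-> exists s, sinv s f.
Proof.
split=> [[fb [/linear_slin fl|fl]]|[[] [fs fb]]].
- by exists false.
- by exists true.
- by split=> //; right.
- by split=> //; left; apply/linear_slin.
Qed.

Lemma suni_unitary W : suni false W <-> unitary W.
Proof.
by split=> [[/linear_slin]|[/linear_slin]].
Qed.

Lemma suni_antiunitary W : suni true W <-> antiunitary W.
Proof. by split=> [[]|[]]. Qed.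

Lemma sinv_bounded s f : sinv s f -> bounded_map f.
Proof. by case=> _ []. Qed.

Lemma sinv_inv s f : sinv s f ->
  exists h, [/\ sinv s h, cancel f h & cancel h f].
Proof.
case=> fs [fb [h [hb fh hf]]]; exists h; split=> //; split.
  exact: slin_inv fs fh hf.
by split=> //; exists f.
Qed.

Lemma sinv_dagger s f : sinv s f -> sinv s (dagger f).
Proof.
move=> fi; have [h [hi fh hf]] := sinv_inv fi.
have [fs _] := fi; have fb := sinv_bounded fi; have hb := sinv_bounded hi.
split; first exact: dagger_slin.
split; first exact: dagger_bounded fs fb.
have [d1 d2] := dagger_inv fs fb hb fh hf.
exists (dagger h); split=> //; apply: dagger_bounded hb; exact: hi.1.
Qed.

Lemma sinv_comp s t f h : sinv s f -> sinv t h -> sinv (s (+) t) (f \o h).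
Proof.
move=> fi hi; have [f' [fi' fK fK']] := sinv_inv fi.
have [h' [hi' hK hK']] := sinv_inv hi.
split; first exact: slin_comp fi.1 hi.1.
split; first exact: bounded_map_comp (sinv_bounded hi) (sinv_bounded fi).
exists (h' \o f'); split; first exact: bounded_map_comp (sinv_bounded fi') (sinv_bounded hi').
- exact: can_comp fK hK.
- exact: can_comp hK' fK'.
Qed.

Lemma sinv_id : sinv false (@id H).
Proof.
by split; [exact: slin_id|split; [exact: bounded_id|exists id; split=> //; exact: bounded_id]].
Qed.

Lemma sinv_below s f : sinv s f ->
  exists2 c : R, 0 < c & forall x, c * rnorm x ^+ 2 <= rnorm (f x) ^+ 2.
Proof.
move=> /sinv_inv[h [hi fh hf]].
have [M [M0 hM]] := (bounded_mapP h).1 (sinv_bounded hi).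
exists ((M + 1) ^+ 2)^-1; first by rewrite invr_gt0 exprn_gt0// ltr_wpDl.
have M1 : 0 < M + 1 by rewrite ltr_wpDl.
move=> x; rewrite ler_pdivrMl ?exprn_gt0// -exprMn.
rewrite ler_sqr ?nnegrE ?rnorm_ge0 ?mulr_ge0 ?rnorm_ge0 ?(ltW M1)//.
by rewrite -{1}(fh x) (le_trans (hM _))// ler_wpM2r ?rnorm_ge0// lerDl.
Qed.

(** [insubd] makes this total with values in [Bsa H]; the default 0 does not occur for bounded
    semilinear f ([cnjE]). Antilinear f are covered since the two conjugations of scalars cancel. *)
Definition cnj f A : Bsa H := insubd 0 (f \o A \o dagger f).

Lemma cnjE s f A x : slin s f -> bounded_map f -> cnj f A x = f (A (dagger f x)).
Proof.
move=> fs fb; rewrite -[LHS]/(val (cnj f A) x) val_insubd ifT//.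
apply: sa_predP => [||u v /=].
- have := slin_comp (slin_comp fs (Bsa_slin A)) (dagger_slin fs fb).
  by rewrite addbF addbb.
- apply: (bounded_map_comp (h := f \o A)); first exact: dagger_bounded fs fb.
  by apply: bounded_map_comp fb; exact: Bsa_bounded.
- rewrite (dagger_ip fs fb) Bsa_ip [RHS]ipC (dagger_ip fs fb) (Bsa_ip A).
  by rewrite ipC -Bsa_ip ipC.
Qed.

Lemma induces_cnj s f g : sinv s f -> induces f g <-> g = cnj f.
Proof.
move=> fi; have fs := fi.1; have fb := sinv_bounded fi; split=> [fg|->].
  apply/funext => A; apply: Bsa_ext => x.
  by rewrite (cnjE _ _ fs fb) fg.
by move=> A; apply/funext => x; rewrite (cnjE _ _ fs fb).
Qed.

Section Fixed.
Variables (s : bool) (f : H -> H).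
Hypothesis fi : sinv s f.
Let fs : slin s f := fi.1.
Let fb : bounded_map f := sinv_bounded fi.

Lemma cnj_val A x : cnj f A x = f (A (dagger f x)).
Proof. exact: cnjE fs fb. Qed.

Lemma cnj_ip A x y : ip (cnj f A x) y = ip (A (dagger f x)) (dagger f y).
Proof. by rewrite cnj_val (dagger_ip fs fb). Qed.

Lemma cnjD A B : cnj f (A + B) = cnj f A + cnj f B.
Proof. by apply: Bsa_ext => x; rewrite BsaD !cnj_val BsaD (slinD fs). Qed.

Lemma cnjZ (r : R) A : cnj f (r *: A) = r *: cnj f A.
Proof. by apply: Bsa_ext => x; rewrite BsaZ !cnj_val BsaZ (slinZr fs). Qed.

Lemma cnj_linear : linear (cnj f).
Proof. by move=> r A B; rewrite cnjD cnjZ. Qed.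

Lemma cnj_norm M A : bnd f M -> `|cnj f A| <= M ^+ 2 * `|A|.
Proof.
move=> fM; have [M0 fM'] := fM; have [_ dM] := dagger_bnd fs fM.
apply: Bsa_normP => [|x]; first by rewrite mulr_ge0 ?sqr_ge0.
rewrite cnj_val (le_trans (fM' _))// expr2 -!mulrA ler_wpM2l//.
rewrite (le_trans (Bsa_norm_le _ _))// mulrCA ler_wpM2l//.
Qed.

Lemma cnj_bounded : bounded_map (cnj f).
Proof.
by have [M fM] := (bounded_mapP f).1 fb; exists (M ^+ 2) => A; exact: cnj_norm.
Qed.

Lemma cnj_Omega A : Omega A -> Omega (cnj f A).
Proof.
move=> /OmegaP[c c0 Ac]; apply/OmegaP.
have [d d0 fd] := sinv_below (sinv_dagger fi).
exists (c * d) => [|x]; first exact: mulr_gt0.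
by rewrite cnj_ip (le_trans _ (Ac _))// -mulrA ler_pM2l.
Qed.

End Fixed.

Lemma cnj_comp s t f h A : sinv s f -> sinv t h ->
  cnj (f \o h) A = cnj f (cnj h A).
Proof.
move=> fi hi; apply: Bsa_ext => x; rewrite (cnj_val fi) (cnj_val hi).
rewrite (cnj_val (sinv_comp fi hi)) (dagger_comp fi.1 (sinv_bounded fi) hi.1)//.
exact: sinv_bounded hi.
Qed.

Lemma cnj_id A : cnj id A = A.
Proof. by apply: Bsa_ext => x; rewrite (cnj_val sinv_id) dagger_id. Qed.

Lemma cnjK s f h : sinv s f -> sinv s h -> cancel f h -> cancel (cnj f) (cnj h).
Proof.
move=> fi hi fh A; rewrite -(cnj_comp _ hi fi) (_ : h \o f = id) ?cnj_id//.
exact/funext.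
Qed.

Lemma cnj_GL s f : sinv s f -> GL_V (cnj f).
Proof.
move=> fi; have [h [hi fh hf]] := sinv_inv fi.
split; first exact: cnj_linear fi.
split; first exact: cnj_bounded fi.
exists (cnj h); split; first exact: cnj_bounded hi.
- exact: cnjK fi hi fh.
- exact: cnjK hi fi hf.
Qed.

Lemma cnj_G s f : sinv s f -> G_Omega (cnj f).
Proof.
move=> fi; split; first exact: cnj_GL fi.
have [h [hi fh hf]] := sinv_inv fi.
apply/seteqP; split=> [_ [A AO <-]|A AO]; first exact: cnj_Omega fi _ AO.
exists (cnj h A); first exact: cnj_Omega hi _ AO.
exact: cnjK hi fi hf A.
Qed.

Lemma Bsa_sinv X : Omega X -> sinv false X.
Proof. by case=> _ Xb; split; first exact: Bsa_slin. Qed.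

Lemma dagger_Bsa X : dagger X = X.
Proof.
apply: (dagger_eq (Bsa_slin X) (Bsa_bounded X)) => x y.
exact: Bsa_sym.
Qed.

Lemma cnj_U X : Omega X -> cnj X = Bsa_U X.
Proof.
move=> XO; apply/funext => A; apply: Bsa_ext => x.
by rewrite (cnj_val (Bsa_sinv XO)) dagger_Bsa.
Qed.

Lemma U_one X : Bsa_U (Bsa1 H) X = X.
Proof. exact: Bsa_ext. Qed.

Lemma GL_inj (g : Bsa H -> Bsa H) : GL_V g -> injective g.
Proof. by case=> _ [_ [h [_ gK _]]]; exact: can_inj gK. Qed.

(** Existence is the regrouping of f X f^dagger A f X f^dagger. For uniqueness, X = 1 shows that g
    composed with any candidate is U at g(1), and g is injective. *)
Lemma cnj_star s f : sinv s f -> unique (is_star (cnj f)) (cnj (dagger f)).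
Proof.
move=> fi; have fs := fi.1; have fb := sinv_bounded fi; have di := sinv_dagger fi.
have dd := daggerK fs fb.
have st : is_star (cnj f) (cnj (dagger f)).
  split; first exact: cnj_GL di.
  move=> X; apply/funext => A; apply: Bsa_ext => x /=.
  by rewrite !(cnj_val fi) /= (cnj_val di) dd.
split=> // gs [gG gsE]; apply/funext => A.
have /GL_inj := cnj_GL fi; apply.
have := gsE (Bsa1 H); have [_ /(_ (Bsa1 H)) ->] := st.
by move=> /(congr1 (fun u => u A)) /=; rewrite !U_one.
Qed.

Lemma suni_sinv s W : suni s W ->
  sinv s W /\ exists V, [/\ suni s V, cancel W V, cancel V W & dagger W = V].
Proof.
move=> [Ws Wsurj Wi].
have Wn x : rnorm (W x) = rnorm x.
  apply/eqP; rewrite -(@eqrXn2 _ 2) ?rnorm_ge0//; apply/eqP; apply: complexI.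
  by rewrite -!innerxx Wi innerxx cj_real.
have [V VW] := choice Wsurj.
have Winj : injective W.
  move=> x y Wxy; apply/eqP; rewrite -subr_eq0; apply/eqP; apply: rnorm_eq0.
  by rewrite -Wn (slinB Ws) Wxy subrr rnorm0.
have WV : cancel W V by move=> x; apply: Winj; rewrite VW.
have Vs : slin s V by exact: slin_inv Ws WV VW.
have Wb : bounded_map W.
  by apply/bounded_mapP; exists 1; split=> // x; rewrite mul1r Wn.
have Vb : bounded_map V.
  by apply/bounded_mapP; exists 1; split=> // x; rewrite mul1r -Wn VW.
have Vi x y : inner (V x) (V y) = cj s (inner x y).
  by apply: (can_inj (@cjK R s)); rewrite -Wi !VW cjK.
split; first by split=> //; split=> //; exists V.
exists V; split=> //; first by split=> // y; exists (W y).
apply: (dagger_eq Ws Wb) => x y.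
by rewrite -{1}(VW y) Wi.
Qed.

Lemma suni_rnorm s W x : suni s W -> rnorm (W x) = rnorm x.
Proof.
move=> [_ _ Wi]; apply/eqP; rewrite -(@eqrXn2 _ 2) ?rnorm_ge0//; apply/eqP.
by apply: complexI; rewrite -!innerxx Wi innerxx cj_real.
Qed.

Lemma suni_comp s t W V : suni s W -> suni t V -> suni (s (+) t) (W \o V).
Proof.
move=> [Ws Wo Wi] [Vs Vo Vi]; split; first exact: slin_comp.
  by move=> y; have [x <-] := Wo y; have [z <-] := Vo x; exists z.
by move=> x y /=; rewrite Wi Vi cj_add.
Qed.

Lemma suni_id : suni false (@id H).
Proof. by split=> [|y|]; [exact: slin_id|exists y|]. Qed.

Lemma jordanE A B x : Bsa_jordan A B x = (2^-1 : R[i]) *: (A (B x) + B (A x)).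
Proof. by []. Qed.

Lemma jordan1 A : Bsa_jordan A (Bsa1 H) = A.
Proof.
apply: Bsa_ext => x; rewrite jordanE !Bsa1E -[RHS]scale1r scalerDr -scalerDl.
by congr (_ *: _); field.
Qed.

Lemma jordanC A B : Bsa_jordan A B = Bsa_jordan B A.
Proof. by apply: Bsa_ext => x; rewrite !jordanE addrC. Qed.

Lemma jordanxx A : Bsa_jordan A A = Bsa_sq A.
Proof.
apply: Bsa_ext => x; rewrite jordanE -[RHS]scale1r scalerDr -scalerDl.
by congr (_ *: _); field.
Qed.

Lemma aut_one k : Aut_V k -> k (Bsa1 H) = Bsa1 H.
Proof.
move=> [[_ [_ [h [_ kh hk]]]] kJ].
by have := kJ (h (Bsa1 H)) (Bsa1 H); rewrite jordan1 hk jordanC jordan1 => <-.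
Qed.

Lemma suni_aut s W : suni s W -> Aut_V (cnj W).
Proof.
move=> Wu; have [Wi [V [Vu WV VW dW]]] := suni_sinv Wu.
split; first exact: cnj_GL Wi.
move=> A B; apply: Bsa_ext => x.
rewrite jordanE !(cnj_val Wi) jordanE dW !WV (slinZ Wi.1) (slinD Wi.1).
by congr (_ *: _); rewrite cjV -[2]/((2 : R[i])) -(rmorph_nat (real_complex R)) cj_real.
Qed.

(** The hypothesis says f f^dagger = 1, which for bijective f makes [dagger f] the inverse. Thus
    Jordan automorphisms are recognised by their value at 1. *)
Lemma cnj1_suni s f : sinv s f -> cnj f (Bsa1 H) = Bsa1 H -> suni s f.
Proof.
move=> fi f1; have [h [hi fh hf]] := sinv_inv fi.
have fs := fi.1; have fb := sinv_bounded fi.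
have ffd x : f (dagger f x) = x.
  by have := congr1 (fun u : Bsa H => u x) f1; rewrite /= (cnj_val fi).
split=> // [y|x y]; first by exists (h y).
rewrite (daggerP fs fb); congr (cj s (inner _ _)).
by apply: (can_inj fh); rewrite ffd.
Qed.

Lemma aut_suni s f : sinv s f -> Aut_V (cnj f) <-> suni s f.
Proof.
move=> fi; split=> [/aut_one|]; first exact: cnj1_suni.
exact: suni_aut.
Qed.

(** From X^2 >= c and X^2 <= (|X| + 1) X follows X >= c / (|X| + 1). *)
Lemma sq_Omega X : psd X -> Omega (Bsa_sq X) -> Omega X.
Proof.
move=> X0 /OmegaP[c c0 Xc]; apply/OmegaP.
have M1 : 0 < `|X| + 1 by rewrite ltr_wpDl.
exists (c / (`|X| + 1)); first exact: divr_gt0.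
have Xup x : ip (X x) x <= (`|X| + 1) * rnorm x ^+ 2.
  by rewrite (le_trans (psd_upper X x))// ler_wpM2r ?sqr_ge0// lerDl.
move=> x; rewrite mulrAC ler_pdivrMr// (le_trans (Xc x))//.
by rewrite Bsa_sqE Bsa_ip ipxx (le_trans (psd_norm X0 Xup x))// mulrC.
Qed.

Lemma abs_daggerP s f : sinv s f ->
  Omega (abs_dagger f) /\ forall x, abs_dagger f (abs_dagger f x) = f (dagger f x).
Proof.
move=> fi; have BO := cnj_Omega fi (Omega1 H).
have [X [X0 XX _]] := sqrt_ex (Omega_psd BO).
have -> : abs_dagger f = X.
  by apply: opsqrt_eq => // x; rewrite XX (cnj_val fi).
split=> [|x]; last by rewrite XX (cnj_val fi).
apply: sq_Omega => //; suff -> : Bsa_sq X = cnj f (Bsa1 H) by [].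
exact: Bsa_ext.
Qed.

(** With X = |f^dagger| and Y its inverse, W = Y f. It is isometric because Y^2 f is the inverse of
    f^dagger, which follows from X^2 = f f^dagger. *)
Lemma polar_ex s f : sinv s f -> exists2 W, suni s W & f = abs_dagger f \o W.
Proof.
move=> fi; have [XO XX] := abs_daggerP fi; move: (abs_dagger f) XO XX => X XO XX.
have [Y [Yi XY YX]] := sinv_inv (Bsa_sinv XO).
have [h [hi fh hf]] := sinv_inv fi.
have fs := fi.1; have fb := sinv_bounded fi.
have [d1 d2] := dagger_inv fs fb (sinv_bounded hi) fh hf.
exists (Y \o f); last by apply/funext => x /=; rewrite YX.
have Ysym x y : inner (Y x) y = inner x (Y y).
  by rewrite -{2}(YX x) Bsa_sym YX.
split.
- by have := slin_comp Yi.1 fs; case: (s).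
- by move=> y; exists (h (X y)); rewrite /= hf XY.
- move=> x y /=; rewrite Ysym.
  have -> : Y (Y (f y)) = dagger h y.
    apply: (can_inj XY); rewrite YX; apply: (can_inj XY).
    by rewrite YX XX d2.
  by rewrite (daggerP fs fb) d2.
Qed.

Lemma is_polarP s f W : sinv s f -> is_polar f W <->
  f = abs_dagger f \o W /\ exists t, suni t W /\ slin t f.
Proof.
move=> fi; split=> [[fW [[fl Wu]|[fl Wu]]]|[fW [[] [Wu fl]]]].
- by split=> //; exists false; split; [apply/suni_unitary|apply/linear_slin].
- by split=> //; exists true; split=> //; apply/suni_antiunitary.
- by split=> //; right; split=> //; apply/suni_antiunitary.
- by split=> //; left; split; [apply/linear_slin|apply/suni_unitary].
Qed.

Lemma polar_decomposition s f g : sinv s f -> g = cnj f ->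
     (exists W : H -> H, is_polar f W) /\
     forall W : H -> H, is_polar f W ->
       [/\ Omega (abs_dagger f),
           exists k : Bsa H -> Bsa H,
             [/\ Aut_V k, induces W k & g = Bsa_U (abs_dagger f) \o k],
           forall (x : Bsa H) (k : Bsa H -> Bsa H),
             Omega x -> Aut_V k -> g = Bsa_U x \o k ->
             x = abs_dagger f /\ induces W k &
           forall A : Bsa H,
             g A = abs_dagger f \o W \o A \o dagger W \o abs_dagger f
               :> (H -> H)].
Proof.
move=> fi ->; split.
  have [W Wu fW] := polar_ex fi; exists W; apply/(is_polarP _ fi); split=> //.
  by exists s; split=> //; exact: fi.1.
move=> W /(is_polarP _ fi)[fW [t [Wu ft]]].
have [XO XX] := abs_daggerP fi.
have [Wi _] := suni_sinv Wu.
have gE : cnj f = Bsa_U (abs_dagger f) \o cnj W.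
  by apply/funext => A; rewrite {1}fW (cnj_comp _ (Bsa_sinv XO) Wi) (cnj_U XO).
split=> //.
- exists (cnj W); split=> //; first exact: suni_aut Wu.
  by apply/(induces_cnj _ Wi).
- move=> x k xO kA xk.
  (* Evaluating g at 1 gives x^2 = f f^dagger because k fixes 1; positive roots are unique. *)
  have xE : x = abs_dagger f.
    apply: sqrt_unique; [exact: Omega_psd|exact: Omega_psd|move=> u].
    rewrite XX -[RHS](cnj_val fi (Bsa1 H) u) xk /= (aut_one kA) //.
  split=> //; apply/(induces_cnj _ Wi); apply/funext => A.
  have /GL_inj := cnj_GL (Bsa_sinv XO); apply; rewrite (cnj_U XO).
  by have := congr1 (fun u => u A) xk; rewrite gE xE /=.
- move=> A; apply/funext => u /=; rewrite gE /=; congr (abs_dagger f _).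
  by rewrite (cnj_val Wi).
Qed.

End Conjugation.

(** * Rank one operators and Wigner's argument *)

Section RankOne.
Variables (R : realType) (H : hilbertType R).
Implicit Types (x y z u v w : H) (a b : R[i]) (A B X Y : Bsa H) (f h : H -> H).

Lemma prj_subproof x : (fun v => inner v x *: x) \in @sa_pred R H.
Proof.
apply: sa_predP => [||u v].
- split=> [u v|a u]; first by rewrite innerDl scalerDl.
  by rewrite innerZl scalerA.
- apply/bounded_mapP; exists (rnorm x ^+ 2); split=> [|v]; first exact: sqr_ge0.
  rewrite -ler_sqr ?nnegrE ?rnorm_ge0 ?mulr_ge0 ?sqr_ge0 ?rnorm_ge0//.
  rewrite sqm_rnorm (le_trans (ler_wpM2r (sqr_ge0 _) (CS_inner v x)))//.
  by rewrite le_eqVlt; apply/orP; left; apply/eqP; ring.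
- by rewrite /ip innerZl innerZr -(inner_conj v x) mulrC.
Qed.

Definition prj x : Bsa H := MkBsa (prj_subproof x).

Lemma prjE x v : prj x v = inner v x *: x. Proof. by []. Qed.

Lemma prj_ip x v : ip (prj x v) v = sqm (inner v x).
Proof. by rewrite prjE /ip innerZl (inner_conj v x) -sqmE. Qed.

Lemma prj_psd x : psd (prj x).
Proof. by move=> v; rewrite prj_ip sqm_ge0. Qed.

Lemma sqm_inner_xx x : sqm (inner x x) = rnorm x ^+ 2 * rnorm x ^+ 2.
Proof. by rewrite innerxx sqm_real expr2. Qed.

Lemma prj_norm x : `|prj x| = rnorm x ^+ 2.
Proof.
apply/le_anti/andP; split.
  apply: Bsa_normP => [|v]; first exact: sqr_ge0.
  rewrite -ler_sqr ?nnegrE ?rnorm_ge0 ?mulr_ge0 ?sqr_ge0 ?rnorm_ge0//.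
  rewrite prjE sqm_rnorm (le_trans (ler_wpM2r (sqr_ge0 _) (CS_inner v x)))//.
  by rewrite le_eqVlt; apply/orP; left; apply/eqP; ring.
have [->|x0] := eqVneq x 0; first by rewrite rnorm0 expr0n /= normr_ge0.
have := psd_upper (prj x) x; rewrite prj_ip sqm_inner_xx ler_pM2r//.
by rewrite exprn_gt0// rnorm_gt0.
Qed.

Lemma prj_scale a x : prj (a *: x) = sqm a *: prj x.
Proof.
apply: Bsa_ext => v; rewrite BsaZ !prjE innerZr !scalerA sqmE.
by congr (_ *: _); ring.
Qed.

Lemma prj0 : prj 0 = 0.
Proof. by apply: Bsa_ext => v; rewrite prjE scaler0. Qed.

Lemma prj_dep u v (c : R) : prj v = c *: prj u -> exists a, v = a *: u.
Proof.
move=> uv; have [->|v0] := eqVneq v 0; first by exists 0; rewrite scale0r.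
have e : (rnorm v ^+ 2)%:C *: v = c%:C *: (inner v u *: u).
  by rewrite -innerxx -!prjE uv.
have n0 : (rnorm v ^+ 2)%:C != 0 :> R[i].
  by rewrite -(rmorph0 (real_complex R)) (inj_eq (@complexI R)) sqrf_eq0 gt_eqF ?rnorm_gt0.
exists ((rnorm v ^+ 2)%:C^-1 * (c%:C * inner v u)).
by rewrite -!scalerA -e scalerA mulVf// scale1r.
Qed.

Lemma prj_inj u v : prj u = prj v -> exists2 a, sqm a = 1 & u = a *: v.
Proof.
move=> uv; have nuv : rnorm u ^+ 2 = rnorm v ^+ 2 by rewrite -!prj_norm uv.
have [u0|u0] := eqVneq u 0.
  exists 1; first by rewrite /sqm /=; ring.
  move: nuv; rewrite u0 rnorm0 expr0n => /esym/eqP; rewrite sqrf_eq0 => /eqP/rnorm_eq0 ->.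
  by rewrite scaler0.
have [a ua] : exists a, u = a *: v by apply: (@prj_dep _ _ 1); rewrite scale1r.
exists a => //; move: nuv; rewrite ua sqm_rnorm => /eqP.
rewrite -[X in _ == X]mul1r -subr_eq0 -mulrBl mulf_eq0 subr_eq0 => /orP[/eqP//|].
rewrite sqrf_eq0 => /eqP/rnorm_eq0 v0.
by move: u0; rewrite ua v0 scaler0 eqxx.
Qed.

Lemma cnj_prj s f x : sinv s f -> cnj f (prj x) = prj (f x).
Proof.
move=> fi; have fs := fi.1; have fb := sinv_bounded fi.
apply: Bsa_ext => v; rewrite (cnj_val fi) !prjE (slinZ fs).
by rewrite (daggerPr fs fb) -(daggerK fs fb) (daggerK (dagger_slin fs fb) (dagger_bounded fs fb)).
Qed.

(* |x><y| + |y><x|; locked so that rewriting with additivity does not unfold it. *)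
Definition prj2 x y : Bsa H := locked (prj (x + y) - prj x - prj y).

Lemma prj2_def x y : prj2 x y = prj (x + y) - prj x - prj y.
Proof. by rewrite /prj2 -lock. Qed.

Lemma prj2E x y v : prj2 x y v = inner v x *: y + inner v y *: x.
Proof.
rewrite prj2_def !BsaB !prjE innerDr.
by apply: inner_ext => w; rewrite !innerE; ring.
Qed.

Lemma prj2C x y : prj2 x y = prj2 y x.
Proof. by apply: Bsa_ext => v; rewrite !prj2E addrC. Qed.

Lemma prj2D x y z : prj2 x (y + z) = prj2 x y + prj2 x z.
Proof.
apply: Bsa_ext => v; rewrite BsaD !prj2E innerDr.
by apply: inner_ext => w; rewrite !innerE; ring.
Qed.

Lemma prj2Z x y (r : R) : prj2 x (r%:C *: y) = r *: prj2 x y.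
Proof.
apply: Bsa_ext => v; rewrite BsaZ !prj2E innerZr conjC_real.
by apply: inner_ext => w; rewrite !innerE; ring.
Qed.

Lemma prj2_self x a : prj2 x (a *: x) = (2 * Re a) *: prj x.
Proof.
apply: Bsa_ext => v; rewrite BsaZ prj2E prjE innerZr !scalerA -scalerDl.
congr (_ *: _); rewrite mulrC -mulrDl; congr (_ * _).
by apply: complex_ext; rewrite ?ReD ?ImD ?ReJ ?ImJ /=; ring.
Qed.

Lemma prj_addt x y (t : R) :
  prj (x + t%:C *: y) = prj x + t *: prj2 x y + (t ^+ 2) *: prj y.
Proof.
apply: Bsa_ext => v; rewrite !BsaD !BsaZ prj2E !prjE innerDr innerZr conjC_real.
by apply: inner_ext => w; rewrite !innerE rmorphXn /=; ring.
Qed.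

Lemma rank1_lower A w : psd A -> ip (A w) w != 0 ->
  psd (A - (ip (A w) w)^-1 *: prj (A w)).
Proof.
move=> A0 q0 v; rewrite BsaB BsaZ ipDl ipNl ipZl prj_ip subr_ge0.
rewrite ler_pdivrMl ?lt_def ?q0 ?A0//.
by rewrite -Bsa_sym mulrC CS_psd_inner.
Qed.

(** The form of B vanishes on the complement of x, so B does too; symmetry then makes x an
    eigenvector. This is the extremality of the ray through [prj x]. *)
Lemma rank1_below x B : psd B -> psd (prj x - B) -> exists c : R, B = c *: prj x.
Proof.
move=> B0 xB.
have orth v : inner v x = 0 -> B v = 0.
  move=> vx; apply: psd_eq0 => //; apply/eqP; rewrite eq_le B0 andbT.
  by have := xB v; rewrite BsaB ipDl ipNl prj_ip vx /sqm /= expr0n addr0 add0r oppr_ge0.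
have [x0|x0] := eqVneq x 0.
  by exists 0; rewrite scale0r; apply: Bsa_ext => v; rewrite orth// x0 inner0r.
have n0 : (rnorm x ^+ 2)%:C != 0 :> R[i].
  by rewrite -(rmorph0 (real_complex R)) (inj_eq (@complexI R)) sqrf_eq0 gt_eqF ?rnorm_gt0.
pose b := ip (B x) x / rnorm x ^+ 2.
have bE : b%:C * (rnorm x ^+ 2)%:C = inner (B x) x.
  by rewrite Bsa_real -rmorphM /b divfK// sqrf_eq0 gt_eqF ?rnorm_gt0.
have Bx : B x = b%:C *: x.
  apply/eqP; rewrite -subr_eq0; apply/eqP; apply: inner_eq0.
  set v := B x - _; have vx : inner v x = 0.
    by rewrite /v innerBl innerZl innerxx bE subrr.
  by rewrite {2}/v innerBr innerZr vx mulr0 subr0 -Bsa_sym orth// inner0l.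
exists (b / rnorm x ^+ 2); apply: Bsa_ext => w; rewrite BsaZ prjE.
rewrite -{1}(subrK ((inner w x / (rnorm x ^+ 2)%:C) *: x) w) (slinD (Bsa_slin B)).
rewrite orth ?add0r; last by rewrite innerBl innerZl innerxx divfK ?subrr.
rewrite (slinZ (Bsa_slin B)) Bx !scalerA; congr (_ *: _).
have -> : (b / rnorm x ^+ 2)%:C = b%:C / (rnorm x ^+ 2)%:C by rewrite rmorphM fmorphV.
by rewrite /= mulrAC [RHS]mulrAC (mulrC b%:C).
Qed.

Lemma psd_neq0 A : A != 0 -> exists w, ip (A w) w != 0.
Proof.
move=> A0; apply: contrapT => h; move/eqP: A0; apply.
apply: Bsa_quad_ext => x; rewrite Bsa0E ip0l; apply: contrapT => hx; apply: h.
by exists x; apply/eqP.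
Qed.

Lemma extremal_prj A : psd A -> A != 0 ->
  (forall B, psd B -> psd (A - B) -> exists c : R, B = c *: A) ->
  exists y, A = prj y.
Proof.
move=> A0 /psd_neq0[w q0] hA; set q := ip (A w) w in q0.
have q1 : 0 < q by rewrite lt_def q0 A0.
have [||c cE] := hA (q^-1 *: prj (A w)).
- by move=> v; rewrite BsaZ ipZl mulr_ge0 ?invr_ge0 ?prj_psd// ltW.
- exact: rank1_lower.
(* Both sides of [cE] are compared through their forms at w, which are q and c q. *)
have c1 : c = 1.
  have := congr1 (fun B : Bsa H => ip (B w) w) cE; rewrite /= -!/(ip _ _).
  rewrite -[X in ip X w = _]/((q^-1 *: prj (A w)) w) BsaZ ipZl prj_ip.
  rewrite -[X in _ = ip X w]/((c *: A) w) BsaZ ipZl -/q -Bsa_sym Bsa_real sqm_real -/q.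
  by rewrite expr2 mulrA mulVf// mul1r => /esym/(canRL (mulfK q0)) ->; rewrite divff.
exists ((Num.sqrt q^-1)%:C *: A w).
by rewrite prj_scale sqm_real sqr_sqrtr ?invr_ge0 ?(ltW q1)// cE c1 scale1r.
Qed.

Lemma orth_proj1 u z : exists a, inner (z - a *: u) u = 0.
Proof.
have [->|u0] := eqVneq u 0; first by exists 0; rewrite inner0r.
have n0 : inner u u != 0 by apply: contraNneq u0 => /inner_eq0 ->.
by exists (inner z u / inner u u); rewrite innerBl innerZl divfK ?subrr.
Qed.

(** The component w of z orthogonal to u and v is found by two Gram-Schmidt steps. At w the
    hypothesis reads -|<w,z>|^2 >= 0, and <w,z> = <w,w>. *)
Lemma span2 u v z (c : R) : psd (c *: (prj u + prj v) - prj z) ->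
  exists a b, z = a *: u + b *: v.
Proof.
move=> h; have [a1 z1] := orth_proj1 u z; have [b1 v1] := orth_proj1 u v.
have [c1 w1] := orth_proj1 (v - b1 *: u) (z - a1 *: u).
set w := _ - c1 *: _ in w1.
have wu : inner w u = 0 by rewrite /w innerBl innerZl z1 v1 mulr0 subr0.
have wv : inner w v = 0.
  by move: w1; rewrite innerBr innerZr wu mulr0 subr0.
have wz : inner w z = 0.
  apply: sqm_eq0; apply/eqP; rewrite eq_le sqm_ge0 andbT.
  have := h w; rewrite BsaB BsaZ BsaD ipDl ipNl ipZl ipDl !prj_ip wu wv.
  by rewrite /sqm /= expr0n !addr0 mulr0 add0r oppr_ge0.
have w0 : w = 0.
  apply: inner_eq0; rewrite {2}/w innerBr innerZr w1 innerBr innerZr wz wu.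
  by rewrite !mulr0 !subr0.
exists (a1 - c1 * b1), c1; apply/eqP; rewrite -subr_eq0; apply/eqP.
rewrite -[RHS]w0 /w; apply: inner_ext => x; rewrite !innerE; ring.
Qed.

Lemma affine_ge0 (d : R) : (forall t, 0 <= 1 + t * d) -> d = 0.
Proof.
move=> h; apply/eqP; apply: contraT => d0.
by have := h (- 2 / d); rewrite divfK//; lra.
Qed.

Definition indep u v := forall a, u <> a *: v.

Lemma indep_witness u v : indep u v -> exists w, inner w v = 0 /\ inner w u != 0.
Proof.
move=> uv; have [a wv] := orth_proj1 v u; exists (u - a *: v); split=> //.
apply/negP => /eqP e; have : u - a *: v = 0.
  by apply: inner_eq0; rewrite innerBr innerZr e wv mulr0 subr0.
by move/eqP; rewrite subr_eq0 => /eqP; exact: uv.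
Qed.

(** At a vector w orthogonal to v but not to u, positivity becomes 1 + t (|a|^2 - 1) >= 0 for all
    real t, of either sign. *)
Lemma coef_norm1 u v z a b : indep u v -> z = a *: u + b *: v ->
  (forall t : R, psd (prj u + t *: (prj z - prj u - prj v) + (t ^+ 2) *: prj v)) ->
  sqm a = 1.
Proof.
move=> /indep_witness[w [wv wu]] zE h; apply/eqP; rewrite -subr_eq0; apply/eqP.
apply: affine_ge0 => t; have := h t w.
rewrite !BsaE !ipE !prj_ip wv zE.
rewrite innerDr !innerZr wv mulr0 addr0 sqmM sqmJ.
have -> : sqm (0 : R[i]) = 0 by rewrite /sqm /= expr0n addr0.
have := sqm_gt0 wu; set q := sqm (inner w u) => q0.
rewrite [X in 0 <= X](_ : _ = q * (1 + t * (sqm a - 1))); last by ring.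
by rewrite pmulr_rge0.
Qed.

Lemma prj2_inj u v a b : indep u v -> indep v u ->
  prj2 u (a *: v) = prj2 u (b *: v) -> a = b.
Proof.
move=> /indep_witness[w [wv wu]] vu /(congr1 (fun A : Bsa H => A w)).
rewrite !prj2E !innerZr wv !mulr0 !scale0r !addr0 !scalerA => /eqP.
rewrite -subr_eq0 -scalerBl scaler_eq0 -mulrBr mulf_eq0 (negbTE wu) /= subr_eq0.
by move=> /orP[/eqP //|/eqP v0]; case: (vu 0); rewrite scale0r.
Qed.

Lemma indep_sym u v : v != 0 -> indep u v -> indep v u.
Proof.
move=> v0 uv a va; have a0 : a != 0 by apply: contraNneq v0 => a0; rewrite va a0 scale0r.
by apply: (uv a^-1); rewrite va scalerA mulVf// scale1r.
Qed.

End RankOne.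

(** * The action of an order isomorphism on rank one operators *)

Section Wigner.
Variables (R : realType) (H : hilbertType R).
Implicit Types (x y z u v w : H) (a b : R[i]) (A B : Bsa H).
Variables (g h : Bsa H -> Bsa H).

(** One half of an order isomorphism with its inverse; it is always used for both (g, h) and (h,
    g). *)
Definition ordiso (g h : Bsa H -> Bsa H) :=
  [/\ linear g /\ bounded_map g, cancel g h & forall A, psd A -> psd (g A)].

Hypotheses (gi : ordiso g h) (hi : ordiso h g).

Let gl : linear g. Proof. by case: gi => [[]]. Qed.
Let hl : linear h. Proof. by case: hi => [[]]. Qed.
Let gD A B : g (A + B) = g A + g B.
Proof. by have := gl 1 A B; rewrite !scale1r. Qed.
Let g0 : g 0 = 0.
Proof. by have := gl (-1) 0 0; rewrite scaler0 addr0 scaleN1r addNr. Qed.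
Let gZ (r : R) A : g (r *: A) = r *: g A.
Proof. by have := gl r A 0; rewrite g0 !addr0. Qed.
Let gB A B : g (A - B) = g A - g B.
Proof. by rewrite gD -scaleN1r gZ scaleN1r. Qed.
Let hB A B : h (A - B) = h A - h B.
Proof. by have := hl (-1) B A; rewrite !scaleN1r ![- _ + _]addrC. Qed.
Let hZ (r : R) A : h (r *: A) = r *: h A.
Proof.
have h0 : h 0 = 0 by have := hl (-1) 0 0; rewrite scaler0 addr0 scaleN1r addNr.
by have := hl r A 0; rewrite h0 !addr0.
Qed.
Let gK : cancel g h. Proof. by case: gi. Qed.
Let hK : cancel h g. Proof. by case: hi. Qed.
Let gpsd A : psd A -> psd (g A). Proof. by case: gi => _ _; exact. Qed.
Let hpsd A : psd A -> psd (h A). Proof. by case: hi => _ _; exact. Qed.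

Lemma ordiso_prj x : exists y, g (prj x) = prj y.
Proof.
have [->|x0] := eqVneq x 0; first by exists 0; rewrite prj0.
apply: extremal_prj.
- exact/gpsd/prj_psd.
- apply/eqP => /(congr1 h); rewrite gK -g0 gK => /(congr1 (@Num.norm _ _)).
  by rewrite prj_norm normr0 => /eqP; rewrite sqrf_eq0 gt_eqF ?rnorm_gt0.
- move=> B B0 AB.
  have [||c cE] := @rank1_below _ _ x (h B); first exact: hpsd.
    by rewrite -(gK (prj x)) -hB; exact: hpsd.
  by exists c; rewrite -gZ -cE hK.
Qed.

Lemma ordiso_indep x y u v : g (prj x) = prj u -> g (prj y) = prj v ->
  indep x y -> indep u v.
Proof.
move=> xu yv xy a ua; have : prj x = sqm a *: prj y.
  by rewrite -(gK (prj x)) xu ua prj_scale hZ -yv gK.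
by move=> /prj_dep[b]; exact: xy.
Qed.

(** Let g send |x+y><x+y| to |z><z|. The parallelogram identity makes 2 (|u><u| + |v0><v0|) - |z><z|
    the image of |x-y><x-y|, so z lies in the span of u and v0. Positivity along x + t y forces
    coefficients of modulus 1, and their relative phase is absorbed into v. *)
Lemma ordiso_pair x u y : g (prj x) = prj u -> indep x y -> indep y x ->
  exists2 v, g (prj y) = prj v & g (prj2 x y) = prj2 u v.
Proof.
move=> xu xy yx; have [v0 yv] := ordiso_prj y; have [z xyz] := ordiso_prj (x + y).
have uv := ordiso_indep xu yv xy; have vu := ordiso_indep yv xu yx.
have gN : g (prj2 x y) = prj z - prj u - prj v0 by rewrite prj2_def !gB xyz xu yv.
have [a [b zE]] : exists a b, z = a *: u + b *: v0.
  apply: (@span2 _ _ _ _ _ 2).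
  have -> : 2 *: (prj u + prj v0) - prj z = g (prj (x - y)).
    have -> : x - y = x + (-1)%:C *: y by rewrite rmorphN1 scaleN1r.
    rewrite prj_addt sqrrN expr1n scale1r scaleN1r !gD -scaleN1r gZ scaleN1r gN xu yv.
    apply: Bsa_ext => w; rewrite !BsaE.
    by apply: inner_ext => w'; rewrite !innerE rmorph_nat; ring.
  exact/gpsd/prj_psd.
have a1 : sqm a = 1.
  apply: (coef_norm1 uv zE) => t.
  by rewrite -gN -xu -yv -!gZ -!gD -prj_addt; exact/gpsd/prj_psd.
have b1 : sqm b = 1.
  apply: (@coef_norm1 _ _ v0 u z b a vu); first by rewrite addrC.
  move=> t; have -> : prj z - prj v0 - prj u = g (prj2 y x).
    by rewrite prj2C gN addrAC.
  by rewrite -xu -yv -!gZ -!gD -prj_addt; exact/gpsd/prj_psd.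
exists ((a^* * b) *: v0).
  by rewrite prj_scale sqmM sqmJ a1 b1 mulr1 scale1r.
have -> : g (prj2 x y) = prj2 (a *: u) (b *: v0).
  by rewrite gN zE prj2_def !prj_scale a1 b1 !scale1r.
apply: Bsa_ext => w; rewrite !prj2E !innerZr rmorphM /= conjCK.
by apply: inner_ext => w'; rewrite !innerE; ring.
Qed.

(** Let e be the phase by which iy is sent to e v. Comparing y, iy and (1+i)y gives |1 + e|^2 = |1 +
    i|^2 = 2; with |e| = 1 this leaves e = i or e = -i, the linear and the antilinear case. *)
Lemma ordiso_phase x u y : g (prj x) = prj u -> indep x y -> indep y x ->
  exists s v, [/\ g (prj y) = prj v, g (prj2 x y) = prj2 u v &
    g (prj2 x (iC R *: y)) = prj2 u (cj s (iC R) *: v)].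
Proof.
move=> xu xy yx.
have scal c : c != 0 -> indep x (c *: y) /\ indep (c *: y) x.
  move=> c0; split=> a; first by rewrite scalerA; exact: xy.
  by move=> e; apply: (yx (c^-1 * a)); rewrite -scalerA -e scalerA mulVf// scale1r.
have [v yv Nv] := ordiso_pair xu xy yx.
have uv := ordiso_indep xu yv xy; have vu := ordiso_indep yv xu yx.
have i1 : sqm (iC R) = 1 by rewrite /sqm /=; ring.
have i0 : iC R != 0 by apply: contraTneq (oner_neq0 R) => i0; rewrite -i1 i0 /sqm /= expr0n addr0 eqxx.
have [xiy iyx] := scal _ i0.
have [v1 v1E Nv1] := ordiso_pair xu xiy iyx.
have [e e1 v1e] : exists2 a, sqm a = 1 & v1 = a *: v.
  by apply: prj_inj; rewrite -v1E prj_scale i1 scale1r yv.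
pose c : R[i] := 1 + iC R.
have c2 : sqm c = 2 by rewrite /sqm /c !ReD !ImD /=; ring.
have c0 : c != 0.
  by apply/eqP => c0; move: c2; rewrite c0 /sqm /= expr0n /= addr0; lra.
have [xcy cyx] := scal _ c0.
have [v2 v2E Nv2] := ordiso_pair xu xcy cyx.
have [d d1 v2d] : exists2 a, sqm a = 1 & v2 = a *: (c *: v).
  by apply: prj_inj; rewrite -v2E !prj_scale gZ yv.
have de : 1 + e = d * c.
  apply: (prj2_inj uv vu); rewrite -scalerA -v2d -Nv2 /c !scalerDl !scale1r.
  by rewrite !prj2D gD Nv Nv1 v1e.
have Re0 : Re e = 0.
  have : sqm (1 + e) = 2 by rewrite de sqmM d1 c2 mul1r.
  by move: e1; rewrite /sqm !ReD !ImD /=; lra.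
have Im2 : (Im e - 1) * (Im e + 1) = 0.
  by move: e1; rewrite /sqm Re0 expr0n add0r => e1; rewrite mulrDr mulr1 mulrBl -expr2 e1; ring.
move/eqP: Im2; rewrite mulf_eq0 => /orP[]/eqP Im1.
  exists false, v; split=> //; rewrite Nv1 v1e; congr (prj2 u (_ *: v)).
  by apply: complex_ext => //=; lra.
exists true, v; split=> //; rewrite Nv1 v1e; congr (prj2 u (_ *: v)).
by apply: complex_ext; rewrite //= ?oppr0//; lra.
Qed.

Section BasePoint.
Variables (x u : H).
Hypotheses (x0 : x != 0) (xu : g (prj x) = prj u).

(* If g is conjugation by a map f that is linear (s = false) or antilinear
   (s = true) and f x = u, then f is this map: g (prj2 y x) -/+ i g (prj2 (iy) x)
   is then 2 |f y><u|, resp. its antilinear analogue. *)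
Definition wig (s : bool) y : H :=
  ((2 * rnorm u ^+ 2)^-1)%:C *:
    (g (prj2 x y) u - cj s (iC R) *: g (prj2 x (iC R *: y)) u).

Lemma rnorm_u : 0 < rnorm u ^+ 2.
Proof.
rewrite exprn_gt0// rnorm_gt0//; apply/eqP => u0.
have : prj x = 0 by rewrite -(gK (prj x)) xu u0 prj0 -g0 gK.
move/(congr1 (@Num.norm _ _)); rewrite prj_norm normr0 => /eqP.
by rewrite sqrf_eq0 gt_eqF ?rnorm_gt0.
Qed.

(** This holds for both values of [s]: [prj2] is real-linear in its second argument, and replacing y
    by iy reproduces the formula because the square of [cj s (iC R)] is -1. *)
Lemma wig_slin s : slin s (wig s).
Proof.
split=> [y z|a y].
  rewrite /wig -scalerDr [iC R *: (y + z)]scalerDr !prj2D !gD !BsaD; congr (_ *: _).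
  by apply: inner_ext => w; rewrite !innerE; ring.
rewrite /wig [RHS]scalerA [cj s a * _]mulrC -[RHS]scalerA; congr (_ *: _).
have rN (r : R) : (- r)%:C = - r%:C :> R[i] by rewrite rmorphN.
have Ea : a = (Re a)%:C + (Im a)%:C * iC R.
  by apply: complex_ext; rewrite ?ReD ?ImD ?ReM ?ImM /=; ring.
have -> : a *: y = (Re a)%:C *: y + (Im a)%:C *: (iC R *: y).
  by rewrite {1}Ea scalerDl scalerA.
have -> : iC R *: ((Re a)%:C *: y + (Im a)%:C *: (iC R *: y)) =
    (Re a)%:C *: (iC R *: y) + (- Im a)%:C *: y.
  rewrite rN; apply: inner_ext => w; rewrite !innerE.
  by rewrite (_ : iC R * (_ + _) = (Re a)%:C * (iC R * inner y w) + (Im a)%:C * ((iC R * iC R) * inner y w)); [rewrite iC_sqr|]; ring.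
rewrite !prj2D !prj2Z !gD !gZ !BsaD !BsaZ [in RHS]Ea cjD cjM !cj_real.
move: (g (prj2 x y) u) (g (prj2 x (iC R *: y)) u) => p q.
have ss : cj s (iC R) * cj s (iC R) = -1.
  by rewrite -cjM iC_sqr cjN cj1.
rewrite rN; apply: inner_ext => w; rewrite !innerE.
move: (inner p w) (inner q w) (Re a)%:C (Im a)%:C ss => P Q r t; move: (cj s (iC R)) => i ss.
have -> : (r + t * i) * (P - i * Q) = r * P + t * i * P - r * i * Q - t * (i * i) * Q by ring.
by rewrite ss; ring.
Qed.

(** Here [s] may depend on y. For y independent of x the two terms of [wig] have cancelling
    components along u and contribute v twice, whence the factor 2 in its normalisation. For
    multiples of x the value [false] is taken. *)
Lemma wig_alt y : exists s, g (prj y) = prj (wig s y).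
Proof.
have ru := rnorm_u.
have ru0 : (2 * rnorm u ^+ 2)%:C != 0 :> R[i].
  by rewrite -(rmorph0 (real_complex R)) (inj_eq (@complexI R)) gt_eqF// mulr_gt0.
have [[c yc]|yx] := pselect (exists c, y = c *: x).
  exists false; rewrite yc prj_scale gZ xu.
  suff -> : wig false (c *: x) = c *: u by rewrite prj_scale.
  rewrite /wig scalerA !prj2_self !gZ !BsaZ xu prjE innerxx /= !scalerA -scalerBl scalerA.
  congr (_ *: _).
  have -> : iC R * (2 * Re (iC R * c))%:C * (rnorm u ^+ 2)%:C =
    - ((2 * rnorm u ^+ 2)%:C * (iC R * (Im c)%:C)).
    by apply: complex_ext; rewrite ?ReN ?ImN ?ReM ?ImM /=; ring.
  have -> : (2 * Re c)%:C * (rnorm u ^+ 2)%:C = (2 * rnorm u ^+ 2)%:C * (Re c)%:C :> R[i].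
    by rewrite -!rmorphM /=; congr (_ %:C); ring.
  rewrite opprK -mulrDr fmorphV mulrA mulVf// mul1r.
  by apply: complex_ext; rewrite ?ReD ?ImD ?ReM ?ImM /=; ring.
have {}yx : indep y x by move=> c yc; apply: yx; exists c.
have xy : indep x y by exact: indep_sym.
have [s [v [yv Nv Niv]]] := ordiso_phase xu xy yx.
exists s; rewrite yv; congr prj; rewrite /wig Nv Niv !prj2E innerxx innerZr.
rewrite -[LHS]scale1r -(mulVf ru0) -scalerA -fmorphV; congr (_ *: _).
have ss : cj s (iC R) * cj s (iC R) = -1 by rewrite -cjM iC_sqr cjN cj1.
have sc : (cj s (iC R))^* = - cj s (iC R).
  by rewrite -cj_conj iC_conj cjN.
rewrite sc rmorphM /= rmorph_nat.
move: (cj s (iC R)) ss => i ss; apply: inner_ext => w; rewrite !innerE.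
move: (inner v w) (inner u w) (inner u v) ((rnorm u ^+ 2)%:C : R[i]) => P Q c r.
have -> : r * P + c * Q - i * (r * (i * P) + - i * c * Q) =
  r * P + c * Q - (i * i) * r * P + (i * i) * c * Q by ring.
by rewrite ss; ring.
Qed.

Lemma quad_vanish A B C (t1 t2 t3 : R) : t1 != t2 -> t1 != t3 -> t2 != t3 ->
  A + t1 *: B + (t1 ^+ 2) *: C = 0 -> A + t2 *: B + (t2 ^+ 2) *: C = 0 ->
  A + t3 *: B + (t3 ^+ 2) *: C = 0 -> A = 0 /\ C = 0.
Proof.
move=> n12 n13 n23 e1 e2 e3.
have q (t : R) w : A + t *: B + (t ^+ 2) *: C = 0 ->
    ip (A w) w + t * ip (B w) w + t ^+ 2 * ip (C w) w = 0.
  by move=> /(congr1 (fun D : Bsa H => ip (D w) w)); rewrite /= !ipE.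
have cz w : ip (A w) w = 0 /\ ip (C w) w = 0.
  have := q _ w e1; have := q _ w e2; have := q _ w e3.
  move: (ip (A w) w) (ip (B w) w) (ip (C w) w) => a b c h3 h2 h1.
  have k12 : (t1 - t2) * (b + (t1 + t2) * c) = 0 by lra.
  have k13 : (t1 - t3) * (b + (t1 + t3) * c) = 0 by lra.
  move/eqP: k12; rewrite mulf_eq0 subr_eq0 (negbTE n12) /= => /eqP k12.
  move/eqP: k13; rewrite mulf_eq0 subr_eq0 (negbTE n13) /= => /eqP k13.
  have : (t2 - t3) * c = 0 by lra.
  move/eqP; rewrite mulf_eq0 subr_eq0 (negbTE n23) /= => /eqP c0.
  by split=> //; move: k12 h1; rewrite c0 !mulr0 !addr0 => ->; rewrite mulr0 addr0.
by split; apply: Bsa_quad_ext => w; rewrite Bsa0E ip0l; case: (cz w).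
Qed.

Lemma wig_three s y z (t1 t2 t3 : R) : t1 != t2 -> t1 != t3 -> t2 != t3 ->
  (forall t, t \in [:: t1; t2; t3] ->
     g (prj (y + t%:C *: z)) = prj (wig s (y + t%:C *: z))) ->
  g (prj y) = prj (wig s y) /\ g (prj z) = prj (wig s z).
Proof.
move=> n12 n13 n23 ht; have ws := wig_slin s.
have key t : t \in [:: t1; t2; t3] ->
   (g (prj y) - prj (wig s y)) + t *: (g (prj2 y z) - prj2 (wig s y) (wig s z))
   + (t ^+ 2) *: (g (prj z) - prj (wig s z)) = 0.
  move=> /ht; rewrite (slinD ws) (slinZr ws) !prj_addt !gD !gZ => e.
  rewrite -[RHS](subrr (g (prj y) + t *: g (prj2 y z) + t ^+ 2 *: g (prj z))) {2}e.
  move: (g (prj y)) (g (prj2 y z)) (g (prj z)) (prj (wig s y)) (prj (wig s z)) => a b c d d'.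
  move: (prj2 _ _) => d''; apply: Bsa_ext => w; rewrite !BsaE.
  by apply: inner_ext => w'; rewrite !innerE; ring.
have m1 : t1 \in [:: t1; t2; t3] by rewrite !inE eqxx.
have m2 : t2 \in [:: t1; t2; t3] by rewrite !inE eqxx orbT.
have m3 : t3 \in [:: t1; t2; t3] by rewrite !inE eqxx !orbT.
have [e1 e2] := quad_vanish n12 n13 n23 (key _ m1) (key _ m2) (key _ m3).
by split; apply/eqP; rewrite -subr_eq0 ?e1 ?e2.
Qed.

(** Suppose [false] fails at y and [true] fails at z. Among the five points y + n z with n from 0 to
    4, three share the same value of [s], and three points determine a quadratic, so this [s] is
    right at both y and z. *)
Lemma wig_global : exists s, forall y, g (prj y) = prj (wig s y).
Proof.
apply: contrapT => hn.
have [y hy] : exists y, g (prj y) <> prj (wig false y).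
  by apply: contrapT => hh; apply: hn; exists false => y; apply: contrapT => ?; apply: hh; exists y.
have [z hz] : exists z, g (prj z) <> prj (wig true z).
  by apply: contrapT => hh; apply: hn; exists true => z; apply: contrapT => ?; apply: hh; exists z.
pose E s (n : nat) := g (prj (y + n%:R%:C *: z)) = prj (wig s (y + n%:R%:C *: z)).
have no s m n p : (m < n < p)%N -> E s m -> E s n -> E s p -> False.
  move=> /andP[mn np] em en ep.
  have [||||e1 e2] := @wig_three s y z m%:R n%:R p%:R.
  - by rewrite eqr_nat ltn_eqF.
  - by rewrite eqr_nat ltn_eqF// (ltn_trans mn).
  - by rewrite eqr_nat ltn_eqF.
  - by move=> t; rewrite !inE => /or3P[]/eqP ->.
  by case: s em en ep e1 e2.
have alt n : E false n \/ E true n.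
  by have [[] e] := wig_alt (y + n%:R%:C *: z); [right|left].
case: (alt 0%N) => p0; case: (alt 1%N) => p1; case: (alt 2%N) => p2;
case: (alt 3%N) => p3; case: (alt 4%N) => p4;
first [ exact: (no _ 0%N 1%N 2%N isT p0 p1 p2) | exact: (no _ 0%N 1%N 3%N isT p0 p1 p3) | exact: (no _ 0%N 1%N 4%N isT p0 p1 p4)
  | exact: (no _ 0%N 2%N 3%N isT p0 p2 p3) | exact: (no _ 0%N 2%N 4%N isT p0 p2 p4) | exact: (no _ 0%N 3%N 4%N isT p0 p3 p4)
  | exact: (no _ 1%N 2%N 3%N isT p1 p2 p3) | exact: (no _ 1%N 2%N 4%N isT p1 p2 p4) | exact: (no _ 1%N 3%N 4%N isT p1 p3 p4)
  | exact: (no _ 2%N 3%N 4%N isT p2 p3 p4) ].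
Qed.

End BasePoint.
End Wigner.

(** * From rank one operators to all of V, and uniqueness of the implementing map *)

Section StructureGroup.
Variables (R : realType) (H : hilbertType R).
Implicit Types (x y z u v w : H) (a b : R[i]) (A B : Bsa H).

Lemma Bsa_lin (k : Bsa H -> Bsa H) : linear k ->
  [/\ forall A B, k (A + B) = k A + k B, forall A B, k (A - B) = k A - k B &
      forall (r : R) A, k (r *: A) = r *: k A].
Proof.
move=> kl.
have k0 : k 0 = 0 by have := kl (-1) 0 0; rewrite scaler0 addr0 scaleN1r addNr.
have kZ (r : R) A : k (r *: A) = r *: k A by have := kl r A 0; rewrite k0 !addr0.
have kD A B : k (A + B) = k A + k B by have := kl 1 A B; rewrite !scale1r.
by split=> // A B; rewrite kD -scaleN1r kZ scaleN1r.
Qed.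

(** The maps preserve [Omega] only, but A + e 1 lies in [Omega] for positive A and e > 0, and
    letting e tend to 0 gives the closed cone. *)
Lemma G_ordiso (g : Bsa H -> Bsa H) : G_Omega g ->
  exists h, ordiso g h /\ ordiso h g.
Proof.
move=> [[gl [gb [h [hb gK hK]]]] gO]; exists h.
have hl : linear h by move=> r A B; apply: (can_inj gK); rewrite gl !hK.
have lim (k : Bsa H -> Bsa H) : linear k -> (forall A, Omega A -> Omega (k A)) ->
    forall A, psd A -> psd (k A).
  move=> kl kO A A0; apply: (@psd_lim _ _ _ (k (Bsa1 H))) => e e0.
  have -> : k A + e *: k (Bsa1 H) = k (A + e *: Bsa1 H).
    by have [kD _ kZ] := Bsa_lin kl; rewrite kD kZ.
  exact/Omega_psd/kO/psd_eps.
have gO' A : Omega A -> Omega (g A) by move=> AO; rewrite -gO; exists A.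
have hO' A : Omega A -> Omega (h A).
  by rewrite -{1}gO => -[B BO <-]; rewrite gK.
by split; split=> //; exact: lim.
Qed.

(** At w, A dominates a rank one operator with the same form value there. Applying k keeps the
    inequality and fixes the rank one operator. *)
Lemma psd_fix_le (k : Bsa H -> Bsa H) A : linear k ->
  (forall B, psd B -> psd (k B)) -> (forall x, k (prj x) = prj x) ->
  psd A -> psd (k A - A).
Proof.
move=> kl k0 kP A0 w; have [q0|q0] := eqVneq (ip (A w) w) 0.
  by rewrite BsaB ipDl ipNl q0 subr0; exact: k0.
have := k0 _ (rank1_lower A0 q0) w; set q := ip (A w) w in q0 *.
have [_ kB kZ] := Bsa_lin kl.
rewrite kB kZ kP !BsaE !ipE prj_ip -Bsa_sym Bsa_real -/q sqm_real.
by rewrite expr2 mulrA mulVf// mul1r.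
Qed.

(** Both k^-1 g and g^-1 k fix the rank one operators, so [psd_fix_le] applies to each, giving g A
    >= k A and k A >= g A for positive A. Every A is a difference of two positive operators. *)
Lemma ordiso_ext (g h k l : Bsa H -> Bsa H) :
  ordiso g h -> ordiso h g -> ordiso k l -> ordiso l k ->
  (forall x, g (prj x) = k (prj x)) -> g = k.
Proof.
move=> [[gl _] gK gp] [[hl _] hK hp] [[kl _] kK kp] [[ll _] lK lp] gk.
have lgl : linear (l \o g) by move=> r A B /=; rewrite gl ll.
have hkl : linear (h \o k) by move=> r A B /=; rewrite kl hl.
have psdE A : psd A -> g A = k A.
  move=> A0.
  have h1 : psd (l (g A) - A).
    apply: (@psd_fix_le (l \o g)) => // [B B0|x] /=; first exact/lp/gp.
    by rewrite gk kK.
  have h2 : psd (h (k A) - A).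
    apply: (@psd_fix_le (h \o k)) => // [B B0|x] /=; first exact/hp/kp.
    by rewrite -gk gK.
  have h3 : psd (k A - g A).
    by have := gp _ h2; have [_ -> _] := Bsa_lin gl; rewrite hK.
  have h4 : psd (g A - k A).
    by have := kp _ h1; have [_ -> _] := Bsa_lin kl; rewrite lK.
  apply: Bsa_quad_ext => x; have := h3 x; have := h4 x.
  by rewrite !BsaB !ipDl !ipNl; lra.
apply/funext => A; have [B [e [BO ->]]] := Omega_diff A.
have [_ gB gZ] := Bsa_lin gl; have [_ kB kZ] := Bsa_lin kl.
rewrite gB gZ kB kZ !psdE //; first exact: (Omega_psd (Omega1 H)).
exact: Omega_psd.
Qed.

Lemma sinv_ordiso s (f : H -> H) : sinv s f -> exists h,
  ordiso (cnj f) h /\ ordiso h (cnj f).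
Proof. by move=> /cnj_G /G_ordiso. Qed.

Hypothesis nz : exists x : H, x <> 0.

Lemma G_induced (g : Bsa H -> Bsa H) : G_Omega g -> exists s f, sinv s f /\ g = cnj f.
Proof.
move=> /G_ordiso[h [gi hi]]; have [x /eqP x0] := nz.
have [u xu] := ordiso_prj gi hi x.
have [s fP] := wig_global gi hi x0 xu.
have fs := wig_slin gi x u s; set f := wig g x u s in fP fs.
have [[gl [M gM]] gK gp] := gi; have [[hl [N hN]] hK hp] := hi.
(* Bounds on g and h transfer to f and its inverse because the norm of |x><x| is |x|^2. *)
have fb x1 : rnorm (f x1) ^+ 2 <= M * rnorm x1 ^+ 2.
  by rewrite -!prj_norm -fP gM.
have fb' x1 : rnorm x1 ^+ 2 <= N * rnorm (f x1) ^+ 2.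
  by rewrite -!prj_norm -fP -{1}(gK (prj x1)) hN.
have sq (K : R) (u1 v1 : H) : rnorm u1 ^+ 2 <= K * rnorm v1 ^+ 2 ->
    rnorm u1 <= (`|K| + 1) * rnorm v1.
  move=> h1; rewrite -ler_sqr ?nnegrE ?mulr_ge0 ?addr_ge0 ?rnorm_ge0//.
  rewrite (le_trans h1)// exprMn ler_wpM2r ?sqr_ge0//.
  have := ler_norm K; have := normr_ge0 K; nra.
have finj : injective f.
  move=> y z yz; apply/eqP; rewrite -subr_eq0; apply/eqP; apply: rnorm_eq0; apply/eqP.
  rewrite -sqrf_eq0 eq_le sqr_ge0 andbT (le_trans (fb' _))//.
  by rewrite (slinB fs) yz subrr rnorm0 expr0n mulr0.
have fsurj w : exists y, f y = w.
  have [y wy] := ordiso_prj hi gi w.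
  have : prj w = prj (f y) by rewrite -fP -wy hK.
  move=> /prj_inj[a _ ->]; exists (cj s a *: y).
  by rewrite (slinZ fs) cjK.
have [f' ff'] := choice fsurj.
have f'f : cancel f f' by move=> y; apply: finj; rewrite ff'.
have fi : sinv s f.
  split=> //; split.
    by apply/bounded_mapP; exists (`|M| + 1); split=> [|y]; [rewrite addr_ge0|exact/sq/fb].
  exists f'; split=> //.
  apply/bounded_mapP; exists (`|N| + 1); split=> [|y]; first by rewrite addr_ge0.
  by apply: sq; rewrite -{2}(ff' y).
exists s, f; split=> //; have [l [ki li]] := sinv_ordiso fi.
apply: (ordiso_ext gi hi ki li) => y.
by rewrite fP (cnj_prj _ fi).
Qed.

Hypothesis dim2 : forall x : H, exists y, forall a, y <> a *: x.

Lemma dim2_indep x : x != 0 -> exists y, indep x y /\ indep y x.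
Proof.
move=> x0; have [y yx] := dim2 x; exists y; split=> //.
exact: indep_sym x0 yx.
Qed.

(** Two independent eigenvectors share their eigenvalue, as their sum is again an eigenvector. The
    second dimension matters: on a line, conjugation satisfies the hypotheses with s = true. *)
Lemma slin_homothety s (T : H -> H) : slin s T -> injective T ->
  (forall x, exists a, T x = a *: x) -> s = false /\ exists a, forall x, T x = a *: x.
Proof.
move=> Ts Ti hT.
have eq2 x y a b : indep x y -> indep y x -> T x = a *: x -> T y = b *: y -> a = b.
  move=> xy yx Tx Ty; have [c Tc] := hT (x + y).
  have /eqP : (a - c) *: x = (c - b) *: y.
    apply/eqP; rewrite -subr_eq0; apply/eqP.
    have : T (x + y) - c *: (x + y) = 0 by rewrite Tc subrr.
    by rewrite (slinD Ts) Tx Ty => <-; apply: inner_ext => w; rewrite !innerE; ring.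
  have [->|ac] := eqVneq a c.
    rewrite subrr scale0r eq_sym scaler_eq0 subr_eq0 => /orP[/eqP //|/eqP y0].
    by case: (yx 0); rewrite scale0r.
  move=> /eqP e; case: (xy ((a - c)^-1 * (c - b))).
  by rewrite -scalerA -e scalerA mulVf ?scale1r// subr_eq0.
have [x /eqP x0] := nz; have [y [xy yx]] := dim2_indep x0.
have [a Tx] := hT x; have [b Ty] := hT y.
have ab : a = b by exact: eq2 Tx Ty.
have all z : T z = a *: z.
  have [z0|z0] := eqVneq z 0; first by rewrite z0 (slin0 Ts) scaler0.
  have [c Tz] := hT z; rewrite Tz; have [[d zd]|zx] := pselect (exists d, z = d *: x).
    have d0 : d != 0 by apply: contraNneq z0 => d0; rewrite zd d0 scale0r.
    congr (_ *: _); rewrite ab; apply: (@eq2 z y) => //.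
      move=> e ze; apply: (xy (d^-1 * e)).
      by rewrite -scalerA -ze zd scalerA mulVf// scale1r.
    by move=> e ye; apply: (yx (e * d)); rewrite -scalerA -zd.
  have zx' : indep z x by move=> d zd; apply: zx; exists d.
  by congr (_ *: _); apply: (eq2 z x) => //; exact: indep_sym x0 zx'.
split; last by exists a.
have a0 : a != 0.
  apply: contra_neq x0 => a0; apply: Ti; rewrite (slin0 Ts) all a0 scale0r //.
case: s Ts => // Ts; have := slinZ Ts (iC R) x.
rewrite !all /= iC_conj !scalerA => /eqP; rewrite -subr_eq0 -scalerBl scaler_eq0 (negbTE x0) orbF.
rewrite mulNr opprK (mulrC a) -mulr2n mulrn_eq0 mulf_eq0 (negbTE a0) orbF /=.
by rewrite -sqrf_eq0 expr2 iC_sqr oppr_eq0 oner_eq0.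
Qed.

(** On each vector, f and h differ by a phase because they agree on rank one operators. Applied to
    h^-1 f, [slin_homothety] makes the phase constant and shows that its type, the sum of the two
    types, is linear. *)
Lemma cnj_inj s t f h : sinv s f -> sinv t h -> cnj f = cnj h ->
  s = t /\ exists l : R[i], `|l| = 1 /\ forall x, f x = l *: h x.
Proof.
move=> fi hi fh; have [h' [hi' hK hK']] := sinv_inv hi.
have [f' [fi' fK fK']] := sinv_inv fi.
have fhP x : exists2 a, sqm a = 1 & f x = a *: h x.
  by apply: prj_inj; rewrite -(cnj_prj _ fi) -(cnj_prj _ hi) fh.
have Ts := slin_comp hi'.1 fi.1.
have [||st [a Ta]] := slin_homothety Ts.
- by apply: inj_comp; [exact: can_inj hK'|exact: can_inj fK].
- by move=> x; have [a _ fx] := fhP x; exists (cj t a); rewrite /= fx (slinZ hi'.1) hK.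
split; first by case: (s) (t) st => [] [].
have fE x : f x = cj t a *: h x.
  by rewrite -(slinZ hi.1) -Ta /= hK'.
exists (cj t a); split=> //; apply: sqm1_norm.
have [x x0] := nz; have [b b1 fx] := fhP x.
have : (cj t a - b) *: h x = 0 by rewrite scalerBl -fE -fx subrr.
move/eqP; rewrite scaler_eq0 => /orP[|/eqP hx0].
  by rewrite subr_eq0 => /eqP ->.
by case: x0; rewrite -(hK x) hx0 (slin0 hi'.1).
Qed.

End StructureGroup.

(** * Antiunitaries and Cayley transforms *)

Section Conjugations.
Variables (R : realType) (H : hilbertType R).
Implicit Types (x y z : H) (a b : R[i]).

Lemma ip_iC x y : ip x (iC R *: y) = Im (inner x y).
Proof. by rewrite (inner_ip x y). Qed.

Lemma ip_iCC x y : ip (iC R *: x) (iC R *: y) = ip x y.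
Proof.
by rewrite ip_iC innerZl ImM /ip /=; ring.
Qed.

(* A maximal set K on which the inner product is real is a closed real
   subspace with H = K + iK; the antiunitary is a + ib |-> a - ib. *)
Lemma antiunitary_ex : exists J : H -> H, suni true J.
Proof.
pose Q := [set A : set H | forall x y, A x -> A y -> Im (inner x y) = 0].
have [K [KQ Kmax]] : exists K, Q K /\ forall B, K `<` B -> ~ Q B.
  apply: Zorn_bigcup => F FQ Ft x y [A FA Ax] [B FB By].
  by have [AB|BA] := Ft _ _ FA FB; [apply: (FQ _ FB) => //; exact: AB|
     apply: (FQ _ FA) => //; exact: BA].
(* Maximality: a vector whose products with all of K are real can be adjoined. All closure
   properties of K follow from this. *)
have Kin z : (forall k, K k -> Im (inner z k) = 0) -> K z.
  move=> zK; apply: contrapT => nKz; apply: (Kmax (K `|` [set z])).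
    split; first by move=> t Kt; left.
    by move=> /(_ z) h; apply: nKz; apply: h; right.
  move=> s t [Ks|->] [Kt|->]; [exact: KQ|..].
  - by rewrite inner_conj ImJ zK// oppr0.
  - exact: zK.
  - by rewrite innerxx.
have KD x y : K x -> K y -> K (x + y).
  by move=> Kx Ky; apply: Kin => k Kk; rewrite innerDl ImD !KQ// addr0.
have KZ (r : R) x : K x -> K (r%:C *: x).
  by move=> Kx; apply: Kin => k Kk; rewrite innerZl Im_scale KQ// mulr0.
have KN x : K x -> K (- x).
  by move=> Kx; apply: Kin => k Kk; rewrite innerNl ImN KQ// oppr0.
have Ks : rsubspace K.
  split=> //; first by apply: Kin => k _; rewrite inner0l.
  move=> x hx; apply: Kin => k Kk; rewrite -ip_iC.
  apply/normr0_eq0/le_anti; rewrite normr_ge0 andbT.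
  apply/ler_addgt0Pr => e e0; rewrite add0r.
  have c1 : 0 < rnorm (iC R *: k) + 1 by rewrite ltr_wpDl ?rnorm_ge0.
  have [k' Kk' xk'] := hx _ (divr_gt0 e0 c1).
  have -> : ip x (iC R *: k) = ip (x - k') (iC R *: k).
    by rewrite ipDl ipNl (ip_iC k') KQ// subr0.
  rewrite (le_trans (ip_le _ _))//; move: xk'; rewrite ler_pdivlMr// => xk'.
  by have := rnorm_ge0 (x - k'); have := rnorm_ge0 (iC R *: k); nra.
(* The residual h - a is orthogonal to K for [ip], so -i(h - a) has real products with K and
   therefore belongs to K. *)
have dec h : exists p : H * H, [/\ K p.1, K p.2 & h = p.1 + iC R *: p.2].
  have [a Ka ha] := nearest_point h Ks; exists (a, - (iC R *: (h - a))); split=> //=.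
    apply/KN/Kin => k Kk; rewrite -ip_iC ip_iCC; exact: ha.
  by rewrite scalerN scalerA iC_sqr scaleN1r opprK addrC subrK.
have uniq (a b : H) : K a -> K b -> a + iC R *: b = 0 -> a = 0 /\ b = 0.
  move=> Ka Kb e.
  have : rnorm a ^+ 2 + rnorm b ^+ 2 = 0.
    rewrite -!ipxx -(ip_iCC b b) -[RHS](ip0l (a + iC R *: b)) -e.
    have ab0 : ip a (iC R *: b) = 0 by rewrite ip_iC KQ.
    by rewrite !ipDl !ipDr (ipC (iC R *: b) a) ab0; ring.
  move/eqP; rewrite paddr_eq0 ?sqr_ge0// !sqrf_eq0 => /andP[/eqP a0 /eqP b0].
  by split; exact: rnorm_eq0.
have [p pP] := choice dec; pose J h := (p h).1 - iC R *: (p h).2.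
have JE (a b : H) : K a -> K b -> J (a + iC R *: b) = a - iC R *: b.
  move=> Ka Kb; have [K1 K2 e] := pP (a + iC R *: b).
  have [|||e1 e2] := uniq ((p (a + iC R *: b)).1 - a) ((p (a + iC R *: b)).2 - b).
  - by apply: KD => //; exact: KN.
  - by apply: KD => //; exact: KN.
  - rewrite scalerBr addrACA -opprD -e subrr //.
  rewrite /J; move/eqP: e1; rewrite subr_eq0 => /eqP ->.
  by move/eqP: e2; rewrite subr_eq0 => /eqP ->.
have JJ h : J (J h) = h.
  have [K1 K2 e] := pP h; rewrite [in RHS]e {2}/J -scalerN JE//; last exact: KN.
  by rewrite scalerN opprK.
exists J; split; first split.
- move=> x y; have [a1 b1 ->] := pP x; have [a2 b2 ->] := pP y.
  rewrite addrACA -scalerDr (JE _ _ (KD _ _ a1 a2) (KD _ _ b1 b2)) (JE _ _ a1 b1) (JE _ _ a2 b2).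
  by apply: inner_ext => w; rewrite !innerE; ring.
- move=> c x; have [Ka Kb ->] := pP x.
  move: (p x).1 (p x).2 Ka Kb => a b Ka Kb.
  have cE : c = (Re c)%:C + iC R * (Im c)%:C.
    by apply: complex_ext; rewrite ?ReD ?ImD ?ReM ?ImM /=; ring.
  have -> : c *: (a + iC R *: b) = ((Re c)%:C *: a - (Im c)%:C *: b) +
      iC R *: ((Re c)%:C *: b + (Im c)%:C *: a).
    apply: inner_ext => w; rewrite {1}cE !innerE.
    move: (inner a w) (inner b w) (Re c)%:C (Im c)%:C => A B r t.
    have -> : (r + iC R * t) * (A + iC R * B) =
      r * A + t * ((iC R * iC R) * B) + iC R * (r * B + t * A) by ring.
    by rewrite iC_sqr; ring.
  rewrite (JE _ _ (KD _ _ (KZ _ _ Ka) (KN _ (KZ _ _ Kb))) (KD _ _ (KZ _ _ Kb) (KZ _ _ Ka))).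
  rewrite (JE _ _ Ka Kb).
  apply: inner_ext => w; rewrite /= {5}cE rmorphD rmorphM /= iC_conj !conjC_real !innerE.
  move: (inner a w) (inner b w) (Re c)%:C (Im c)%:C => A B r t.
  have -> : (r + - iC R * t) * (A - iC R * B) =
    r * A + t * ((iC R * iC R) * B) - iC R * (r * B + t * A) by ring.
  by rewrite iC_sqr; ring.
- by move=> y; exists (J y).
- move=> x y; have [Ka Kb xE] := pP x; have [Kc Kd yE] := pP y.
  rewrite [in RHS]xE [in RHS]yE /J /=.
  move: (p x).1 (p x).2 (p y).1 (p y).2 Ka Kb Kc Kd => a b c d Ka Kb Kc Kd.
  have rl s t : K s -> K t -> (inner s t)^* = inner s t.
    move=> Ks' Kt; apply: complex_ext; first by rewrite ReJ.
    by rewrite ImJ KQ// oppr0.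
  rewrite !innerE !(rmorphD, rmorphM, rmorphN) /= !conjCK !rl//.
  by rewrite !iC_conj; ring.
Qed.

End Conjugations.

(** * Cayley transforms and the factorisation of unitaries *)

Section Cayley.
Variables (R : realType) (H : hilbertType R).
Implicit Types (x y z : H) (a b : R[i]) (K : Bsa H).

(** Since <Kx,x> is real, the real part of <(1 - iK)x,x> is |x|^2, so Lax-Milgram applies with
    constant 1 and the inverse is a contraction. *)
Lemma resolvent_ex K : exists r : H -> H, [/\ linear r,
  forall x, rnorm (r x) <= rnorm x,
  forall y, r (y - iC R *: K y) = y & forall x, r x - iC R *: K (r x) = x].
Proof.
pose T y := y - iC R *: K y.
have Tl : linear T.
  move=> a x y; rewrite /T Bsa_linear.
  by apply: inner_ext => w; rewrite !innerE; ring.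
have Tb : bounded_map T.
  apply/bounded_mapP; exists (1 + Re `|iC R| * `|K|); split.
    by rewrite addr_ge0// mulr_ge0//; have := normr_ge0 (iC R); rewrite lecE => /andP[].
  move=> x; rewrite mulrDl mul1r (le_trans (rnormB _ _))// lerD2l rnormZ -mulrA.
  rewrite ler_wpM2l ?Bsa_norm_le//.
  by have := normr_ge0 (iC R); rewrite lecE => /andP[].
have Tc x : 1 * rnorm x ^+ 2 <= ip (T x) x.
  rewrite mul1r /T ipDl ipNl ipxx /ip innerZl Bsa_real ReM /=.
  by rewrite mul0r mulr0 subrr subr0.
have [r [rl rb Tr rT]] := lax_milgram Tl Tb ltr01 Tc.
by exists r; split=> // x; have := rb x; rewrite mul1r.
Qed.

Definition resolvent K : H -> H := sval (cid (resolvent_ex K)).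

(** This equals (1 + iK)(1 - iK)^-1; the resolvent form makes the dependence on K easy to
    estimate. *)
Definition cay K x : H := 2%:C *: resolvent K x - x.

Lemma resolventP K : [/\ linear (resolvent K),
  forall x, rnorm (resolvent K x) <= rnorm x,
  forall y, resolvent K (y - iC R *: K y) = y &
  forall x, resolvent K x - iC R *: K (resolvent K x) = x].
Proof. by rewrite /resolvent; case: cid. Qed.

Lemma cayE K y : cay K (y - iC R *: K y) = y + iC R *: K y.
Proof.
have [_ _ r1 _] := resolventP K; rewrite /cay r1.
by apply: inner_ext => w; rewrite !innerE rmorph_nat; ring.
Qed.

Lemma cay_surj K x : exists y, x = y - iC R *: K y.
Proof. by have [_ _ _ r2] := resolventP K; exists (resolvent K x); rewrite r2. Qed.

Lemma cay_suni K : suni false (cay K).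
Proof.
have [rl _ _ _] := resolventP K.
split.
- apply/linear_slin => a x y; rewrite /cay rl.
  by apply: inner_ext => w; rewrite !innerE; ring.
- move=> y; have [x ->] := cay_surj (- K) y.
  exists (x - iC R *: K x); rewrite cayE BsaN scalerN opprK //.
- move=> x y; have [u ->] := cay_surj K x; have [v ->] := cay_surj K y.
  by rewrite !cayE /= !innerE iC_conj Bsa_sym; ring.
Qed.

Lemma cay0 x : cay 0 x = x.
Proof. by have := cayE 0 x; rewrite Bsa0E scaler0 subr0 addr0. Qed.

(** The resolvent identity r_t - r_s = r_t (i (t - s) K) r_s, in which both resolvents are
    contractions. *)
Lemma cay_lipschitz K (s t : R) x :
  rnorm (cay (t *: K) x - cay (s *: K) x) <=
  (2 * (Re `|iC R| * `|K|)) * `|t - s| * rnorm x.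
Proof.
have [rtl rtb rt1 rt2] := resolventP (t *: K).
have [rsl rsb rs1 rs2] := resolventP (s *: K).
rewrite /cay opprB addrA subrK -scalerBr rnormZr normr_nat.
set y := resolvent (s *: K) x.
have -> : resolvent (t *: K) x - y = resolvent (t *: K) (iC R *: ((t - s)%:C *: K y)).
  have -> : resolvent (t *: K) x - y = resolvent (t *: K) (x - (y - iC R *: (t *: K) y)).
    by rewrite (slinB ((linear_slin _).1 rtl)) rt1.
  congr (resolvent _ _).
  rewrite -{1}(rs2 x) -/y !BsaZ.
  by apply: inner_ext => w; rewrite !innerE rmorphB /=; ring.
rewrite -!mulrA ler_pM2l// (le_trans (rtb _))// rnormZ rnormZr.
have i0 : 0 <= Re `|iC R| by have := normr_ge0 (iC R); rewrite lecE => /andP[].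
rewrite ler_wpM2l// mulrCA ler_wpM2l// (le_trans (Bsa_norm_le _ _))//.
by rewrite ler_wpM2l// rsb.
Qed.

(** When Re W >= 0, 1 + W is coercive, and K = i (1 - W)(1 + W)^-1 inverts the Cayley transform; [k]
    is this operator written with r = (1 + W)^-1. *)
Lemma cay_of_unitary (W : H -> H) : suni false W -> (forall x, 0 <= ip (W x) x) ->
  exists K, forall x, W x = cay K x.
Proof.
move=> Wu W0; have [Ws _ Wi] := Wu.
pose T x := x + W x.
have Tl : linear T.
  move=> a x y; rewrite /T (slinD Ws) (slinZ Ws) /=.
  by apply: inner_ext => w; rewrite !innerE; ring.
have Tb : bounded_map T.
  apply/bounded_mapP; exists 2; split=> // x.
  by rewrite (le_trans (rnormD _ _))// (suni_rnorm _ Wu) mulr_natl mulr2n.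
have Tc x : 1 * rnorm x ^+ 2 <= ip (T x) x by rewrite mul1r /T ipDl ipxx lerDl.
have [r [/linear_slin rs rb Tr rT]] := lax_milgram Tl Tb ltr01 Tc.
pose k x := iC R *: (2%:C *: r x - x).
have ks : slin false k.
  apply/linear_slin => a x y; rewrite /k (slinD rs) (slinZ rs) /=.
  by apply: inner_ext => w; rewrite !innerE; ring.
have kb : bounded_map k.
  have i0 : 0 <= Re `|iC R| by have := normr_ge0 (iC R); rewrite lecE => /andP[].
  apply/bounded_mapP; exists (Re `|iC R| * 3); split; first by rewrite mulr_ge0.
  move=> x; rewrite rnormZ -mulrA ler_wpM2l// (le_trans (rnormB _ _))//.
  rewrite rnormZr normr_nat; have := rb x; rewrite mul1r; lra.
have kT x : k (T x) = iC R *: (x - W x).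
  rewrite /k Tr /T; congr (_ *: _).
  by apply: inner_ext => w; rewrite !innerE rmorph_nat; ring.
have ksa : k \in @sa_pred R H.
  apply: sa_predP => // x y; rewrite -(rT x) -(rT y) !kT /T /ip; congr Re.
  by rewrite !innerE iC_conj !Wi /=; ring.
exists (MkBsa ksa) => x.
(* This is the solution of x = y - iKy and W x = y + iKy. *)
pose y := (2^-1)%:C *: T x.
have h2 : 2%:C * (2^-1)%:C = 1 :> R[i] by rewrite -rmorphM divff// rmorph1.
have ky : k y = iC R *: (x - y).
  have yE : y = T ((2^-1)%:C *: x).
    by rewrite /y /T scalerDr (slinZr Ws).
  rewrite yE kT -yE; congr (_ *: _); rewrite (slinZr Ws) /y /T.
  apply: inner_ext => w; rewrite !innerE.
  move: (inner x w) (inner (W x) w) ((2^-1)%:C) h2 => A B h h2.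
  transitivity (2%:C * h * A - h * A - h * B); first by rewrite rmorph_nat; ring.
  by rewrite h2; ring.
have xE : x = y - iC R *: MkBsa ksa y.
  by rewrite [MkBsa _ _]ky scalerA iC_sqr scaleN1r opprK addrC subrK.
rewrite [in RHS]xE cayE [MkBsa _ _]ky scalerA iC_sqr scaleN1r opprB addrA.
have -> : y + y = 2%:C *: y by rewrite rmorph_nat scaler_nat mulr2n.
by rewrite /y scalerA h2 scale1r /T addrC addKr.
Qed.

(** Stability under complex scalars upgrades the real orthogonality of the nearest point to
    orthogonality for [inner]. *)
Lemma proj_ex (N : set H) : rsubspace N -> (forall a x, N x -> N (a *: x)) ->
  exists P : Bsa H, (forall x, N (P x)) /\
    forall x k, N k -> inner (x - P x) k = 0.
Proof.
move=> Ns NZ; have [N0 ND NZr Ncl] := Ns.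
have /choice[p pP] x : exists y, N y /\ forall k, N k -> inner (x - y) k = 0.
  have [y Ny xy] := nearest_point x Ns; exists y; split=> // k Nk.
  by rewrite inner_ip !xy//; exact: NZ.
have pN x : N (p x) by case: (pP x).
have po x k : N k -> inner (x - p x) k = 0 by case: (pP x) => _; exact.
have pu x y : N y -> (forall k, N k -> inner (x - y) k = 0) -> p x = y.
  move=> Ny xy; apply/eqP; rewrite -subr_eq0; apply/eqP; apply: inner_eq0.
  have NB : N (p x - y) by rewrite -scaleN1r; apply: ND => //; exact: NZ.
  have := xy _ NB; have := po x _ NB.
  rewrite !innerBl => /eqP; rewrite subr_eq0 => /eqP ->.
  by move=> /eqP; rewrite subr_eq0 => /eqP ->; rewrite subrr.
have pl : linear p.
  move=> a x y; apply: pu => [|k Nk]; first by apply: ND => //; exact: NZ.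
  have -> : a *: x + y - (a *: p x + p y) = a *: (x - p x) + (y - p y).
    by apply: inner_ext => w; rewrite !innerE; ring.
  by rewrite innerDl innerZl !po// mulr0 addr0.
have pin x y : inner (p x) y = inner (p x) (p y).
  rewrite -{1}(subrK (p y) y) innerDr inner_conj po// conjC0 add0r //.
have pb : bounded_map p.
  apply/bounded_mapP; exists 1; split=> // x; rewrite mul1r.
  have [->|/rnorm_gt0 p0] := eqVneq (p x) 0; first by rewrite rnorm0 rnorm_ge0.
  rewrite -(ler_pM2l p0) -expr2 -ipxx {1}/ip -pin.
  exact: le_trans (ler_norm _) (ip_le _ _).
have psa : p \in @sa_pred R H.
  apply: sa_predP => //; first exact/linear_slin.
  by move=> x y; congr Re; rewrite pin [RHS]inner_conj [in RHS]pin -inner_conj.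
by exists (MkBsa psa).
Qed.

(** One factor is not enough: [cay K] + 1 is twice an invertible resolvent, so -1 is never in the
    spectrum of a single transform. The factor removed here has P as spectral projection, and P
    reduces W because |S| - S commutes with W and its inverse. *)
Lemma unitary_cay (W : H -> H) : suni false W ->
  exists K1 K2, forall x, W x = cay K1 (cay K2 x).
Proof.
move=> Wu; have [Wi [V [Vu WV VW _]]] := suni_sinv Wu.
have [Ws _ Win] := Wu; have [Vs _ Vin] := Vu.
have adj x y : inner (W x) y = inner x (V y) by rewrite -{1}(VW y) Win.
have adj' x y : inner (V x) y = inner x (W y) by rewrite -{1}(WV y) Vin.
have hC : ((2^-1)%:C)^* = (2^-1)%:C :> R[i] by exact: conjC_real.
(* -i/2 = 1/(2i), so that S below is (W - W^dagger)/(2i), the imaginary part of W. *)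
pose c : R[i] := - iC R * (2^-1)%:C.
pose S0 x := c *: (W x - V x).
have S0s : slin false S0.
  apply/linear_slin => a x y; rewrite /S0 !(slinD Ws) !(slinD Vs) (slinZ Ws) (slinZ Vs) /=.
  by apply: inner_ext => w; rewrite !innerE; ring.
have c0 : 0 <= Re `|c| by have := normr_ge0 c; rewrite lecE => /andP[].
have S0b : bounded_map S0.
  apply/bounded_mapP; exists (Re `|c| * 2); split; first by rewrite mulr_ge0.
  move=> x; rewrite rnormZ -mulrA ler_wpM2l// (le_trans (rnormB _ _))//.
  by rewrite (suni_rnorm _ Wu) (suni_rnorm _ Vu) mulr_natl mulr2n.
have S0sa : S0 \in @sa_pred R H.
  apply: sa_predP => // x y; rewrite /ip /S0; congr Re.
  by rewrite !innerE adj adj' /c rmorphM rmorphN /= iC_conj hC; ring.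
pose S := MkBsa S0sa; have SE x : S x = c *: (W x - V x) by [].
have SW x : W (S x) = S (W x).
  by rewrite !SE (slinZ Ws) (slinB Ws) /= VW WV.
have SV x : V (S x) = S (V x).
  by rewrite !SE (slinZ Vs) (slinB Vs) /= VW WV.
have Sq x : ip (S x) x = Im (inner (W x) x).
  rewrite /ip SE !innerE adj' (inner_conj (W x) x) /c.
  by rewrite !(ReM, ImM, ReD, ImD, ReN, ImN, ReJ, ImJ) /=; field.
have [X [X0 XX Xc]] := sqrt_ex (psd_sq S).
have bW : bounded_map W := sinv_bounded Wi.
have bV : bounded_map V := sinv_bounded (suni_sinv Vu).1.
have XW x : W (X x) = X (W x).
  by apply: Xc => // z; rewrite !Bsa_sqE !SW.
have XV x : V (X x) = X (V x).
  by apply: Xc => // z; rewrite !Bsa_sqE !SV.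
have XS x : S (X x) = X (S x).
  by apply: Xc => [||z]; [exact: Bsa_slin|exact: Bsa_bounded|rewrite !Bsa_sqE].
pose N := [set z | X z - S z = 0].
have DX : slin false (X - S) := Bsa_slin (X - S).
have DE x : (X - S) x = X x - S x by [].
have Ns : rsubspace N.
  split; rewrite /N /=.
  - by rewrite -DE (slin0 DX).
  - by move=> x y; rewrite -!DE => hx hy; rewrite (slinD DX) hx hy addr0.
  - by move=> r x; rewrite -!DE => hx; rewrite (slinZr DX) hx scaler0.
  - move=> x hx; rewrite -DE; apply: rnorm_lt0 => e e0.
    have [d d0 hd] := bnd_small x (Bsa_bnd (X - S)) e0.
    have [k] := hx d d0; rewrite -DE => k0 xk.
    by have := hd k xk; rewrite (slinB DX) k0 subr0.
have NZ a x : N x -> N (a *: x).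
  by rewrite /N /= -!DE => hx; rewrite (slinZ DX) hx scaler0.
have [P [PN Po]] := proj_ex Ns NZ.
have NW x : N x -> N (W x).
  move=> Nx; change (X (W x) - S (W x) = 0).
  by rewrite -XW -SW -(slinB Ws) -[RHS](slin0 Ws); congr W.
have NV x : N x -> N (V x).
  move=> Nx; change (X (V x) - S (V x) = 0).
  by rewrite -XV -SV -(slinB Vs) -[RHS](slin0 Vs); congr V.
have PK x : N x -> P x = x.
  move=> Nx; apply/esym/eqP; rewrite -subr_eq0; apply/eqP; apply: inner_eq0.
  by apply: Po; have [_ ND _ _] := Ns; rewrite -scaleN1r; apply: ND => //; exact: NZ.
have Porth x : (forall k, N k -> inner x k = 0) -> P x = 0.
  move=> hx; apply: inner_eq0.
  by have := Po x (P x) (PN x); rewrite innerBl hx// sub0r => /eqP; rewrite oppr_eq0 => /eqP.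
pose K2 := 2 *: P - Bsa1 H.
have K2E x : K2 x = 2%:C *: P x - x by [].
have theta x : cay K2 (iC R *: (x - P x) - iC R *: P x) = x.
  set z := _ - _.
  have Pq : P (x - P x) = 0 by apply: Porth => k; exact: Po.
  (* The preimage of z under 1 - i K2, computed where K2 = 1 and where K2 = -1: -i/(1 - i) = (1 -
     i)/2 and i/(1 + i) = (1 + i)/2. *)
  pose y1 := (2^-1)%:C *: ((1 - iC R) *: P x) + (2^-1)%:C *: ((1 + iC R) *: (x - P x)).
  have K2y : K2 y1 = (2^-1)%:C *: ((1 - iC R) *: P x) - (2^-1)%:C *: ((1 + iC R) *: (x - P x)).
    rewrite K2E /y1 (slinD (Bsa_slin P)) !(slinZ (Bsa_slin P)) /= Pq (PK (P x) (PN x)).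
    by apply: inner_ext => w; rewrite !innerE rmorph_nat; ring.
  have h2 : (2^-1)%:C + (2^-1)%:C = 1 :> R[i] by rewrite -rmorphD -(rmorph1 (real_complex R)); congr (_ %:C); field.
  have -> : z = y1 - iC R *: K2 y1.
    rewrite K2y /z /y1; apply: inner_ext => w; rewrite !innerE.
    move: (inner (P x) w) (inner x w) => p X'.
    have -> : (2^-1)%:C * ((1 - iC R) * p) + (2^-1)%:C * ((1 + iC R) * (X' - p)) -
      iC R * ((2^-1)%:C * ((1 - iC R) * p) - (2^-1)%:C * ((1 + iC R) * (X' - p))) =
      (2^-1)%:C * ((1 - iC R) - iC R + iC R * iC R) * p + (2^-1)%:C * ((1 + iC R) + iC R + iC R * iC R) * (X' - p).
      by ring.
    rewrite iC_sqr.
    have -> : (2^-1)%:C * (1 - iC R - iC R + -1) * p = - (((2^-1)%:C + (2^-1)%:C) * (iC R * p)) by ring.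
    have -> : (2^-1)%:C * (1 + iC R + iC R + -1) * (X' - p) = ((2^-1)%:C + (2^-1)%:C) * (iC R * (X' - p)) by ring.
    by rewrite h2; ring.
  rewrite cayE K2y /y1; apply: inner_ext => w; rewrite !innerE.
  move: (inner (P x) w) (inner x w) => p X'.
  have -> : (2^-1)%:C * ((1 - iC R) * p) + (2^-1)%:C * ((1 + iC R) * (X' - p)) +
      iC R * ((2^-1)%:C * ((1 - iC R) * p) - (2^-1)%:C * ((1 + iC R) * (X' - p))) =
      (2^-1)%:C * ((1 - iC R) + iC R - iC R * iC R) * p + (2^-1)%:C * ((1 + iC R) - iC R - iC R * iC R) * (X' - p).
    by ring.
  rewrite iC_sqr.
  have -> : (2^-1)%:C * (1 - iC R + iC R - -1) * p + (2^-1)%:C * (1 + iC R - iC R - -1) * (X' - p) = ((2^-1)%:C + (2^-1)%:C) * X' by ring.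
  by rewrite h2 mul1r.
have [_ [T [Tu cT Tc _]]] := suni_sinv (cay_suni K2).
have TE x : T x = iC R *: (x - P x) - iC R *: P x.
  by apply: (can_inj cT); rewrite Tc theta.
have W1u : suni false (W \o T) := suni_comp Wu Tu.
have [x|K1 hK1] := cay_of_unitary W1u.
  have NDq k : N k -> inner (x - P x) k = 0 by exact: Po.
  rewrite /= TE (slinB Ws) !(slinZ Ws) /=.
  set q := x - P x in NDq *; set p := P x.
  have Np : N p by exact: PN.
  have xE : x = p + q by rewrite /q addrC subrK.
  clearbody p q; rewrite xE.
  have -> : ip (iC R *: W q - iC R *: W p) (p + q) = Im (inner (W p) p) - Im (inner (W q) q).
    have Wqp : inner (W q) p = 0 by rewrite adj NDq//; exact: NV.
    have Wpq : inner (W p) q = 0 by rewrite inner_conj NDq ?conjC0//; exact: NW.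
    rewrite /ip !innerE Wqp Wpq.
    by rewrite !(ReM, ReD, ReN, ImM, ImD, ImN) /=; ring.
  rewrite -!Sq.
  have -> : S p = X p by apply/esym/eqP; rewrite -subr_eq0; apply/eqP; exact: Np.
  (* As (|S| - S)(|S| + S) = 0, the range of |S| + S lies in N. Since q is orthogonal to N, symmetry
     gives (|S| + S) q = 0. *)
  have -> : S q = - X q.
    apply/eqP; rewrite -addr_eq0 addrC; apply/eqP; apply: inner_ext => w.
    rewrite inner0l innerDl !Bsa_sym -innerDr; apply: NDq.
    change (X (X w + S w) - S (X w + S w) = 0).
    rewrite (slinD (Bsa_slin X)) (slinD (Bsa_slin S)) XX Bsa_sqE XS.
    by rewrite [X in _ - X]addrC subrr.
  by rewrite ipNl opprK addr_ge0.
exists K1, K2 => x; rewrite -hK1 /= cT //.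
Qed.

End Cayley.

(** * Connected components *)

Section Components.
Variable T : topologicalType.
Implicit Types A B Z S F : set T.

Lemma connected_component_mono A B x :
  A `<=` B -> connected_component A x `<=` connected_component B x.
Proof.
by move=> AB y [C [Cx CA Cc Cy]]; exists C => //; split=> // z /CA /AB.
Qed.

(** S is clopen in Z, being both the trace of F0 and the trace of the complement of F1. F0 and F1
    are allowed to overlap outside Z. *)
Lemma connected_component_eq Z S x0 F0 F1 S' :
  S `<=` F0 -> S' `<=` F1 -> closed F0 -> closed F1 ->
  Z = S `|` S' -> S `&` F1 = set0 -> S' `&` F0 = set0 ->
  (forall x, S x -> connected_component S x0 x) ->
  forall x, S x -> connected_component Z x = S.
Proof.
move=> SF0 SF1 F0c F1c ZE SF1' SF0' conn x Sx.
have SZ : S `<=` Z by rewrite ZE; left.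
have mono y : connected_component S y `<=` connected_component Z y.
  exact: connected_component_mono.
apply/seteqP; split=> y; last first.
  move=> Sy; apply: (@connected_component_trans _ _ x0); last exact/mono/conn.
  exact/connected_component_sym/mono/conn.
move=> [B [Bx BZ Bc By]].
have BS : B `&` S = B.
  apply: Bc; first by exists x.
    exists (~` F1); first exact: closed_openC.
    apply/seteqP; split=> z [Bz].
      by move=> Sz; split=> // F1z; have : (S `&` F1) z by []; rewrite SF1'.
    move=> nF1; split=> //; have := BZ _ Bz; rewrite ZE => -[//|/SF1 //].
  exists F0 => //; apply/seteqP; split=> z [Bz].
    by move=> /SF0.
  move=> F0z; split=> //; have := BZ _ Bz; rewrite ZE => -[//|Sz].
  by have : (S' `&` F0) z by []; rewrite SF0'.
by move: By; rewrite -BS => -[].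
Qed.

Lemma components_two Z S S' x0 x1 F0 F1 :
  S `<=` F0 -> S' `<=` F1 -> closed F0 -> closed F1 ->
  Z = S `|` S' -> S `&` F1 = set0 -> S' `&` F0 = set0 ->
  S x0 -> S' x1 ->
  (forall x, S x -> connected_component S x0 x) ->
  (forall x, S' x -> connected_component S' x1 x) ->
  components Z = [set S; S'].
Proof.
move=> SF0 SF1 F0c F1c ZE SF1' SF0' Sx0 Sx1 c0 c1.
have e0 := connected_component_eq SF0 SF1 F0c F1c ZE SF1' SF0' c0.
have e1 := connected_component_eq SF1 SF0 F1c F0c (etrans ZE (setUC _ _)) SF0' SF1' c1.
apply/seteqP; split=> [_ [x Zx <-]|A [->|->]].
- move: Zx; rewrite {1}ZE => -[Sx|Sx]; [left|right]; [exact: e0|exact: e1].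
- by exists x0; [rewrite ZE; left|exact: e0].
- by exists x1; [rewrite ZE; right|exact: e1].
Qed.

End Components.

(** The path is controlled on [0, 1] only. Composing with the clamp [cl], which is 1-Lipschitz,
    extends it continuously to the line without changing the image of the segment. *)
Lemma lipschitz_connected (R : realType) (V : normedModType R) (f : R -> V) (C : R) :
  (forall s t, 0 <= s <= 1 -> 0 <= t <= 1 -> `|f s - f t| <= C * `|s - t|) ->
  connected [set f t | t in `[0, 1]].
Proof.
move=> fC; pose cl (t : R) := Num.max 0 (Num.min 1 t).
have cl01 t : 0 <= cl t <= 1.
  by rewrite /cl le_max lexx /= ge_max ler01 ge_min lexx.
have clid t : 0 <= t <= 1 -> cl t = t.
  by move=> /andP[t0 t1]; rewrite /cl min_r// max_r.
have clP t : [\/ t <= 0 /\ cl t = 0, 0 <= t <= 1 /\ cl t = t | 1 <= t /\ cl t = 1].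
  have [t0|t0] := lerP t 0.
    by constructor 1; rewrite /cl max_l// ge_min t0 orbT.
  have [t1|t1] := lerP t 1; first by constructor 2; rewrite clid ?(ltW t0).
  by constructor 3; rewrite /cl min_l ?ltW// max_r.
have cll s t : `|cl s - cl t| <= `|s - t|.
  have := ler_norm (s - t); have := ler_norm (- (s - t)); rewrite normrN => h1 h2.
  rewrite ler_norml; apply/andP.
  by case: (clP s) => -[hs ->]; case: (clP t) => -[ht ->]; split; lra.
have C0 : 0 <= `|C| by [].
have -> : [set f t | t in `[0, 1]] = (f \o cl) @` `[0, 1].
  apply/seteqP; split=> _ [t t01 <-]; exists t => //=; rewrite clid//;
    by move: t01; rewrite /= in_itv.
apply: connected_continuous_connected; first exact: segment_connected.
apply: continuous_subspaceT => t.
apply/cvgrPdist_le => e e0; near=> s => /=.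
rewrite (le_trans (fC _ _ (cl01 _) (cl01 _)))//.
rewrite (le_trans (ler_wpM2r (normr_ge0 _) (ler_norm C)))//.
rewrite (le_trans (ler_wpM2l C0 (cll t s)))//.
have C1 : 0 < `|C| + 1 by rewrite ltr_wpDl.
have : `|t - s| <= e / (`|C| + 1).
  near: s; apply: cvgr_dist_le; last by rewrite divr_gt0.
  exact: cvg_id.
rewrite ler_pdivlMr//; have := normr_ge0 (t - s); nra.
Unshelve. all: by end_near. Qed.

(** * Paths in the operator norm and the two components *)

Section OperatorPaths.
Variables (R : realType) (H : hilbertType R).
Local Notation V := (Bsa H).
Implicit Types (x y z w : H) (A : V) (s : bool) (f W : H -> H) (k : V -> V).

(** The topology lives on [BL], whereas [cnj] produces plain functions. The default 0 is not reached
    on [GL_V] ([BLofE]). *)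
Definition BLof (g : V -> V) : BL V V := insubd 0 g.

Lemma BLofE (g : V -> V) : GL_V g -> BLof g = g :> (V -> V).
Proof.
move=> [gl [gb _]]; rewrite -[LHS]/(val (BLof g)) val_insubd ifT//.
exact/asboolP.
Qed.

Lemma BLof_val (g : BL V V) (h : V -> V) : g = h :> (V -> V) -> g = BLof h.
Proof. by move=> <-; rewrite /BLof -[BL_val g]/(val g) valKd. Qed.

Lemma BL_norm_le (g : BL V V) A : `|g A| <= `|g| * `|A|.
Proof.
have gl := BL_linear g; have [_ _ gZ] := Bsa_lin gl.
have [->|A0] := eqVneq A 0.
  by have := gZ 0 0; rewrite !scale0r => ->; rewrite !normr0 mulr0.
have n0 : `|A| != 0 by rewrite normr_eq0.
have := BL_opnorm_ub g (x := `|A|^-1 *: A).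
rewrite gZ !normrZ normfV normr_id mulVf// => /(_ (lexx _)).
by rewrite ler_pdivrMl ?normr_gt0// mulrC.
Qed.

Lemma dagger_dist s (f h : H -> H) (d : R) : slin s f -> slin s h ->
  bounded_map f -> bounded_map h -> (forall x, rnorm (f x - h x) <= d * rnorm x) ->
  forall x, rnorm (dagger f x - dagger h x) <= d * rnorm x.
Proof.
move=> fs hs fb hb fh x.
have [->|/rnorm_gt0 r0] := eqVneq (dagger f x - dagger h x) 0.
  by rewrite rnorm0 (le_trans (rnorm_ge0 _) (fh x)).
rewrite -(ler_pM2l r0) -expr2 -ipxx; set v := dagger f x - dagger h x in r0 *.
have -> : ip v v = ip (f v - h v) x.
  by rewrite {1}/v !ipDl !ipNl (dagger_ip fs fb) (dagger_ip hs hb) (ipC v) (ipC v) .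
rewrite (le_trans (ler_norm _))// (le_trans (ip_le _ _))//.
rewrite mulrA (mulrC (rnorm v)) ler_wpM2r ?rnorm_ge0//.
Qed.

(** Telescoping as (f - h) A f^dagger + h A (f^dagger - h^dagger), with the adjoints as close as the
    maps, gives twice M d. *)
Lemma cnj_dist s (f h : H -> H) (M d : R) : sinv s f -> sinv s h ->
  bnd f M -> bnd h M -> 0 <= d -> (forall x, rnorm (f x - h x) <= d * rnorm x) ->
  `|BLof (cnj f) - BLof (cnj h)| <= 2 * M * d.
Proof.
move=> fi hi fM hM d0 fh; have [M0 fM'] := fM; have [_ hM'] := hM.
have [_ dfM] := dagger_bnd fi.1 fM.
have dd := dagger_dist fi.1 hi.1 (sinv_bounded fi) (sinv_bounded hi) fh.
apply: BL_opnorm_le => A A1.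
rewrite -[X in `|X|]/(BLof (cnj f) A - BLof (cnj h) A).
rewrite (BLofE (cnj_GL fi)) (BLofE (cnj_GL hi)).
apply: Bsa_normP => [|x]; first by rewrite !mulr_ge0.
rewrite BsaB (cnj_val fi) (cnj_val hi).
rewrite -(subrKA (h (A (dagger f x)))) -(slinB hi.1) -(slinB (Bsa_slin A)).
have A1' z : rnorm (A z) <= rnorm z.
  by rewrite (le_trans (Bsa_norm_le _ _))// ler_piMl// rnorm_ge0.
rewrite (le_trans (rnormD _ _))//.
have h1 : rnorm (f (A (dagger f x)) - h (A (dagger f x))) <= M * d * rnorm x.
  by rewrite (le_trans (fh _))// [M * d]mulrC -mulrA ler_wpM2l// (le_trans (A1' _)).
have h2 : rnorm (h (A (dagger f x - dagger h x))) <= M * d * rnorm x.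
  rewrite (le_trans (hM' _))// -mulrA ler_wpM2l// (le_trans (A1' _))//.
by rewrite -!mulrA mulr_natl mulr2n !mulrA lerD.
Qed.

Lemma cnj_path s (S : set (BL V V)) (F : R -> H -> H) (M C : R) : 0 <= C ->
  (forall t, 0 <= t <= 1 ->
     [/\ sinv s (F t), bnd (F t) M & S (BLof (cnj (F t)))]) ->
  (forall t u x, 0 <= t <= 1 -> 0 <= u <= 1 ->
     rnorm (F t x - F u x) <= C * `|t - u| * rnorm x) ->
  connected_component S (BLof (cnj (F 0))) (BLof (cnj (F 1))).
Proof.
move=> C0 Fs Fl; exists [set BLof (cnj (F t)) | t in `[0, 1]]; last first.
  by exists 1 => //=; rewrite in_itv /= lexx ler01.
split.
- by exists 0 => //=; rewrite in_itv /= lexx ler01.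
- by move=> _ [t /= + <-]; rewrite in_itv /= => /Fs[].
- apply: (@lipschitz_connected _ _ _ (2 * M * C)) => t u t01 u01.
  have [ti tM _] := Fs _ t01; have [ui uM _] := Fs _ u01.
  rewrite -mulrA; apply: (cnj_dist ti ui tM uM) => [|x].
    by rewrite mulr_ge0.
  exact: Fl.
Qed.

Definition induced_by s : set (BL V V) :=
  [set g | exists f : H -> H, sinv s f /\ g = cnj f :> (V -> V)].

Definition uinduced_by s : set (BL V V) :=
  [set g | exists f : H -> H, suni s f /\ g = cnj f :> (V -> V)].

Lemma suni_bnd s W : suni s W -> bnd W 1.
Proof. by move=> Wu; split=> // x; rewrite mul1r (suni_rnorm _ Wu). Qed.

Lemma BLof_uinduced s W : suni s W -> uinduced_by s (BLof (cnj W)).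
Proof.
by move=> Wu; exists W; split=> //; rewrite BLofE//; exact: cnj_GL (suni_sinv Wu).1.
Qed.

Lemma BLof_induced s f : sinv s f -> induced_by s (BLof (cnj f)).
Proof. by move=> fi; exists f; split=> //; rewrite BLofE//; exact: cnj_GL fi. Qed.

Lemma uinduced_sub s : uinduced_by s `<=` induced_by s.
Proof. by move=> g [W [Wu gW]]; exists W; split=> //; exact: (suni_sinv Wu).1. Qed.

(** W W0^-1 is unitary for either type, so its two Cayley factors, deformed to 1 and composed with
    W0, give a path within one type. *)
Lemma uinduced_connected s W0 W : suni s W0 -> suni s W ->
  connected_component (uinduced_by s) (BLof (cnj W0)) (BLof (cnj W)).
Proof.
move=> W0u Wu; have [_ [V0 [V0u V0K W0K _]]] := suni_sinv W0u.
have Uu : suni false (W \o V0) by have := suni_comp Wu V0u; rewrite addbb.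
have [K1 [K2 WK]] := unitary_cay Uu.
pose F (t : R) := cay (t *: K1) \o (cay (t *: K2) \o W0).
have F0 : F 0 = W0 by apply/funext => x; rewrite /F /= !scale0r !cay0.
have F1 : F 1 = W by apply/funext => x; rewrite /F /= !scale1r -WK /= V0K.
rewrite -{1}F0 -F1.
have Fu t : suni s (F t) := suni_comp (cay_suni _) (suni_comp (cay_suni _) W0u).
pose L (K : V) := 2 * (Re `|iC R| * `|K|).
have L0 K : 0 <= L K.
  by rewrite !mulr_ge0//; have := normr_ge0 (iC R); rewrite lecE => /andP[].
apply: (@cnj_path s _ F 1 (L K2 + L K1)); first exact: addr_ge0.
  move=> t _; split; [exact: (suni_sinv (Fu t)).1|exact: suni_bnd (Fu t)|].
  exact: BLof_uinduced.
move=> t u x _ _; rewrite /F /= -(subrKA (cay (t *: K1) (cay (u *: K2) (W0 x)))).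
rewrite -(slinB (let: And3 cs _ _ := cay_suni (t *: K1) in cs)).
rewrite (le_trans (rnormD _ _))// (suni_rnorm _ (cay_suni _)) !mulrDl.
rewrite -(suni_rnorm x W0u) lerD//; first exact: cay_lipschitz.
by rewrite -(suni_rnorm (W0 x) (cay_suni (u *: K2))) cay_lipschitz.
Qed.

Lemma induced_polar_connected s f : sinv s f -> exists W, suni s W /\
  connected_component (induced_by s) (BLof (cnj f)) (BLof (cnj W)).
Proof.
move=> fi; have [W Wu fW] := polar_ex fi; exists W; split=> //.
have [XO _] := abs_daggerP fi; move: (abs_dagger f) XO fW => X XO fW.
have [c c0 Xc] := (OmegaP X).1 XO.
pose P (t : R) : V := (1 - t) *: X + t *: Bsa1 H.
have PE t x : P t x = (1 - t)%:C *: X x + t%:C *: x by [].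
have PO t : 0 <= t <= 1 -> Omega (P t).
  (* The constant is c for X and 1 for the identity; their minimum serves for every convex
     combination. *)
  move=> /andP[t0 t1]; apply/OmegaP; exists (Num.min c 1).
    by rewrite lt_min c0 ltr01.
  move=> x; rewrite PE ipDl !ipZl ipxx.
  have m1 : Num.min c 1 <= c by rewrite ge_min lexx.
  have m2 : Num.min c 1 <= 1 by rewrite ge_min lexx orbT.
  have r0 : 0 <= rnorm x ^+ 2 by rewrite sqr_ge0.
  have := Xc x; move: (Num.min c 1) (rnorm x ^+ 2) (ip (X x) x) m1 m2 r0 => m r q m1 m2 r0 hq.
  have h1 : m * r <= q by apply: le_trans hq; rewrite ler_wpM2r.
  have h2 : m * r <= r by rewrite ler_piMl.
  have t1' : 0 <= 1 - t by rewrite subr_ge0.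
  have := ler_wpM2l t1' h1; have := ler_wpM2l t0 h2; lra.
pose F (t : R) := P t \o W.
have F0 : F 0 = f.
  rewrite fW; apply/funext => x; rewrite -[LHS]/(P 0 (W x)) PE.
  by rewrite subr0 scale1r rmorph0 scale0r addr0.
have F1 : F 1 = W.
  apply/funext => x; rewrite -[LHS]/(P 1 (W x)) PE.
  by rewrite subrr scale0r add0r rmorph1 scale1r.
rewrite -{1}F0 -F1.
have Fi t : 0 <= t <= 1 -> sinv s (F t).
  by move=> t01; have := sinv_comp (Bsa_sinv (PO _ t01)) (suni_sinv Wu).1.
have X1 y : rnorm (X y) <= `|X| * rnorm y := Bsa_norm_le X y.
apply: (@cnj_path s _ F (`|X| + 1) (`|X| + 1)); first by rewrite addr_ge0.
  move=> t t01; split; [exact: Fi| |exact/BLof_induced/Fi].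
  split=> [|x]; first by rewrite addr_ge0.
  rewrite -[F t x]/(P t (W x)) PE (le_trans (rnormD _ _))// !rnormZr (suni_rnorm _ Wu).
  move: t01 => /andP[t0 t1]; rewrite !ger0_norm ?subr_ge0//.
  have := X1 (W x); rewrite (suni_rnorm _ Wu) => hX.
  have t1' : 0 <= 1 - t by rewrite subr_ge0.
  have := ler_wpM2l t1' hX; have := rnorm_ge0 x; have := normr_ge0 X.
  have := mulr_ge0 (normr_ge0 X) (rnorm_ge0 x); nra.
move=> t u x _ _; rewrite -[F t x]/(P t (W x)) -[F u x]/(P u (W x)) !PE.
have -> : (1 - t)%:C *: X (W x) + t%:C *: W x -
    ((1 - u)%:C *: X (W x) + u%:C *: W x) = (t - u)%:C *: (W x - X (W x)).
  by apply: inner_ext => w; rewrite !innerE !rmorphB /=; ring.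
rewrite rnormZr mulrAC [leRHS]mulrC ler_wpM2l// (le_trans (rnormB _ _))//.
by rewrite mulrDl mul1r addrC -(suni_rnorm x Wu) lerD2r X1.
Qed.

Lemma induced_connected s W0 f : suni s W0 -> sinv s f ->
  connected_component (induced_by s) (BLof (cnj W0)) (BLof (cnj f)).
Proof.
move=> W0u fi; have [W [Wu fW]] := induced_polar_connected fi.
apply: (connected_component_trans (y := BLof (cnj W))); last exact: connected_component_sym.
apply: connected_component_mono (@uinduced_sub s) _ _.
exact: uinduced_connected.
Qed.

(** The defect of u is split into P(u - v), (P - P')v, (|P'| - |P|)v and |P|(u - v), each of order
    d. The bound d <= 1 controls |v| by |u| + D. *)
Lemma norm_eigen_perturb (P P' : V) (u v : H) (d D K : R) : 0 <= d -> 0 <= D ->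
  d <= 1 -> `|P - P'| <= d * K -> rnorm (u - v) <= d * D ->
  P' v = (`|P'|)%:C *: v ->
  rnorm (P u - (`|P|)%:C *: u) <= d * (2 * (`|P| * D) + 2 * (K * (rnorm u + D))).
Proof.
move=> d0 D0 d1 PP uv Pv.
have dK0 : 0 <= d * K := le_trans (normr_ge0 _) PP.
have vD : rnorm v <= rnorm u + D.
  rewrite -(subrK u v) addrC (le_trans (rnormD _ _))// lerD2l rnorm_distC.
  by rewrite (le_trans uv)// ler_piMl.
have -> : P u - (`|P|)%:C *: u = P (u - v) + (P v - P' v)
    + (`|P'| - `|P|)%:C *: v - (`|P|)%:C *: (u - v).
  rewrite (slinB (Bsa_slin P)) Pv.
  by apply: inner_ext => z; rewrite !innerE rmorphB /=; ring.
have t1 : rnorm (P (u - v)) <= `|P| * (d * D).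
  by rewrite (le_trans (Bsa_norm_le _ _))// ler_wpM2l.
have t2 : rnorm (P v - P' v) <= d * K * (rnorm u + D).
  rewrite -BsaB (le_trans (Bsa_norm_le _ _))//.
  by rewrite ler_pM ?rnorm_ge0.
have t3 : rnorm ((`|P'| - `|P|)%:C *: v) <= d * K * (rnorm u + D).
  rewrite rnormZr ler_pM ?rnorm_ge0//.
  by rewrite (le_trans (ler_dist_dist _ _))// distrC.
have t4 : rnorm ((`|P|)%:C *: (u - v)) <= `|P| * (d * D).
  by rewrite rnormZr normr_id ler_wpM2l.
rewrite (le_trans (rnormB _ _))// (le_trans (lerD (rnormD _ _) (lexx _)))//.
rewrite (le_trans (lerD (lerD (rnormD _ _) (lexx _)) (lexx _)))//.
rewrite (le_trans (lerD (lerD (lerD t1 t2) t3) t4))//.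
by rewrite le_eqVlt; apply/orP; left; apply/eqP; ring.
Qed.

(** * A closed condition that tells linear from antilinear *)

Section Orientation.
Variables (x y : H).

(* For g = f . f^dagger with u = f x, v = f y, the vector [orient s g w] is
   2 <w,v> u if f is linear (s = false), resp. antilinear (s = true), and
   2 <w,u> v in the other case. *)
Definition orient s (g : V -> V) w : H :=
  g (prj2 x y) w - cj s (iC R) *: g (prj2 (iC R *: x) y) w.

(** For g induced by f, it says that the vector is a multiple of u = f x: it is an eigenvector of
    |u><u| for |u|^2. Writing |u|^2 as a norm avoids f, and both sides depend continuously on g. *)
Definition oriented s (g : V -> V) : Prop :=
  forall w, g (prj x) (orient s g w) = (`|g (prj x)|)%:C *: orient s g w.

Lemma cnj_prj2 s f u v : sinv s f -> cnj f (prj2 u v) = prj2 (f u) (f v).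
Proof.
move=> fi; have [_ cB _] := Bsa_lin (cnj_linear fi).
by rewrite !prj2_def !cB !(cnj_prj _ fi) (slinD fi.1).
Qed.

Lemma cj_iC_sqr s : cj s (iC R) * cj s (iC R) = -1.
Proof. by rewrite -cjM iC_sqr cjN cj1. Qed.

Lemma cj_iC_conj s : (cj s (iC R))^* = - cj s (iC R).
Proof. by rewrite -cj_conj iC_conj cjN. Qed.

Lemma induced_oriented s f : sinv s f -> oriented s (cnj f).
Proof.
move=> fi w.
have -> : orient s (cnj f) w = (2 * inner w (f y)) *: f x.
  rewrite /orient !(cnj_prj2 _ _ fi) (slinZ fi.1) !prj2E !innerZr cj_iC_conj.
  apply: inner_ext => w'; rewrite !innerE.
  have := cj_iC_sqr s; move: (cj s (iC R)) (inner w (f x)) (inner w (f y)) => i p q ii.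
  move: (inner (f y) w') (inner (f x) w') => B A.
  have -> : p * B + q * A - i * (- i * p * B + q * (i * A)) =
    p * B + q * A + (i * i) * p * B - (i * i) * q * A by ring.
  by rewrite ii; ring.
rewrite (cnj_prj _ fi) prj_norm prjE innerZl innerxx !scalerA.
by congr (_ *: _); rewrite mulrC.
Qed.

(** At w = f x the vector for the opposite sign is 2 |f x|^2 f y, so the eigenvalue equation would
    make f y a multiple of f x, against the independence of x and y. *)
Lemma induced_not_oriented s f : indep x y -> indep y x -> sinv s f ->
  ~ oriented (~~ s) (cnj f).
Proof.
move=> xy yx fi /(_ (f x)).
have u0 : (rnorm (f x) ^+ 2)%:C != 0 :> R[i].
  rewrite -(rmorph0 (real_complex R)) (inj_eq (@complexI R)) sqrf_eq0 gt_eqF//.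
  rewrite rnorm_gt0//; apply/eqP => fx0; have [h [hi fh hf]] := sinv_inv fi.
  by apply: (xy 0); rewrite scale0r -(fh x) fx0 (slin0 hi.1).
have -> : orient (~~ s) (cnj f) (f x) = (2 * (rnorm (f x) ^+ 2)%:C) *: f y.
  rewrite /orient !(cnj_prj2 _ _ fi) (slinZ fi.1) !prj2E !innerZr cj_iC_conj innerxx.
  have -> : cj (~~ s) (iC R) = - cj s (iC R).
    by case: (s); rewrite /= iC_conj ?opprK.
  apply: inner_ext => w'; rewrite !innerE.
  have := cj_iC_sqr s.
  move: (cj s (iC R)) ((rnorm (f x) ^+ 2)%:C) (inner (f x) (f y)) => i p q ii.
  move: (inner (f y) w') (inner (f x) w') => B A.
  have -> : p * B + q * A - - i * (- i * p * B + q * (i * A)) =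
    p * B + q * A - (i * i) * p * B + (i * i) * q * A by ring.
  by rewrite ii; ring.
rewrite (cnj_prj _ fi) prj_norm prjE innerZl scalerA => e.
have [h [hi fh hf]] := sinv_inv fi.
apply: (yx (cj s (inner (f y) (f x) / (rnorm (f x) ^+ 2)%:C))).
apply: (can_inj fh); rewrite (slinZ fi.1) cjK.
move: e; move: ((rnorm (f x) ^+ 2)%:C : R[i]) u0 => r r0 e.
have := congr1 (fun v => (2 * r * r)^-1 *: v) e; rewrite /= !scalerA.
have -> : (2 * r * r)^-1 * (2 * r * inner (f y) (f x)) = inner (f y) (f x) / r.
  by field; rewrite r0.
have -> : (2 * r * r)^-1 * (r * (2 * r)) = 1 by field; rewrite r0.
by rewrite scale1r => ->.
Qed.

Lemma oriented_closed s : closed [set g : BL V V | oriented s g].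
Proof.
move=> a ca w; apply/eqP; rewrite -subr_eq0; apply/eqP; apply: rnorm_lt0 => e e0.
pose k := Re `|cj s (iC R)|.
have k0 : 0 <= k by have := normr_ge0 (cj s (iC R)); rewrite lecE => /andP[].
set A := prj x; set N1 := prj2 x y; set N2 := prj2 (iC R *: x) y.
pose D := (`|N1| + k * `|N2|) * rnorm w.
have D0 : 0 <= D by rewrite mulr_ge0 ?rnorm_ge0// addr_ge0// mulr_ge0.
pose Q := 2 * (`|a A| * D) + 2 * (`|A| * (rnorm (orient s a w) + D)).
have Q0 : 0 <= Q.
  have q1 : 0 <= `|a A| * D by rewrite mulr_ge0.
  have q2 : 0 <= `|A| * (rnorm (orient s a w) + D).
    by rewrite mulr_ge0// addr_ge0 ?rnorm_ge0.
  by rewrite /Q; lra.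
(* The 1 meets the condition d <= 1 of [norm_eigen_perturb]; the other term makes its bound d * Q at
   most e, with Q + 1 as a positive denominator. *)
pose d := Num.min 1 (e / (Q + 1)).
have Q1 : 0 < Q + 1 by rewrite ltr_wpDl.
have d0 : 0 < d by rewrite lt_min ltr01 divr_gt0.
have [b [ob ab]] := ca _ (nbhsx_ballx a d d0).
have {}ab : `|a - b| <= d by move: ab; rewrite -ball_normE /= => /ltW.
have abv (B : V) : `|a B - b B| <= d * `|B|.
  by rewrite -[X in `|X|]/((a - b) B) (le_trans (BL_norm_le _ _))// ler_wpM2r.
have abx (B : V) z : rnorm (a B z - b B z) <= d * `|B| * rnorm z.
  by rewrite -BsaB (le_trans (Bsa_norm_le _ _))// ler_wpM2r ?rnorm_ge0.
have LD : rnorm (orient s a w - orient s b w) <= d * D.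
  have -> : orient s a w - orient s b w =
      (a N1 w - b N1 w) - cj s (iC R) *: (a N2 w - b N2 w).
    rewrite /orient -/N1 -/N2.
    by apply: inner_ext => z; rewrite !innerE; ring.
  rewrite (le_trans (rnormB _ _))// rnormZ -/k.
  have h1 := abx N1 w; have h2 := ler_wpM2l k0 (abx N2 w).
  by rewrite (le_trans (lerD h1 h2))// le_eqVlt; apply/orP; left; apply/eqP; rewrite /D; ring.
have d1 : d <= 1 by rewrite ge_min lexx.
have dQ : d * Q <= e.
  have : d <= e / (Q + 1) by rewrite ge_min lexx orbT.
  rewrite ler_pdivlMr// => h; apply: le_trans h.
  by rewrite ler_pM2l// lerDl.
apply: le_trans dQ; apply: (norm_eigen_perturb _ _ d1 _ LD (ob w)) => //.
exact: ltW.
Qed.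

End Orientation.

Lemma aut_inv k : Aut_V k -> exists h, [/\ Aut_V h, cancel k h & cancel h k].
Proof.
move=> [[kl [kb [h [hb kh hk]]]] kJ]; exists h; split=> //; split.
  split; first by move=> r A B; apply: (can_inj kh); rewrite kl !hk.
  by split=> //; exists k.
by move=> A B; apply: (can_inj kh); rewrite kJ !hk.
Qed.

(** A - c 1 is a square X^2, and Jordan automorphisms preserve squares and the unit, so k(A) - c 1 =
    k(X)^2 is positive: the same c works. *)
Lemma aut_Omega k A : Aut_V k -> Omega A -> Omega (k A).
Proof.
move=> kA /OmegaP[c c0 Ac]; apply/OmegaP; exists c => // x.
have [[kl _] kJ] := kA; have [_ kB kZ] := Bsa_lin kl.
have p : psd (A - c *: Bsa1 H).
  by move=> z; rewrite !BsaE ipDl ipNl ipZl ipxx subr_ge0.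
have [X [_ XX _]] := sqrt_ex p.
have := psd_sq (k X) x.
rewrite -jordanxx -kJ jordanxx (_ : Bsa_sq X = A - c *: Bsa1 H); last exact: Bsa_ext.
by rewrite kB kZ (aut_one kA) !BsaE ipDl ipNl ipZl ipxx subr_ge0.
Qed.

Lemma aut_G k : Aut_V k -> G_Omega k.
Proof.
move=> kA; split; first by case: kA.
have [h [hA kh hk]] := aut_inv kA.
apply/seteqP; split=> [_ [A AO <-]|A AO]; first exact: aut_Omega.
by exists (h A); [exact: aut_Omega|exact: hk].
Qed.

Hypothesis nz : exists x : H, x <> 0.
Hypothesis dim2 : forall x : H, exists y, forall a, y <> a *: x.

Lemma G_Omega_split :
  [set g : BL V V | G_Omega g] = induced_by false `|` induced_by true.
Proof.
apply/seteqP; split=> g /=.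
  by move=> /(G_induced nz)[[] [f [fi gf]]]; [right|left]; exists f.
by move=> [] [f [fi ->]]; exact: cnj_G fi.
Qed.

Lemma Aut_V_split :
  [set g : BL V V | Aut_V g] = uinduced_by false `|` uinduced_by true.
Proof.
apply/seteqP; split=> g /=.
  move=> gA; have [[] [f [fi gf]]] := G_induced nz (aut_G gA); [right|left];
    by exists f; split=> //; apply/(aut_suni fi); rewrite -gf.
by move=> [] [f [fu ->]]; exact: suni_aut fu.
Qed.

Lemma induced_components :
  [/\ components [set g : BL V V | G_Omega g] =
        [set induced_by false; induced_by true],
      induced_by false <> induced_by true,
      components [set g : BL V V | Aut_V g] =
        [set uinduced_by false; uinduced_by true] &
      uinduced_by false <> uinduced_by true].
Proof.
have [x /eqP x0] := nz; have [y [xy yx]] := dim2_indep dim2 x0.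
have [J Ju] := antiunitary_ex H.
have sub s : induced_by s `<=` [set g : BL V V | oriented x y s g].
  by move=> g [f [fi /= ->]]; exact: induced_oriented.
have usub s : uinduced_by s `<=` [set g : BL V V | oriented x y s g].
  by move=> g /uinduced_sub /sub.
have dis s : induced_by s `&` [set g : BL V V | oriented x y (~~ s) g] = set0.
  rewrite -subset0 => g [[f [fi /= ->]]]; exact: induced_not_oriented.
have udis s : uinduced_by s `&` [set g : BL V V | oriented x y (~~ s) g] = set0.
  by rewrite -subset0 => g [/uinduced_sub gs go]; rewrite -(dis s).
have cl s := @oriented_closed x y s.
have base : uinduced_by true (BLof (cnj J)) by exact: BLof_uinduced.
have base0 : uinduced_by false (BLof (cnj id)) by apply: BLof_uinduced; exact: suni_id.
have conn s W0 : suni s W0 -> forall g, induced_by s g ->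
    connected_component (induced_by s) (BLof (cnj W0)) g.
  by move=> W0u g [f [fi /BLof_val ->]]; exact: induced_connected.
have uconn s W0 : suni s W0 -> forall g, uinduced_by s g ->
    connected_component (uinduced_by s) (BLof (cnj W0)) g.
  by move=> W0u g [f [fi /BLof_val ->]]; exact: uinduced_connected.
split.
- apply: (components_two (sub false) (sub true) (cl _) (cl _) G_Omega_split
    (dis false) (dis true) (uinduced_sub base0) (uinduced_sub base)).
    exact: conn (suni_id H).
  exact: conn Ju.
(* If the parts coincided, the map of the antiunitary J would be linear-induced and yet satisfy the
   antilinear condition. *)
- move=> e; have : (induced_by false `&` [set g : BL V V | oriented x y true g]) (BLof (cnj J)).
    by split; [rewrite e; exact: uinduced_sub|exact: usub].
  by rewrite (dis false).
- apply: (components_two (usub false) (usub true) (cl _) (cl _) Aut_V_split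
    (udis false) (udis true) base0 base).
    exact: uconn (suni_id H).
  exact: uconn Ju.
- move=> e; have : (uinduced_by false `&` [set g : BL V V | oriented x y true g]) (BLof (cnj J)).
    by split; [rewrite e|exact: usub].
  by rewrite (udis false).
Qed.

End OperatorPaths.

Section Dimension.
Variables (R : realType) (H : hilbertType R).
Hypothesis infH : infinite_dimensional H.

Lemma infinite_dimensional_neq0 : exists x : H, x <> 0.
Proof.
have [x hx] := infH (fun _ : 'I_0 => 0); exists x => x0.
by apply: (hx (fun=> 0)); rewrite big_ord0.
Qed.

Lemma infinite_dimensional_indep (x : H) : exists y, forall a, y <> a *: x.
Proof.
have [y hy] := infH (fun _ : 'I_1 => x); exists y => a ya.
by apply: (hy (fun=> a)); rewrite big_ord1.
Qed.

End Dimension.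

Theorem theorem4p3 (R : realType) (H : hilbertType R)
    (infH : infinite_dimensional H) (sepH : separable H) :
  (* 1 *)
  (forall g : Bsa H -> Bsa H,
     G_Omega g <-> exists f : H -> H, semilin_inv f /\ induces f g) /\
  (* 2 *)
  (forall (g : Bsa H -> Bsa H) (f : H -> H),
     G_Omega g -> semilin_inv f -> induces f g ->
     exists gs : Bsa H -> Bsa H,
       unique (is_star g) gs /\
       forall A : Bsa H, gs A = dagger f \o A \o f :> (H -> H)) /\
  (* 3 *)
  (forall (g : Bsa H -> Bsa H) (f h : H -> H),
     semilin_inv f -> semilin_inv h -> induces f g -> induces h g ->
     ((linear f /\ linear h) \/ (antilinear f /\ antilinear h)) /\
     exists l : R[i], `|l| = 1 /\ forall x : H, f x = l *: h x) /\
  (* 4 *)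
  (forall (g : Bsa H -> Bsa H) (f : H -> H),
     semilin_inv f -> induces f g ->
     (exists W : H -> H, is_polar f W) /\
     forall W : H -> H, is_polar f W ->
       [/\ Omega (abs_dagger f),
           exists k : Bsa H -> Bsa H,
             [/\ Aut_V k, induces W k & g = Bsa_U (abs_dagger f) \o k],
           forall (x : Bsa H) (k : Bsa H -> Bsa H),
             Omega x -> Aut_V k -> g = Bsa_U x \o k ->
             x = abs_dagger f /\ induces W k &
           forall A : Bsa H,
             g A = abs_dagger f \o W \o A \o dagger W \o abs_dagger f
               :> (H -> H)]) /\
  (* 5 *)
  (forall (g : Bsa H -> Bsa H) (f : H -> H),
     semilin_inv f -> induces f g ->
     (Aut_V g <-> unitary f \/ antiunitary f)) /\
  (* 6 *)
  (let lin_part := [set g : BL (Bsa H) (Bsa H) | exists f : H -> H,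
         [/\ bounded_invertible f, linear f & induces f g]] in
   let antilin_part := [set g : BL (Bsa H) (Bsa H) | exists f : H -> H,
         [/\ bounded_invertible f, antilinear f & induces f g]] in
   let unitary_part := [set g : BL (Bsa H) (Bsa H) | exists f : H -> H,
         unitary f /\ induces f g] in
   let antiunitary_part := [set g : BL (Bsa H) (Bsa H) | exists f : H -> H,
         antiunitary f /\ induces f g] in
   [/\ components [set g : BL (Bsa H) (Bsa H) | G_Omega g] =
         [set lin_part; antilin_part],
       lin_part <> antilin_part,
       components [set g : BL (Bsa H) (Bsa H) | Aut_V g] =
         [set unitary_part; antiunitary_part] &
       unitary_part <> antiunitary_part]).
Proof.
have nz := infinite_dimensional_neq0 infH.
have dim2 := infinite_dimensional_indep infH.
split.
  move=> g; split=> [/(G_induced nz)[s [f [fi ->]]]|[f [/semilin_invP[s fi]]]].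
    by exists f; split; [apply/semilin_invP; exists s|apply/(induces_cnj _ fi)].
  by move/(induces_cnj _ fi) => ->; exact: cnj_G fi.
split.
  move=> g f _ /semilin_invP[s fi] /(induces_cnj _ fi) ->.
  exists (cnj (dagger f)); split; first exact: cnj_star fi.
  move=> A; apply/funext => x; rewrite (cnj_val (sinv_dagger fi)).
  by rewrite (daggerK fi.1 (sinv_bounded fi)).
split.
  move=> g f h /semilin_invP[s fi] /semilin_invP[t hi].
  move=> /(induces_cnj _ fi) -> /(induces_cnj _ hi) fh.
  have [st l] := cnj_inj nz dim2 fi hi fh; split=> //.
  rewrite -{t}st in hi; case: s fi hi => fi hi; [right|left].
    by split; [exact: fi.1|exact: hi.1].
  by split; apply/linear_slin; [exact: fi.1|exact: hi.1].
split.
  move=> g f /semilin_invP[s fi] /(induces_cnj _ fi).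
  exact: polar_decomposition fi.
split.
  move=> g f /semilin_invP[s fi] /(induces_cnj _ fi) ->; rewrite (aut_suni fi).
  split=> [fu|[/(proj2 (suni_unitary f)) fu|/(proj2 (suni_antiunitary f)) fu]].
  - by case: s fi fu => _ fu; [right; apply/suni_antiunitary|left; apply/suni_unitary].
  (* The type given by [fu] and the type [s] of [fi] are not known to agree; passing through the
     value at 1 avoids comparing them. *)
  - by apply: (cnj1_suni fi); have := aut_one (suni_aut fu).
  - by apply: (cnj1_suni fi); have := aut_one (suni_aut fu).
move=> lin_part antilin_part unitary_part antiunitary_part.
have -> : lin_part = @induced_by R H false.
  apply/seteqP; split=> g [f].
    move=> [fb /linear_slin fl fg]; exists f; have fi : sinv false f by split.
    by split=> //; apply/(induces_cnj _ fi).
  move=> [fi gf]; exists f; split; [exact: fi.2|apply/linear_slin; exact: fi.1|].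
  exact/(induces_cnj _ fi).
have -> : antilin_part = @induced_by R H true.
  apply/seteqP; split=> g [f].
    move=> [fb fl fg]; exists f; have fi : sinv true f by split.
    by split=> //; apply/(induces_cnj _ fi).
  move=> [fi gf]; exists f; split; [exact: fi.2|exact: fi.1|].
  exact/(induces_cnj _ fi).
have -> : unitary_part = @uinduced_by R H false.
  apply/seteqP; split=> g [f [fu fg]]; exists f.
    move/(proj2 (suni_unitary f)): fu => fu; split=> //.
    by apply/(induces_cnj _ (suni_sinv fu).1).
  by split; [exact: (proj1 (suni_unitary f))|apply/(induces_cnj _ (suni_sinv fu).1)].
have -> : antiunitary_part = @uinduced_by R H true.
  apply/seteqP; split=> g [f [fu fg]]; exists f.
    move/(proj2 (suni_antiunitary f)): fu => fu; split=> //.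
    by apply/(induces_cnj _ (suni_sinv fu).1).
  by split; [exact: (proj1 (suni_antiunitary f))|apply/(induces_cnj _ (suni_sinv fu).1)].
exact: induced_components.
Qed.
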